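(* Let $Y_i=(y_{i,1},\dots,y_{i,L})^T=(h_1(X_i),\dots,h_L(X_i))^T$, $i=1,\dots,n$, be i.i.d. copies of a random vector $Y_0=(y_{0,1},\dots,y_{0,L})^T$ with covariance matrix $\Sigma=(\sigma_{l_1,l_2})_{l_1,l_2\in[L]}$, and suppose: 1. there exist constants $C_p>0$ (allowed to depend on $p$) such that $\operatorname{tr}(\Sigma)\ge C_pL$; 2. $Y_0$ has finite fourth moments with $\sup_{l\in[L]}\mathbb E[y_{0,l}^4]<C$ for a constant $C$, and for some $\kappa>2$ and all $u\in\{2,3,4\}$ and $l_1,\dots,l_u\in[L]$, $$|\operatorname{cum}(y_{0,l_1},\dots,y_{0,l_u})|\le C_p^{u/2}\Big(1\vee\max_{1\le i,j\le u}|l_i-l_j|\Big)^{-\kappa}.$$ Then, under the null hypothesis $\mathbb E[Y_0]=\mathbf 0$, for every even positive integer $q$, as $n\to\infty$, $$(q!)^{-1/2}\,n^{q/2}\,\|\Sigma\|_q^{-q/2}\,U_{n,q}\ \xrightarrow{\ \mathcal D\ }\ N(0,1).$$ Furthermore, for any finite set $I$ of even positive integers, the statistics $(U_{n,q})_{q\in I}$ are asymptotically jointly independent.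
   Context: For each $n$, $X_1,\dots,X_n$ are i.i.d. random vectors in $\mathbb R^p$, with $p=p_n\to\infty$ as $n\to\infty$; $\mathcal L=[L]=\{1,\dots,L\}$ is a finite index set with $L=L_p\to\infty$, and $h_l:\mathbb R^p\to\mathbb R$ ($l\in\mathcal L$) are kernels of order one. The distribution of $X_i$, the set $\mathcal L$ and the kernels may vary with $n$, while $q$, $C$, $\kappa$ do not. The statistic is $$U_{n,q}=\sum_{l\in\mathcal L}\frac{(n-q)!}{n!}\sum^{*}_{1\le i_1,\dots,i_q\le n}\ \prod_{c=1}^q h_l(X_{i_c}),$$ where $\sum^*$ is the sum over mutually distinct indices. For even $q$, $\|\Sigma\|_q^q:=\sum_{l_1,l_2\in\mathcal L}\sigma_{l_1,l_2}^q$, and $\|\Sigma\|_q^{-q/2}=(\|\Sigma\|_q^q)^{-1/2}$. $\operatorname{cum}$ denotes the joint cumulant. ''Asymptotically jointly independent'' means that the vector of the normalized statistics (with the normalization displayed in the claim) for $q\in I$ converges in distribution to a vector of independent standard normal variables. *)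

(* Defs.v *)
From HB Require Import structures.
From mathcomp Require Import all_boot all_order all_algebra finmap.
From mathcomp Require Import all_classical all_reals all_analysis.

Set Implicit Arguments.
Unset Strict Implicit.
Unset Printing Implicit Defensive.

Import Order.TTheory GRing.Theory Num.Theory.
Import numFieldNormedType.Exports.

Local Open Scope classical_set_scope.
Local Open Scope ring_scope.

Section random_elements.
Context {R : realType}.

(* Product rule over every finite subfamily. *)
Definition mutually_independent d (T : measurableType d) (P : probability T R)
    d' (T' : measurableType d') (I : finType) (X : I -> T -> T') : Prop :=
  forall (J : {set I}) (A : I -> set T'), (forall i, measurable (A i)) ->
    P [set w | forall i, i \in J -> A i (X i w)] =
    (\prod_(i in J) P (X i @^-1` A i))%E.

Definition eq_in_distribution d (T : measurableType d) (P : probability T R)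
    d' (T' : measurableType d') (X Y : T -> T') : Prop :=
  forall A : set T', measurable A -> P (X @^-1` A) = P (Y @^-1` A).

Definition iid d (T : measurableType d) (P : probability T R)
    d' (T' : measurableType d') (I : finType) (X : I -> T -> T') : Prop :=
  mutually_independent P X /\
  forall i j, eq_in_distribution P (X i) (X j).

Definition covariance_mx d (T : measurableType d) (P : probability T R)
    (L : nat) (Y : T -> L.-tuple R) : 'M[R]_L :=
  \matrix_(l1, l2) fine (covariance P (fun w => tnth (Y w) l1)
                                      (fun w => tnth (Y w) l2)).

(* cum(Z_1, ..., Z_u) is the sum over the set partitions pi of {1, ..., u} of
   (-1)^(|pi| - 1) (|pi| - 1)! \prod_(B in pi) E[\prod_(i in B) Z_i]. *)
Definition joint_cumulant d (T : measurableType d) (P : probability T R)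
    (u : nat) (Z : 'I_u -> T -> R) : R :=
  \sum_(pi : {set {set 'I_u}} | finset.partition pi (finset.setTfor 'I_u))
    (-1) ^+ (#|pi|.-1) * ((#|pi|.-1)`!)%:R *
    \prod_(B in pi) fine ('E_P[fun w => (\prod_(i in B) Z i w)%R])%E.

(* max_(i, j) |l_i - l_j|; the shift between {1, ..., L} and 'I_L does not
   affect the differences. *)
Definition index_spread (u L : nat) (l : 'I_u -> 'I_L) : nat :=
  \max_(i < u) \max_(j < u) `|(l i)%:Z - (l j)%:Z|%N.

End random_elements.

Section convergence_in_distribution.
Context {R : realType}.
Variables (d : nat -> measure_display)
  (T : forall n, measurableType (d n)) (P : forall n, probability (T n) R).

(* Convergence in distribution of real random variables living on possibly
   different probability spaces: convergence of the distribution functions at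
   every continuity point of the limit one. *)
Definition cvg_to_law (Z : forall n, T n -> R) (mu : set R -> \bar R) : Prop :=
  forall t : R, {for t, continuous (fun s => mu `]-oo, s]%classic)} ->
    P n [set w | Z n w <= t] @[n --> \oo] --> mu `]-oo, t]%classic.

Definition joint_cdf d' (T' : measurableType d') (P' : probability T' R)
    (I : finType) (G : I -> T' -> R) (t : {ptws I -> R}) : \bar R :=
  P' [set w | forall i, G i w <= t i].

(* The same notion for random vectors, with joint distribution functions;
   {ptws I -> R} with I finite is R^I with its usual topology. *)
Definition cvg_to_vector (I : finType) (Z : forall n, I -> T n -> R)
    d' (T' : measurableType d') (P' : probability T' R) (G : I -> T' -> R) :
    Prop :=
  forall t : {ptws I -> R}, {for t, continuous (joint_cdf P' G)} ->
    joint_cdf (P n) (Z n) t @[n --> \oo] --> joint_cdf P' G t.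

Definition cvg_to_independent_normals (I : finType)
    (Z : forall n, I -> T n -> R) : Prop :=
  exists (d' : measure_display) (T' : measurableType d')
    (P' : probability T' R) (G : I -> {RV P' >-> R}),
  [/\ mutually_independent P' (fun i => G i : T' -> R),
      forall i (A : set R), measurable A ->
        distribution P' (G i) A = normal_prob 0 1 A
    & cvg_to_vector Z P' (fun i => G i : T' -> R)].

End convergence_in_distribution.

Section statistic.
Context {R : realType}.

(* Tuples of mutually distinct indices are the injections 'I_q -> 'I_n; for
   n < q there are none and the statistic is 0. *)
Definition Ustat (S T : Type) (n L q : nat) (h : 'I_L -> S -> R)
    (X : 'I_n -> T -> S) (w : T) : R :=
  \sum_(l < L) ((n - q)`!)%:R / (n`!)%:R *
    \sum_(i : {ffun 'I_q -> 'I_n} | injectiveb i)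
      \prod_(c < q) h l (X (i c) w).

(* The q-th power of the entrywise q-norm, for even q. *)
Definition qnorm_pow (L : nat) (q : nat) (Sigma : 'M[R]_L) : R :=
  \sum_(l1 < L) \sum_(l2 < L) Sigma l1 l2 ^+ q.

Definition normalized_Ustat (S T : Type) (n L : nat) (Sigma : 'M[R]_L)
    (q : nat) (h : 'I_L -> S -> R) (X : 'I_n -> T -> S) (w : T) : R :=
  ((q`!)%:R `^ (- 2^-1)) * (n%:R `^ (q%:R / 2)) *
  (qnorm_pow q Sigma `^ (- 2^-1)) * Ustat q h X w.

End statistic.

(* Main.v *)
(* The kernels being of order one, U_{n,q} is, up to normalization, the sum
   over l of the elementary symmetric polynomials e_q(Y_{1,l}, ..., Y_{n,l}).
   The recursion e_{q}(k+1) = e_q(k) + Y_{k+1,l} e_{q-1}(k) makes any linear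
   combination of the statistics a martingale in k, and E[e_q e_{q'}] = 0 for
   q <> q'. The conditional variances of its increments are combinations of
   sum_{l,l'} v_{l,l'} e_a(l) e_b(l') with |v| <= |sigma|; the same recursion,
   in which (a, b) decreases, and the summability of the cumulants bound their
   variances by a discrete Gronwall inequality. Hence E[cos(theta . Z + alpha)]
   converges to its Gaussian value with an explicit rate. Together with bounded
   second moments this gives convergence of the probabilities of orthants, by
   sandwiching their indicators between trigonometric polynomials on a large
   window. The limit is N(0, 1) on each coordinate, and the coordinates are
   independent since the limiting variance is the sum of the theta_q^2. *)
Require Import Defs.
From HB Require Import structures.
From mathcomp Require Import all_boot all_order all_algebra finmap.
From mathcomp Require Import all_classical all_reals all_analysis.
From mathcomp Require Import measurable_realfun.
From mathcomp Require Import zify ring lra.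
Import Order.TTheory GRing.Theory Num.Theory.
Import numFieldNormedType.Exports.
Local Open Scope classical_set_scope.
Local Open Scope ring_scope.

Set Implicit Arguments.
Unset Strict Implicit.
Unset Printing Implicit Defensive.

(** * Expectations and independence *)

(** The hypotheses are rigid: the cumulant bound at [u = 2] gives sigma_{l,l} <= C_p, and the trace
    bound then forces equality for every l. Once the observations are divided by sqrt(n C_p), the
    constant C_p disappears, the covariance has unit diagonal, and no remaining bound depends on the
    law of the sample except through n and L. The unit diagonal also gives ||Sigma||_q^q >= C_p^q L
    for even q, so the coefficients of the martingale are of order L^(-1/2). This balances the
    fourth moments, where the decay of the cumulants leaves a total of order L^2 out of the L^4
    quadruples of indices. Conditional expectations are never formed: each statement about them is
    an identity tested against functions of the past, and rests on the independence of two generated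
    sigma-algebras. Every recursion is arranged so that one step costs a factor 1 + 1/n, which n
    steps turn into at most e. *)

Section expectation_layer.
Context d (T : measurableType d) (R : realType) (P : probability T R).
Implicit Types f g : T -> R.

Definition intble f := P.-integrable setT (EFin \o f).

Definition expect f : R := \int[P]_w f w.

Lemma intble_meas f : intble f -> measurable_fun setT f.
Proof. by move=> /(measurable_int P)/measurable_EFinP. Qed.

Lemma intbleD f g : intble f -> intble g -> intble (fun w => f w + g w).
Proof.
move=> If Ig.
by apply: (eq_integrable measurableT _ _ _ (integrableD _ If Ig)).
Qed.

Lemma intbleZ (c : R) f : intble f -> intble (fun w => c * f w).
Proof. by move=> If; apply: (eq_integrable measurableT _ _ _ (integrableZl _ c If)). Qed.

Lemma intbleB f g : intble f -> intble g -> intble (fun w => f w - g w).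
Proof.
move=> If Ig.
by apply: (eq_integrable measurableT _ _ _ (integrableB _ If Ig)).
Qed.

Lemma intble_cst (c : R) : intble (fun=> c).
Proof. exact: finite_measure_integrable_cst. Qed.

Lemma intble_sum (I : Type) (s : seq I) (Q : pred I) (F : I -> T -> R) :
  (forall i, Q i -> intble (F i)) -> intble (fun w => \sum_(i <- s | Q i) F i w).
Proof.
move=> IF; apply: (eq_integrable measurableT _ _ _ (integrable_sum _ s IF)) => //.
by move=> w _ /=; rewrite sumEFin.
Qed.

Lemma intble_le f g : measurable_fun setT f -> intble g ->
  (forall w, `|f w| <= g w) -> intble f.
Proof.
move=> mf Ig fg; apply: (le_integrable measurableT _ _ Ig) => //.
  exact/measurable_EFinP.
by move=> w _ /=; rewrite lee_fin (le_trans (fg w))// ler_norm.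
Qed.

Lemma intble_norm f : intble f -> intble (fun w => `|f w|).
Proof. by move=> If; exact: (integrable_norm If). Qed.

Lemma intble_bounded f (c : R) : measurable_fun setT f ->
  (forall w, `|f w| <= c) -> intble f.
Proof. by move=> mf; apply: intble_le => //; exact: intble_cst. Qed.

Lemma expectD f g : intble f -> intble g ->
  expect (fun w => f w + g w) = expect f + expect g.
Proof. exact: RintegralD. Qed.

Lemma expectB f g : intble f -> intble g ->
  expect (fun w => f w - g w) = expect f - expect g.
Proof. exact: RintegralB. Qed.

Lemma expectZ (c : R) f : intble f -> expect (fun w => c * f w) = c * expect f.
Proof. exact: RintegralZl. Qed.

Lemma expect_cst (c : R) : expect (fun=> c) = c.
Proof. by rewrite /expect Rintegral_cst//= probability_setT mulr1. Qed.

Lemma expect_sum (I : Type) (s : seq I) (Q : pred I) (F : I -> T -> R) :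
  (forall i, Q i -> intble (F i)) ->
  expect (fun w => \sum_(i <- s | Q i) F i w) = \sum_(i <- s | Q i) expect (F i).
Proof.
move=> IF; elim: s => [|i s IH].
  rewrite big_nil; under [X in expect X]eq_fun do rewrite big_nil.
  exact: expect_cst.
rewrite big_cons; under [X in expect X]eq_fun do rewrite big_cons.
case: ifPn => // Qi.
by rewrite expectD ?IH//; [exact: IF|exact: intble_sum].
Qed.

Lemma expect_le f g : intble f -> intble g -> (forall w, f w <= g w) ->
  expect f <= expect g.
Proof. by move=> If Ig fg; apply: le_Rintegral. Qed.

Lemma expect_ge0 f : (forall w, 0 <= f w) -> 0 <= expect f.
Proof. by move=> f0; apply: Rintegral_ge0. Qed.

Lemma expect_norm f : intble f -> `|expect f| <= expect (fun w => `|f w|).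
Proof. by move=> If; apply: le_normr_Rintegral. Qed.

Lemma expect_le_norm f g : intble f -> intble g -> (forall w, `|f w| <= g w) ->
  `|expect f| <= expect g.
Proof.
move=> If Ig fg; apply: (le_trans (expect_norm If)).
by apply: expect_le => //; exact: intble_norm.
Qed.

(** Expanding 0 <= E (|f| - m)^2 with m = E |f| gives m^2 <= E f^2. *)
Lemma expect_sqr_norm f : intble f -> intble (fun w => f w ^+ 2) ->
  expect (fun w => `|f w|) <= Num.sqrt (expect (fun w => f w ^+ 2)).
Proof.
move=> If If2; set m := expect (fun w => `|f w|).
have m0 : 0 <= m by exact: expect_ge0.
rewrite -(ger0_norm m0) -sqrtr_sqr ler_wsqrtr//.
have In := intble_norm If.
have : 0 <= expect (fun w => f w ^+ 2 - 2 * m * `|f w| + m ^+ 2).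
  apply: expect_ge0 => w.
  rewrite -(real_normK (num_real (f w))).
  by have := sqr_ge0 (`|f w| - m); nra.
have I1 := intbleZ (2 * m) In.
rewrite (expectD (intbleB If2 I1) (intble_cst _)) (expectB If2 I1).
rewrite (expectZ _ In) expect_cst.
rewrite -/m; nra.
Qed.

(** The class in which the observations and their polynomials live: it is stable under linear
    combinations, and the product of any four members is integrable. *)
Definition L4 f := measurable_fun setT f /\ intble (fun w => f w ^+ 4).

Lemma L4_cst (c : R) : L4 (fun=> c).
Proof. by split=> //; exact: intble_cst. Qed.

Lemma prod4_le (a b c e : R) :
  `|a * b * c * e| <= a ^+ 4 + b ^+ 4 + c ^+ 4 + e ^+ 4.
Proof.
have ab (u v : R) : `|u * v| <= u ^+ 2 + v ^+ 2.
  by rewrite ler_norml; apply/andP; split;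
    have := sqr_ge0 (u + v); have := sqr_ge0 (u - v);
    have := sqr_ge0 u; have := sqr_ge0 v; nra.
rewrite -mulrA; apply: (le_trans (ab _ _)).
have h (u v : R) : (u * v) ^+ 2 <= u ^+ 4 + v ^+ 4.
  rewrite exprMn.
  have := sqr_ge0 (u ^+ 2 - v ^+ 2); have := sqr_ge0 (u ^+ 2 + v ^+ 2).
  have -> : u ^+ 4 = (u ^+ 2) ^+ 2 by rewrite -exprM.
  have -> : v ^+ 4 = (v ^+ 2) ^+ 2 by rewrite -exprM.
  have := sqr_ge0 (u ^+ 2); have := sqr_ge0 (v ^+ 2); nra.
by rewrite -addrA lerD// h.
Qed.

Lemma L4_prod f1 f2 f3 f4 : L4 f1 -> L4 f2 -> L4 f3 -> L4 f4 ->
  intble (fun w => f1 w * f2 w * f3 w * f4 w).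
Proof.
move=> [m1 i1] [m2 i2] [m3 i3] [m4 i4].
apply: (@intble_le _ (fun w => f1 w ^+ 4 + f2 w ^+ 4 + f3 w ^+ 4 + f4 w ^+ 4)).
- by repeat apply: measurable_funM.
- by repeat apply: intbleD.
- by move=> w; exact: prod4_le.
Qed.

Lemma L4D f g : L4 f -> L4 g -> L4 (fun w => f w + g w).
Proof.
move=> [mf If] [mg Ig]; split; first exact: measurable_funD.
apply: (@intble_le _ (fun w => 8 * f w ^+ 4 + 8 * g w ^+ 4)).
- by apply: measurable_funX; exact: measurable_funD.
- by apply: intbleD; exact: intbleZ.
- move=> w; rewrite ger0_norm ?exprn_even_ge0//.
  set a := f w; set b := g w.
  have -> : (a + b) ^+ 4 = ((a + b) ^+ 2) ^+ 2 by rewrite -exprM.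
  have h1 : (a + b) ^+ 2 <= 2 * a ^+ 2 + 2 * b ^+ 2.
    by have := sqr_ge0 (a - b); nra.
  apply: (@le_trans _ _ ((2 * a ^+ 2 + 2 * b ^+ 2) ^+ 2)).
    by rewrite ler_sqr ?nnegrE ?sqr_ge0// (le_trans _ h1)// sqr_ge0.
  have -> : a ^+ 4 = (a ^+ 2) ^+ 2 by rewrite -exprM.
  have -> : b ^+ 4 = (b ^+ 2) ^+ 2 by rewrite -exprM.
  by have := sqr_ge0 (a ^+ 2 - b ^+ 2); nra.
Qed.

Lemma L4Z (c : R) f : L4 f -> L4 (fun w => c * f w).
Proof.
move=> [mf If]; split; first exact: measurable_funM.
under eq_fun do rewrite exprMn; exact: intbleZ.
Qed.

Lemma L4_sum (I : Type) (s : seq I) (F : I -> T -> R) :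
  (forall i, L4 (F i)) -> L4 (fun w => \sum_(i <- s) F i w).
Proof.
move=> LF; elim: s => [|i s IH].
  by under eq_fun do rewrite big_nil; exact: L4_cst.
by under eq_fun do rewrite big_cons; exact: L4D.
Qed.

Lemma L4_intble f : L4 f -> intble f.
Proof.
move=> Lf; have := L4_prod Lf (L4_cst 1) (L4_cst 1) (L4_cst 1).
by under eq_fun do rewrite !mulr1.
Qed.

Lemma L4_intble2 f g : L4 f -> L4 g -> intble (fun w => f w * g w).
Proof.
move=> Lf Lg; have := L4_prod Lf Lg (L4_cst 1) (L4_cst 1).
by under eq_fun do rewrite !mulr1.
Qed.

Lemma L4_sqr f : L4 f -> intble (fun w => f w ^+ 2).
Proof. by move=> Lf; under eq_fun do rewrite expr2; exact: L4_intble2. Qed.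

Lemma L4_cube f : L4 f -> intble (fun w => f w ^+ 3).
Proof.
move=> Lf; have := L4_prod Lf Lf Lf (L4_cst 1).
by under eq_fun do rewrite mulr1 -expr2 -exprSr.
Qed.

Lemma expect_ext f g : (forall w, f w = g w) -> expect f = expect g.
Proof. by move=> /funext ->. Qed.

Lemma intble_ext f g : (forall w, f w = g w) -> intble f -> intble g.
Proof. by move=> /funext ->. Qed.

End expectation_layer.

(** * Independent factors and generated sigma-algebras *)

Section independence.
Context d (T : measurableType d) (R : realType) (P : probability T R).

Definition indep_fun (f g : T -> R) := forall A B : set R,
  measurable A -> measurable B ->
  P ((f @^-1` A) `&` (g @^-1` B)) = (P (f @^-1` A) * P (g @^-1` B))%E.

(** The law of (f, g) agrees with the product of the two laws on rectangles, hence everywhere, and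
    Fubini applies to the product of the coordinates. Integrability of the product is a conclusion:
    this is what lets polynomials of any degree in the observations keep four moments. *)
Lemma indep_intble_expectM (f g : T -> R) : intble P f -> intble P g ->
  indep_fun f g ->
  intble P (fun w => f w * g w) /\
  expect P (fun w => f w * g w) = expect P f * expect P g.
Proof.
move=> If Ig fg.
have mf := intble_meas If; have mg := intble_meas Ig.
pose X : {RV P >-> R} := HB.pack f (isMeasurableFun.Build _ _ _ _ _ mf).
pose Y : {RV P >-> R} := HB.pack g (isMeasurableFun.Build _ _ _ _ _ mg).
have mfg : measurable_fun setT (fun w => (f w, g w)).
  exact: measurable_fun_pair.
pose Z : {RV P >-> (R * R)%type} :=
  HB.pack (fun w => (f w, g w)) (isMeasurableFun.Build _ _ _ _ _ mfg).
pose mX := distribution P X; pose mY := distribution P Y.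
have law (B : set (R * R)) : measurable B ->
    (mX \x mY)%E B = distribution P Z B.
  move=> mB; apply: (product_measure_unique (m' := distribution P Z)) => //.
pose m (z : R * R) : \bar R := (z.1 * z.2)%:E.
have mm : measurable_fun setT m.
  apply/measurable_EFinP; apply: measurable_funM.
  - exact: measurable_fst.
  - exact: measurable_snd.
have intX : (\int[mX]_x `|x|%:E < +oo)%E.
  rewrite ge0_integral_distribution//; last exact/measurable_EFinP.
  by case/integrableP : If.
have intY : (\int[mY]_x `|x|%:E < +oo)%E.
  rewrite ge0_integral_distribution//; last exact/measurable_EFinP.
  by case/integrableP : Ig.
have im : (mX \x mY)%E.-integrable setT m.
  apply/integrable12ltyP => //=.
  under eq_integral => x _.
    under eq_integral do rewrite normrM EFinM.
    rewrite ge0_integralZl//; last exact/measurable_EFinP.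
    over.
  rewrite ge0_integralZr//; [|exact/measurable_EFinP|exact: integral_ge0].
  by rewrite lte_mul_pinfty// ?integral_ge0// ge0_fin_numE// integral_ge0.
have iZ : (distribution P Z).-integrable setT m.
  apply/integrableP; split => //.
  case/integrableP : im => _; apply: le_lt_trans.
  rewrite le_eqVlt; apply/orP; left; apply/eqP.
  by apply: eq_measure_integral => A mA _; first [exact: (law A mA)|exact: (esym (law A mA))].
have iZ' : intble P (fun w => f w * g w).
  apply/integrableP; split.
    by apply/measurable_EFinP; exact: measurable_funM.
  case/integrableP : iZ => _.
  by rewrite ge0_integral_distribution//; exact: measurableT_comp.
split=> //.
rewrite /expect /Rintegral.
have -> : (\int[P]_w (f w * g w)%:E = \int[distribution P Z]_z m z)%E.
  by rewrite integral_distribution.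
have -> : (\int[distribution P Z]_z m z = \int[(mX \x mY)]_z m z)%E.
  by apply: eq_measure_integral => A mA _; first [exact: (law A mA)|exact: (esym (law A mA))].
rewrite -integral12_prod_meas1// /fubini_F /m /=.
have iX : mX.-integrable setT (fun x : R => x%:E).
  by apply/integrableP; split => //; exact/measurable_EFinP.
have iY : mY.-integrable setT (fun x : R => x%:E).
  by apply/integrableP; split => //; exact/measurable_EFinP.
under eq_integral => x _.
  under eq_integral do rewrite EFinM.
  rewrite integralZl//.
  over.
have iYfin := integrable_fin_num measurableT iY.
rewrite -(fineK iYfin) integralZr//.
rewrite fineM//; last exact: integrable_fin_num.
by rewrite !integral_distribution//=.
Qed.

(** Measurability for the sigma-algebra generated by [G], expressed by retyping the domain so that
    the closure lemmas for measurable functions apply unchanged. *)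
Definition gmeas (G : set (set T)) (f : T -> R) :=
  measurable_fun [set: g_sigma_algebraType G] (f : g_sigma_algebraType G -> R).

Lemma gmeas_sub (G H : set (set T)) f : <<s G >> `<=` <<s H >> ->
  gmeas G f -> gmeas H f.
Proof. by move=> GH mf _ B mB; apply: GH; exact: mf. Qed.

Lemma gmeas_measurable (G : set (set T)) f : G `<=` measurable ->
  gmeas G f -> measurable_fun setT f.
Proof.
move=> GT mf _ B mB.
have : <<s G >> `<=` @measurable _ T.
  by apply: smallest_sub => //; exact: sigma_algebra_measurable.
by apply; exact: mf.
Qed.

(** For a fixed event, the events independent of it form a lambda-system, so the pi-lambda theorem
    extends one side at a time. [key] does this against an arbitrary second family: it is applied to
    [G] against [H], then to [H] against [<<s G >>]. *)
Lemma sigma_indep (G H : set (set T)) : setI_closed G -> setI_closed H ->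
  G `<=` measurable -> H `<=` measurable ->
  (forall A B, G A -> H B -> P (A `&` B) = (P A * P B)%E) ->
  forall A B, <<s G >> A -> <<s H >> B -> P (A `&` B) = (P A * P B)%E.
Proof.
have key (G' H' : set (set T)) : setI_closed G' ->
    G' `<=` measurable -> H' `<=` measurable ->
    (forall A B, G' A -> H' B -> P (A `&` B) = (P A * P B)%E) ->
    forall A B, <<s G' >> A -> H' B -> P (A `&` B) = (P A * P B)%E.
  move=> GI GT HT GH A B sA HB.
  have mB := HT _ HB.
  suff : <<s G' >> `<=`
      [set A : set T | measurable A /\ P (A `&` B) = (P A * P B)%E].
    by move=> /(_ _ sA)[].
  apply: lambda_system_subset => //; last first.
    by move=> X GX /=; split; [exact: GT|exact: GH].
  apply/dynkin_lambda_system; split => /=.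
  - by rewrite setTI probability_setT mul1e.
  - move=> X [mX XB]; split; first exact: measurableC.
    rewrite setIC -setDE measureD//; last first.
      by rewrite (le_lt_trans (probability_le1 _ _))// ltry.
    rewrite probability_setC// muleBl ?fin_num_measure// mul1e.
    by move: XB; rewrite setIC => <-.
  - move=> F tF HF; split; first by apply: bigcup_measurable => k _; case: (HF k).
    rewrite setI_bigcupl measure_bigcup//; last 2 first.
    + by move=> k _; apply: measurableI => //; case: (HF k).
    + exact: trivIset_setIr.
    rewrite measure_bigcup//; last by move=> k _; case: (HF k).
    rewrite muleC -(fineK (fin_num_measure P _ mB)) -nneseriesZl//.
    apply: eq_eseriesr => k _; case: (HF k) => _ HFk.
    by rewrite /= fineK ?fin_num_measure// muleC.
move=> GI HI GT HT GH A B sA sB.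
rewrite setIC muleC.
have sGT : <<s G >> `<=` @measurable _ T.
  by apply: smallest_sub => //; exact: sigma_algebra_measurable.
apply: (key H <<s G >>) => // A' B' HA sB'.
by rewrite setIC muleC; apply: (key G H).
Qed.

End independence.

(** Here [m] is the degree and [k] the number of variables. The defining equation is the step of the
    martingale, which therefore holds by computation. *)
Fixpoint elemsym (R : pzRingType) (x : nat -> R) (m k : nat) : R :=
  match k, m with
  | _, 0 => 1
  | 0, _.+1 => 0
  | k'.+1, m'.+1 => elemsym x m k' + x k' * elemsym x m' k'
  end.

Lemma elemsym0 (R : pzRingType) (x : nat -> R) k : elemsym x 0 k = 1.
Proof. by case: k. Qed.

(** Unfolds the recursion in the number of variables; it will present the statistic as a sum of
    martingale differences. *)
Lemma elemsym_sum (R : pzRingType) (x : nat -> R) m n :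
  elemsym x m.+1 n = \sum_(k < n) x k * elemsym x m k.
Proof. by elim: n => [|n IH]; rewrite ?big_ord0// big_ord_recr/= -IH. Qed.

(** By induction [u k] <= (1 + 1/n)^k k b, and (1 + 1/n)^n <= e. *)
Lemma discrete_gronwall (R : realType) (n : nat) (u : nat -> R) (b : R) :
  0 <= b -> u 0 <= 0 ->
  (forall k, (k < n)%N -> u k.+1 <= (1 + n%:R^-1) * u k + b) ->
  forall k, (k <= n)%N -> u k <= expR 1 * n%:R * b.
Proof.
move=> b0 u0 urec.
case: n urec => [_ [|//] _|n urec k kn]; first by rewrite mulr0 mul0r.
pose c : R := 1 + n.+1%:R^-1.
have c1 : 1 <= c by rewrite lerDl.
have c0 : 0 <= c by rewrite (le_trans ler01).
have H j : (j <= n.+1)%N -> u j <= c ^+ j * j%:R * b.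
  elim: j => [_|j IH jn]; first by rewrite mulr0 mul0r.
  apply: (le_trans (urec _ jn)); rewrite -/c.
  have := IH (ltnW jn) => /(ler_wpM2l c0); rewrite !mulrA -exprS => h.
  apply: (le_trans (lerD h (lexx b))).
  rewrite -natr1 mulrDr mulr1 mulrDl lerD2l ler_peMl//.
  by rewrite exprn_ege1.
apply: (le_trans (H k kn)); apply: ler_wpM2r => //.
apply: ler_pM => //; [exact: exprn_ge0| |by rewrite ler_nat].
apply: (@le_trans _ _ (c ^+ n.+1)).
  by rewrite ler_weXn2l.
have : c <= expR (n.+1%:R^-1) by exact: expR_ge1Dx.
move=> /(lerXn2r n.+1); rewrite !nnegrE => /(_ c0 (expR_ge0 _)).
by move/le_trans; apply; rewrite -expRM_natl mulfV.
Qed.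

(** * Second and fourth moments of linear combinations *)

Section L2.
Context d (T : measurableType d) (R : realType) (P : probability T R).
Implicit Types f g : T -> R.
Local Notation E := (expect P).
Local Notation intble := (intble P).
Local Notation L4 := (L4 P).

Definition L2 f := measurable_fun setT f /\ intble (fun w => f w ^+ 2).

Lemma mulr_norm_le (a b : R) : `|a * b| <= 2^-1 * a ^+ 2 + 2^-1 * b ^+ 2.
Proof.
by rewrite ler_norml; apply/andP; split;
  have := sqr_ge0 (a + b); have := sqr_ge0 (a - b); nra.
Qed.

Lemma L2_intbleM f g : L2 f -> L2 g -> intble (fun w => f w * g w).
Proof.
move=> [mf If] [mg Ig].
apply: (@intble_le _ _ _ _ _ (fun w => 2^-1 * f w ^+ 2 + 2^-1 * g w ^+ 2)).
- exact: measurable_funM.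
- by apply: intbleD; exact: intbleZ.
- by move=> w; exact: mulr_norm_le.
Qed.

Lemma L2_cst (c : R) : L2 (fun=> c).
Proof. by split => //; exact: intble_cst. Qed.

Lemma L2_intble f : L2 f -> intble f.
Proof.
move=> Lf; have := L2_intbleM Lf (L2_cst 1).
by under eq_fun do rewrite mulr1.
Qed.

Lemma L2D f g : L2 f -> L2 g -> L2 (fun w => f w + g w).
Proof.
move=> Lf Lg; have [[mf If] [mg Ig]] := (Lf, Lg).
split; first exact: measurable_funD.
apply: (@intble_ext _ _ _ _ (fun w => f w ^+ 2 + 2 * (f w * g w) + g w ^+ 2)).
  by move=> w; ring.
by apply: intbleD => //; apply: intbleD => //; apply: intbleZ; exact: L2_intbleM.
Qed.

Lemma L2Z (c : R) f : L2 f -> L2 (fun w => c * f w).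
Proof.
move=> [mf If]; split; first exact: measurable_funM.
by under eq_fun do rewrite exprMn; exact: intbleZ.
Qed.

Lemma L2B f g : L2 f -> L2 g -> L2 (fun w => f w - g w).
Proof.
move=> Lf Lg; have := L2D Lf (L2Z (-1) Lg).
by under eq_fun do rewrite mulN1r.
Qed.

Lemma L2_sum (I : Type) (s : seq I) (F : I -> T -> R) :
  (forall i, L2 (F i)) -> L2 (fun w => \sum_(i <- s) F i w).
Proof.
move=> LF; elim: s => [|i s IH].
  by under eq_fun do rewrite big_nil; exact: L2_cst.
by under eq_fun do rewrite big_cons; exact: L2D.
Qed.

Lemma L4_L2 f : L4 f -> L2 f.
Proof. by move=> Lf; split; [case: Lf|exact: L4_sqr]. Qed.

Lemma L4_L2M f g : L4 f -> L4 g -> L2 (fun w => f w * g w).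
Proof.
move=> Lf Lg; split; first by apply: measurable_funM; [case: Lf|case: Lg].
apply: (intble_ext _ (L4_prod Lf Lf Lg Lg)) => w; ring.
Qed.

(** The pointwise bound ab <= (a^2 + b^2) / 2 replaces Cauchy-Schwarz without loss, both factors
    having the same bound [K]. *)
Lemma expect_mul_le f g (K : R) : L2 f -> L2 g ->
  E (fun w => f w ^+ 2) <= K -> E (fun w => g w ^+ 2) <= K ->
  `|E (fun w => f w * g w)| <= K.
Proof.
move=> Lf Lg fK gK.
have If : intble (fun w => 2^-1 * f w ^+ 2) by apply: intbleZ; case: Lf.
have Ig : intble (fun w => 2^-1 * g w ^+ 2) by apply: intbleZ; case: Lg.
apply: le_trans (expect_le_norm (L2_intbleM Lf Lg) (intbleD If Ig) _) _.
  by move=> w; exact: mulr_norm_le.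
rewrite expectD// !expectZ; [lra|by case: Lg|by case: Lf].
Qed.

Lemma expect_sqr_mul_le f g (K : R) : L4 f -> L4 g ->
  E (fun w => f w ^+ 4) <= K -> E (fun w => g w ^+ 4) <= K ->
  E (fun w => (f w * g w) ^+ 2) <= K.
Proof.
move=> Lf Lg fK gK.
under [X in expect _ X]eq_fun do rewrite exprMn.
apply: le_trans (ler_norm _) _.
have L f' : L4 f' -> L2 (fun w => f' w ^+ 2).
  by move=> Lf'; under eq_fun do rewrite expr2; exact: L4_L2M.
apply: expect_mul_le; [exact: L|exact: L| |];
  by under [X in expect _ X]eq_fun do rewrite -exprM.
Qed.

Lemma expect_prod4_le (K : R) f1 f2 f3 f4 : L4 f1 -> L4 f2 -> L4 f3 -> L4 f4 ->
  E (fun w => f1 w ^+ 4) <= K -> E (fun w => f2 w ^+ 4) <= K ->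
  E (fun w => f3 w ^+ 4) <= K -> E (fun w => f4 w ^+ 4) <= K ->
  `|E (fun w => f1 w * f2 w * f3 w * f4 w)| <= K.
Proof.
move=> L1 L2' L3 L4' h1 h2 h3 h4.
rewrite (_ : (fun w => _) = (fun w => (f1 w * f2 w) * (f3 w * f4 w))).
  by apply: expect_mul_le; [exact: L4_L2M|exact: L4_L2M|
    exact: expect_sqr_mul_le|exact: expect_sqr_mul_le].
by apply/funext => w; rewrite !mulrA.
Qed.

(** After expansion of the square each mixed moment is at most [V]; only absolute coefficients
    count, so the [F j] may be arbitrarily dependent. *)
Lemma expect_sqr_sum_le (J : finType) (c : J -> R) (F : J -> T -> R) (V : R) :
  (forall j, L2 (F j)) -> (forall j, E (fun w => F j w ^+ 2) <= V) ->
  E (fun w => (\sum_j c j * F j w) ^+ 2) <= (\sum_j `|c j|) ^+ 2 * V.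
Proof.
move=> LF VF.
have ID i j : intble (fun w => c i * c j * (F i w * F j w)).
  by apply: intbleZ; exact: L2_intbleM.
have -> : E (fun w => (\sum_j c j * F j w) ^+ 2) =
    E (fun w => \sum_i \sum_j c i * c j * (F i w * F j w)).
  apply: expect_ext => w.
  rewrite expr2 mulr_suml; apply: eq_bigr => i _.
  rewrite mulr_sumr; apply: eq_bigr => j _.
  ring.
rewrite expect_sum; last by move=> i _; apply: intble_sum => j _.
rewrite expr2 mulr_suml mulr_suml ler_sum// => i _.
rewrite expect_sum; last by move=> j _.
rewrite mulr_sumr mulr_suml ler_sum// => j _.
rewrite expectZ; last exact: L2_intbleM.
apply: (le_trans (ler_norm _)); rewrite !normrM.
by apply: ler_wpM2l => //; apply: expect_mul_le.
Qed.

Definition var f := E (fun w => (f w - E f) ^+ 2).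

Lemma var_sum_le (J : finType) (c : J -> R) (F : J -> T -> R) (V : R) :
  (forall j, L2 (F j)) -> (forall j, var (F j) <= V) ->
  var (fun w => \sum_j c j * F j w) <= (\sum_j `|c j|) ^+ 2 * V.
Proof.
move=> LF VF.
have LD j : L2 (fun w => F j w - E (F j)) by apply: L2B => //; exact: L2_cst.
apply: le_trans (expect_sqr_sum_le c LD VF); rewrite le_eqVlt; apply/orP; left; apply/eqP.
rewrite /var expect_sum; last by move=> j _; apply: intbleZ; exact: L2_intble.
apply: expect_ext => w; congr (_ ^+ 2); rewrite -sumrB; apply: eq_bigr => j _.
by rewrite expectZ ?mulrBr//; exact: L2_intble.
Qed.

(** The fourth power is the square of a sum over pairs of indices with summands [F i * F j], to
    which [expect_sqr_sum_le] applies. *)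
Lemma expect_4_sum_le (J : finType) (c : J -> R) (F : J -> T -> R) (V : R) :
  (forall j, L4 (F j)) -> (forall j, E (fun w => F j w ^+ 4) <= V) ->
  E (fun w => (\sum_j c j * F j w) ^+ 4) <= (\sum_j `|c j|) ^+ 4 * V.
Proof.
move=> LF VF.
have -> : E (fun w => (\sum_j c j * F j w) ^+ 4) =
    E (fun w => (\sum_(p : J * J) (c p.1 * c p.2) * (F p.1 w * F p.2 w)) ^+ 2).
  apply: expect_ext => w.
  rewrite (exprM _ 2 2); congr (_ ^+ 2); rewrite expr2.
  rewrite mulr_suml -(pair_bigA _ (fun i j => (c i * c j) * (F i w * F j w)))/=.
  apply: eq_bigr => i _; rewrite mulr_sumr; apply: eq_bigr => j _; ring.
apply: (le_trans (expect_sqr_sum_le (V := V) _ _ _)).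
- by move=> [i j] /=; exact: L4_L2M.
- by move=> [i j] /=; exact: expect_sqr_mul_le.
rewrite le_eqVlt; apply/orP; left; apply/eqP; congr (_ * _).
rewrite (exprM _ 2 2); congr (_ ^+ 2).
rewrite expr2 mulr_suml -(pair_bigA _ (fun i j => `|c i * c j|))/=.
by apply: eq_bigr => i _; rewrite mulr_sumr; apply: eq_bigr => j _; rewrite normrM.
Qed.

End L2.

(** * Taylor bounds *)

Section trig_bounds.
Variable R : realType.
Implicit Types x y z : R.

Lemma within_continuous_sub (f : R -> R) (A : set R) :
  continuous f -> {within A, continuous f}.
Proof. by move=> cf; apply: continuous_subspaceT. Qed.

Lemma sin_ubound z : 0 <= z -> `|sin z| <= z.
Proof.
move=> z0.
have cx : {within `[0, z], continuous (@sin R)}.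
  exact/within_continuous_sub/continuous_sin.
have [c _] := @MVT_segment R sin cos 0 z z0 (fun x _ => is_derive_sin x) cx.
rewrite sin0 !subr0 => ->; rewrite normrM (ger0_norm z0).
by rewrite ler_piMl// cos_max.
Qed.

Lemma cos_double y : cos (2 * y) = 1 - 2 * sin y ^+ 2.
Proof.
rewrite [X in cos X](_ : _ = y + y); last by ring.
by rewrite cosD -!expr2 cos2sin2; ring.
Qed.

Lemma cos_lbound z : 0 <= z -> 1 - cos z <= z ^+ 2 / 2.
Proof.
move=> z0; have -> : z = 2 * (z / 2) by field.
have h : `|sin (z / 2)| <= z / 2 by apply: sin_ubound; rewrite divr_ge0.
have : `|sin (z / 2)| ^+ 2 <= (z / 2) ^+ 2.
  by apply: lerXn2r => //; rewrite nnegrE// divr_ge0.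
rewrite real_normK ?num_real// cos_double.
set s := sin _; set t := z / 2; nra.
Qed.

Lemma sin_lbound z : 0 <= z -> 0 <= z - sin z <= z ^+ 3 / 2.
Proof.
move=> z0.
have dx x : x \in `]0, z[ -> is_derive x 1 (fun x => x - sin x) (1 - cos x).
  by move=> _; exact: is_deriveB.
have cx : {within `[0, z], continuous (fun x => x - sin x)}.
  apply: within_continuous_sub => x; apply: continuousB => //.
  exact: continuous_sin.
have [c] := @MVT_segment R (fun x => x - sin x) (fun x => 1 - cos x) 0 z z0 dx cx.
rewrite in_itv/= => /andP[c0 cz]; rewrite sin0 !subr0 => ->.
have c1 := cos_le1 c; apply/andP; split; first by rewrite mulr_ge0// subr_ge0.
have h := cos_lbound c0.
have : c ^+ 2 <= z ^+ 2 by apply: lerXn2r => //; rewrite nnegrE.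
move=> cz2; have : 1 - cos c <= z ^+ 2 / 2 by lra.
move=> /(ler_wpM2r z0)/le_trans; apply.
by rewrite le_eqVlt; apply/orP; left; apply/eqP; ring.
Qed.

(** With y = z / 2 the left side is 2 (y - sin y)(y + sin y), so the bounds on the sine at y
    suffice. *)
Lemma cos_taylor2 z : 0 <= z -> `|cos z - 1 + z ^+ 2 / 2| <= z ^+ 3 / 4.
Proof.
move=> z0; set y := z / 2; have zy : z = 2 * y by rewrite /y; field.
have y0 : 0 <= y by rewrite divr_ge0.
have /andP[h1 h2] := sin_lbound y0.
have := sin_ubound y0; rewrite ler_norml => /andP[h3 h4].
have -> : cos z - 1 + z ^+ 2 / 2 = 2 * ((y - sin y) * (y + sin y)).
  by rewrite zy cos_double; field.
have p0 : 0 <= y + sin y by lra.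
rewrite ger0_norm; last by rewrite !mulr_ge0.
have -> : z ^+ 3 / 4 = 2 * y ^+ 3 by rewrite zy; field.
apply: ler_wpM2l => //.
(* For y <= 1 the product is at most (y^3 / 2)(2 y) = y^4 <= y^3; for y > 1 it equals y^2 - sin(y)^2
   <= y^2 <= y^3. *)
have [y1|y1] := lerP y 1.
  apply: (@le_trans _ _ (y ^+ 3 / 2 * (2 * y))).
    by apply: ler_pM => //; lra.
  have -> : y ^+ 3 / 2 * (2 * y) = y ^+ 3 * y by field.
  by rewrite ler_piMr// exprn_ge0.
have -> : (y - sin y) * (y + sin y) = y ^+ 2 - sin y ^+ 2 by ring.
have := sqr_ge0 (sin y) => s2.
apply: (@le_trans _ _ (y ^+ 2)); first lra.
by rewrite [leRHS]exprSr ler_peMr ?sqr_ge0// ltW.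
Qed.

(** The addition formula separates the remainders of the cosine and of the sine, at most 1/4 and 1/2
    of |z|^3; parity reduces both to z >= 0. *)
Lemma cosD_taylor2 y z :
  `|cos (y + z) - (cos y - z * sin y - z ^+ 2 / 2 * cos y)| <= `|z| ^+ 3.
Proof.
rewrite cosD.
have -> : cos y * cos z - sin y * sin z - (cos y - z * sin y - z ^+ 2 / 2 * cos y)
  = cos y * (cos z - 1 + z ^+ 2 / 2) + sin y * (z - sin z) by ring.
have n0 := normr_ge0 z.
have h1 : `|cos z - 1 + z ^+ 2 / 2| <= `|z| ^+ 3 / 4.
  by have := cos_taylor2 n0; rewrite cos_norm real_normK ?num_real.
have h2 : `|z - sin z| <= `|z| ^+ 3 / 2.
  have /andP[a b] := sin_lbound n0.
  suff <- : `|(`|z| - sin `|z|)| = `|z - sin z| by rewrite (ger0_norm a).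
  have [z0|z0] := ger0P z; first by [].
  by rewrite sinN -[RHS]normrN; congr `|_|; ring.
have z3 : 0 <= `|z| ^+ 3 by rewrite exprn_ge0.
apply: (le_trans (ler_normD _ _)); rewrite !normrM.
have h3 : `|cos y| * `|cos z - 1 + z ^+ 2 / 2| <= 1 * (`|z| ^+ 3 / 4).
  by apply: ler_pM => //; exact: cos_max.
have h4 : `|sin y| * `|z - sin z| <= 1 * (`|z| ^+ 3 / 2).
  by apply: ler_pM => //; exact: sin_max.
lra.
Qed.

(** For the upper bound, e^v >= 1 + v and (1 - v + v^2)(1 + v) = 1 + v^3 >= 1. *)
Lemma expRN_bounds (v : R) : 0 <= v -> 1 - v <= expR (- v) <= 1 - v + v ^+ 2.
Proof.
move=> v0; apply/andP; split; first exact: expR_ge1Dx.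
rewrite expRN -[leLHS]mul1r ler_pdivrMr ?expR_gt0//.
have h : 1 + v <= expR v by exact: expR_ge1Dx.
have p : 0 <= 1 - v + v ^+ 2 by nra.
have := ler_wpM2l p h.
have := exprn_ge0 3 v0; nra.
Qed.

End trig_bounds.

(** * The martingale of elementary symmetric polynomials *)

Lemma mulr_sum_sqr (R : realType) (J : finType) (c : R) (u : J -> R) :
  c * (\sum_j u j) ^+ 2 = \sum_i \sum_j c * (u i * u j).
Proof.
rewrite expr2 mulr_suml mulr_sumr; apply: eq_bigr => i _.
by rewrite mulr_sumr mulr_sumr.
Qed.

Section martingale.
Context d (T : measurableType d) (R : realType) (P : probability T R).
Local Notation E := (expect P).
Local Notation intble := (intble P).
Local Notation L4 := (L4 P).
Local Notation L2 := (L2 P).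
(* [x k l] stands for the normalized observation Y_{k,l} / sqrt(n C_p); [G k]
   and [H k] generate the sigma-algebras of the observations of index < k and
   of the k-th one. *)
Variables (n L : nat) (x : nat -> 'I_L -> T -> R) (G H : nat -> set (set T)).
Hypothesis n_gt0 : (0 < n)%N.
Hypothesis G_meas : forall k, G k `<=` measurable.
Hypothesis G_mono : forall k, <<s G k >> `<=` <<s G k.+1 >>.
Hypothesis H_next : forall k, (k < n)%N -> <<s H k >> `<=` <<s G k.+1 >>.
Hypothesis GH_indep : forall k, (k < n)%N -> forall A B,
  <<s G k >> A -> <<s H k >> B -> P (A `&` B) = (P A * P B)%E.
Hypothesis x_H : forall k l, (k < n)%N -> gmeas (H k) (x k l).
Variables (sigma : 'I_L -> 'I_L -> R) (B S : R).
Hypothesis x_L4 : forall k l, (k < n)%N -> L4 (x k l).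
Hypothesis x_mean : forall k l, (k < n)%N -> E (x k l) = 0.
Hypothesis x_cov : forall k l l', (k < n)%N ->
  E (fun w => x k l w * x k l' w) = sigma l l' / n%:R.
Hypothesis B_ge1 : 1 <= B.
Hypothesis S_ge1 : 1 <= S.
Hypothesis x_4 : forall k l, (k < n)%N ->
  E (fun w => x k l w ^+ 4) <= B / n%:R ^+ 2.
Hypothesis sigma_sum : forall l, \sum_l' `|sigma l l'| <= S.
Hypothesis sigma_le1 : forall l l', `|sigma l l'| <= 1.
Hypothesis x_quad : forall k, (k < n)%N ->
  \sum_(i : 'I_L * 'I_L) \sum_(j : 'I_L * 'I_L)
    `|E (fun w => x k i.1 w * x k i.2 w * x k j.1 w * x k j.2 w)|
    <= B * L%:R ^+ 2 / n%:R ^+ 2.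

Let n0 : (0 : R) < n%:R. Proof. by rewrite ltr0n. Qed.
Let n1 : (1 : R) <= n%:R. Proof. by rewrite ler1n. Qed.

Lemma sigma_sym l l' : sigma l l' = sigma l' l.
Proof.
have ni : n%:R^-1 != 0 :> R by rewrite invr_neq0// gt_eqF.
apply: (mulIf ni); rewrite -!(x_cov _ _ n_gt0).
by apply: expect_ext => w; exact: mulrC.
Qed.

(** Plays the part of the conditional expectation: a factor built on observation [k] is averaged out
    against one built on the earlier observations. *)
Lemma past_indep k f g : (k < n)%N -> gmeas (G k) f -> gmeas (H k) g ->
  intble f -> intble g ->
  intble (fun w => f w * g w) /\ E (fun w => f w * g w) = E f * E g.
Proof.
move=> kn Gf Hg If Ig; apply: indep_intble_expectM => // A B' mA mB.
by apply: (GH_indep kn); rewrite -[_ @^-1` _]setTI; [exact: Gf|exact: Hg].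
Qed.

Lemma past_indep_L4 k f g : (k < n)%N -> gmeas (G k) f -> gmeas (H k) g ->
  L4 f -> L4 g -> L4 (fun w => g w * f w).
Proof.
move=> kn Gf Hg [mf If] [mg Ig]; split; first exact: measurable_funM.
have [I _] := past_indep kn (measurable_funX 4 Gf) (measurable_funX 4 Hg) If Ig.
by under eq_fun do rewrite exprMn mulrC.
Qed.

Lemma past_indep_L2 k f g : (k < n)%N -> gmeas (G k) f -> gmeas (H k) g ->
  L2 f -> L2 g -> L2 (fun w => g w * f w).
Proof.
move=> kn Gf Hg [mf If] [mg Ig]; split; first exact: measurable_funM.
have [I _] := past_indep kn (measurable_funX 2 Gf) (measurable_funX 2 Hg) If Ig.
by under eq_fun do rewrite exprMn mulrC.
Qed.

Definition elem m l k (w : T) := elemsym (fun i => x i l w) m k.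

Lemma elem0 l k : elem 0 l k = fun=> 1.
Proof. by apply/funext => w; rewrite /elem elemsym0. Qed.

Lemma elemS m l k :
  elem m.+1 l k.+1 = fun w => elem m.+1 l k w + x k l w * elem m l k w.
Proof. by []. Qed.

Lemma elem_past m l k : (k <= n)%N -> gmeas (G k) (elem m l k).
Proof.
elim: k m => [|k IH] [|m] kn.
- by rewrite elem0; exact: measurable_cst.
- exact: measurable_cst.
- by rewrite elem0; exact: measurable_cst.
rewrite elemS; apply: measurable_funD.
  by apply: (gmeas_sub (@G_mono k)); apply: IH; exact: ltnW.
apply: measurable_funM.
  by apply: (gmeas_sub (H_next kn)); exact: x_H.
by apply: (gmeas_sub (@G_mono k)); apply: IH; exact: ltnW.
Qed.

Lemma elem_L4 m l k : (k <= n)%N -> L4 (elem m l k).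
Proof.
elim: k m => [|k IH] [|m] kn.
- by rewrite elem0; exact: L4_cst.
- exact: L4_cst.
- by rewrite elem0; exact: L4_cst.
rewrite elemS; apply: L4D; first by apply: IH; exact: ltnW.
apply: (past_indep_L4 kn).
- by apply: elem_past; exact: ltnW.
- exact: x_H.
- by apply: IH; exact: ltnW.
- exact: x_L4.
Qed.

(** The term X^3 Z is kept because its expectation vanishes when Z carries a centred factor
    independent of the past. The other mixed terms are absorbed: X Z^3 into X^2 Z^2 and Z^4, then 8
    X^2 Z^2 into X^4 / c + 16 c Z^4. With c = n the growth factor suits Gronwall, and n E Z^4 is
    still of order 1/n. *)
Lemma fourth_step (X Z c : R) : 0 < c ->
  (X + Z) ^+ 4 <= (1 + c^-1) * X ^+ 4 + 4 * (X ^+ 3 * Z) + (16 * c + 3) * Z ^+ 4.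
Proof.
move=> c0.
have -> : (X + Z) ^+ 4 = X ^+ 4 + 4 * (X ^+ 3 * Z) + 6 * (X ^+ 2 * Z ^+ 2)
   + 4 * (X * Z ^+ 3) + Z ^+ 4 by ring.
have h1 : 4 * (X * Z ^+ 3) <= 2 * (X ^+ 2 * Z ^+ 2) + 2 * Z ^+ 4.
  have := sqr_ge0 (X * Z - Z ^+ 2).
  have -> : (X * Z - Z ^+ 2) ^+ 2 = X ^+ 2 * Z ^+ 2 - 2 * (X * Z ^+ 3) + Z ^+ 4.
    ring.
  lra.
have h2 : 8 * (X ^+ 2 * Z ^+ 2) <= c^-1 * X ^+ 4 + 16 * c * Z ^+ 4.
  have : 0 <= c^-1 * (X ^+ 2 - 4 * c * Z ^+ 2) ^+ 2.
    by rewrite mulr_ge0// ?sqr_ge0// invr_ge0 ltW.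
  have -> : c^-1 * (X ^+ 2 - 4 * c * Z ^+ 2) ^+ 2 =
    c^-1 * X ^+ 4 - 8 * (X ^+ 2 * Z ^+ 2) + 16 * c * Z ^+ 4.
    by field; rewrite gt_eqF.
  lra.
lra.
Qed.

(** The 19 comes from 16 n + 3 <= 19 n in [fourth_step] with c = n, the factor e from Gronwall. *)
Let K1 : R := 19 * expR 1 * B.

Lemma K1_ge1 : 1 <= K1.
Proof.
rewrite /K1 -[leLHS]mulr1 ler_pM//.
have := @expR_ge1Dx R 1; lra.
Qed.

(** Induction on the degree, with Gronwall in [k] at each degree: one step adds n times the fourth
    moment at degree m - 1 times that of one observation, which is of order n^-2. *)
Lemma elem_fourth m l k : (k <= n)%N -> E (fun w => elem m l k w ^+ 4) <= K1 ^+ m.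
Proof.
elim: m k => [|m IH] k kn.
  under [X in expect _ X]eq_fun do rewrite elem0 expr1n.
  by rewrite expect_cst.
pose u k := E (fun w => elem m.+1 l k w ^+ 4).
have K0 : 0 <= K1 ^+ m by rewrite exprn_ge0// (le_trans ler01)// K1_ge1.
have := @discrete_gronwall R n u (19 * B / n%:R * K1 ^+ m) _ _ _ k kn.
rewrite (_ : expR 1 * _ * _ = K1 ^+ m.+1); last first.
  by rewrite exprS /K1; field; rewrite gt_eqF.
apply.
- apply: mulr_ge0 => //; apply: divr_ge0; last exact: ltW.
  by apply: mulr_ge0 => //; exact: le_trans ler01 _.
- by rewrite /u /elem /=; under [X in expect _ X]eq_fun do rewrite expr0n/=;
    rewrite expect_cst.
move=> j jn; rewrite /u.
have jn' := ltnW jn.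
pose X := elem m.+1 l j; pose Y := x j l; pose F := elem m l j.
have LX : L4 X by exact: elem_L4.
have LY : L4 Y by exact: x_L4.
have LF : L4 F by exact: elem_L4.
have GX : gmeas (G j) X by exact: elem_past.
have GF : gmeas (G j) F by exact: elem_past.
have HY : gmeas (H j) Y by exact: x_H.
have IX3F : intble (fun w => X w ^+ 3 * F w).
  by apply: (intble_ext _ (L4_prod LX LX LX LF)) => w; ring.
have GX3F : gmeas (G j) (fun w => X w ^+ 3 * F w).
  by apply: measurable_funM => //; exact: measurable_funX.
have [I1 E1] := past_indep jn GX3F HY IX3F (L4_intble LY).
have [I2 E2] := past_indep jn (measurable_funX 4 GF) (measurable_funX 4 HY)
  (proj2 LF) (proj2 LY).
have I3 : intble (fun w => (1 + n%:R^-1) * X w ^+ 4 +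
    4 * (X w ^+ 3 * F w * Y w) + (16 * n%:R + 3) * (F w ^+ 4 * Y w ^+ 4)).
  by apply: intbleD; [apply: intbleD|]; apply: intbleZ => //; case: LX.
have IS : intble (fun w => elem m.+1 l j.+1 w ^+ 4) by case: (elem_L4 m.+1 l jn).
apply: (le_trans (expect_le IS I3 _)).
  move=> w; rewrite elemS; apply: le_trans (fourth_step _ _ n0) _.
  rewrite le_eqVlt; apply/orP; left; apply/eqP.
  by rewrite /X /F /Y; ring.
rewrite !expectD; last 4 first.
- by apply: intbleZ; case: LX.
- exact: intbleZ.
- by apply: intbleD; apply: intbleZ => //; case: LX.
- exact: intbleZ.
rewrite !expectZ//; last by case: LX.
rewrite E1 E2 x_mean// mulr0 mulr0 addr0 lerD2l.
have h1 : E (fun w => F w ^+ 4) <= K1 ^+ m by exact: IH.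
have h2 : E (fun w => Y w ^+ 4) <= B / n%:R ^+ 2 by exact: x_4.
have h3 : 0 <= E (fun w => F w ^+ 4).
  by apply: expect_ge0 => w; rewrite exprn_even_ge0.
have h4 : 0 <= E (fun w => Y w ^+ 4).
  by apply: expect_ge0 => w; rewrite exprn_even_ge0.
apply: (@le_trans _ _ (19 * n%:R * (K1 ^+ m * (B / n%:R ^+ 2)))).
  have : E (fun w => F w ^+ 4) * E (fun w => Y w ^+ 4) <=
      K1 ^+ m * (B / n%:R ^+ 2) by exact: ler_pM.
  apply: ler_pM; first by have := n1; lra.
  - exact: mulr_ge0.
  - by have := n1; lra.
by rewrite le_eqVlt; apply/orP; left; apply/eqP; field; rewrite gt_eqF.
Qed.

(** Of the four terms produced by one step, the two that contain a single new observation vanish;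
    the other two follow Pascal's rule with a factor sigma / n. Both degrees drop together, so only
    equal degrees contribute. *)
Lemma elem_cov m m' l l' k : (k <= n)%N ->
  E (fun w => elem m l k w * elem m' l' k w) =
  (m == m')%:R * 'C(k, m)%:R * (sigma l l' / n%:R) ^+ m.
Proof.
elim: k m m' => [|k IH] [|m] [|m'] kn.
- under [X in expect _ X]eq_fun do rewrite !elem0 mulr1.
  by rewrite expect_cst bin0 expr0 !mulr1.
- under [X in expect _ X]eq_fun do rewrite mulr0.
  by rewrite expect_cst !mul0r.
- under [X in expect _ X]eq_fun do rewrite mul0r.
  by rewrite expect_cst !mul0r.
- under [X in expect _ X]eq_fun do rewrite mul0r.
  by rewrite expect_cst bin0n mulr0 mul0r.
- under [X in expect _ X]eq_fun do rewrite !elem0 mulr1.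
  by rewrite expect_cst bin0 expr0 !mulr1.
- have kn' := ltnW kn.
  have := IH 0 m'.+1 kn'; rewrite !elem0.
  under [X in expect _ X]eq_fun do rewrite mul1r.
  under [X in _ -> expect _ X = _]eq_fun do rewrite mul1r.
  have [I1 E1] := past_indep kn (elem_past m' l' kn') (x_H l' kn)
    (L4_intble (elem_L4 m' l' kn')) (L4_intble (x_L4 l' kn)).
  rewrite !mul0r => h.
  rewrite (_ : elem m'.+1 l' k.+1 = fun w => elem m'.+1 l' k w + elem m' l' k w * x k l' w).
    by rewrite expectD// ?h ?E1 ?x_mean// ?mulr0 ?addr0//; apply: L4_intble; exact: elem_L4.
  by apply/funext => w; rewrite elemS [x k l' w * _]mulrC.
- have kn' := ltnW kn.
  have := IH m.+1 0 kn'; rewrite !elem0.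
  under [X in expect _ X]eq_fun do rewrite mulr1.
  under [X in _ -> expect _ X = _]eq_fun do rewrite mulr1.
  have [I1 E1] := past_indep kn (elem_past m l kn') (x_H l kn)
    (L4_intble (elem_L4 m l kn')) (L4_intble (x_L4 l kn)).
  rewrite !mul0r => h.
  rewrite (_ : elem m.+1 l k.+1 = fun w => elem m.+1 l k w + elem m l k w * x k l w).
    by rewrite expectD// ?h ?E1 ?x_mean// ?mulr0 ?addr0//; apply: L4_intble; exact: elem_L4.
  by apply/funext => w; rewrite elemS [x k l w * _]mulrC.
have kn' := ltnW kn.
pose X := elem m.+1 l k; pose X' := elem m'.+1 l' k.
pose F := elem m l k; pose F' := elem m' l' k.
pose Y := x k l; pose Y' := x k l'.
have -> : (fun w => elem m.+1 l k.+1 w * elem m'.+1 l' k.+1 w) =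
  (fun w => X w * X' w + (X w * F' w) * Y' w + (F w * X' w) * Y w
    + (F w * F' w) * (Y w * Y' w)).
  by apply/funext => w; rewrite !elemS /X /X' /F /F' /Y /Y'; ring.
have LX : L4 X by exact: elem_L4.
have LX' : L4 X' by exact: elem_L4.
have LF : L4 F by exact: elem_L4.
have LF' : L4 F' by exact: elem_L4.
have LY : L4 Y by exact: x_L4.
have LY' : L4 Y' by exact: x_L4.
have GX : gmeas (G k) X by exact: elem_past.
have GX' : gmeas (G k) X' by exact: elem_past.
have GF : gmeas (G k) F by exact: elem_past.
have GF' : gmeas (G k) F' by exact: elem_past.
have HY : gmeas (H k) Y by exact: x_H.
have HY' : gmeas (H k) Y' by exact: x_H.
have [I1 E1] := past_indep kn (measurable_funM GX GF') HY'
  (L4_intble2 LX LF') (L4_intble LY').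
have [I2 E2] := past_indep kn (measurable_funM GF GX') HY
  (L4_intble2 LF LX') (L4_intble LY).
have [I3 E3] := past_indep kn (measurable_funM GF GF') (measurable_funM HY HY')
  (L4_intble2 LF LF') (L4_intble2 LY LY').
have I0 := L4_intble2 LX LX'.
rewrite (expectD (intbleD (intbleD I0 I1) I2) I3) (expectD (intbleD I0 I1) I2).
rewrite (expectD I0 I1) E1 E2 E3 !x_mean// x_cov// !mulr0 !addr0.
rewrite IH// IH// eqSS.
case: eqP => [->|]; last by rewrite !mul0r addr0.
by rewrite !mul1r binS natrD exprS; ring.
Qed.

Lemma x_L2 k l : (k < n)%N -> L2 (x k l).
Proof. by move=> kn; apply: L4_L2; exact: x_L4. Qed.

(** The martingale difference property in weak form: a vanishing conditional mean is expressed by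
    orthogonality to the past. *)
Lemma innov_orth (J : finType) (Y Z : J -> T -> R) k : (k < n)%N ->
  (forall j, gmeas (H k) (Y j)) -> (forall j, L2 (Y j)) ->
  (forall j, E (Y j) = 0) ->
  (forall j, gmeas (G k) (Z j)) -> (forall j, L2 (Z j)) ->
  L2 (fun w => \sum_j Y j w * Z j w) /\
  forall f, gmeas (G k) f -> L2 f -> E (fun w => f w * \sum_j Y j w * Z j w) = 0.
Proof.
move=> kn HY LY EY GZ LZ; split.
  by apply: L2_sum => j; apply: (past_indep_L2 kn).
move=> f Gf Lf.
have I j := past_indep kn (measurable_funM Gf (GZ j)) (HY j)
  (L2_intbleM Lf (LZ j)) (L2_intble (LY j)).
rewrite (_ : (fun w => _) = fun w => \sum_j f w * Z j w * Y j w); last first.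
  by apply/funext => w; rewrite mulr_sumr; apply: eq_bigr => j _; ring.
rewrite expect_sum; last by move=> j _; case: (I j).
by apply: big1 => j _; rewrite (proj2 (I j)) EY mulr0.
Qed.

Lemma innov_sqr (J : finType) (Y Z : J -> T -> R) k : (k < n)%N ->
  (forall j, gmeas (H k) (Y j)) -> (forall j, L2 (Y j)) ->
  (forall j, gmeas (G k) (Z j)) -> (forall j, L2 (Z j)) ->
  E (fun w => (\sum_j Y j w * Z j w) ^+ 2) =
  \sum_i \sum_j E (fun w => Y i w * Y j w) * E (fun w => Z i w * Z j w).
Proof.
move=> kn HY LY GZ LZ.
have I i j := past_indep kn (measurable_funM (GZ i) (GZ j))
  (measurable_funM (HY i) (HY j))
  (L2_intbleM (LZ i) (LZ j)) (L2_intbleM (LY i) (LY j)).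
rewrite (_ : (fun w => _) =
    fun w => \sum_i \sum_j (Z i w * Z j w) * (Y i w * Y j w)); last first.
  apply/funext => w; rewrite expr2 mulr_suml; apply: eq_bigr => i _.
  by rewrite mulr_sumr; apply: eq_bigr => j _; ring.
rewrite expect_sum; last by move=> i _; apply: intble_sum => j _; case: (I i j).
apply: eq_bigr => i _.
rewrite expect_sum; last by move=> j _; case: (I i j).
by apply: eq_bigr => j _; rewrite (proj2 (I i j)) mulrC.
Qed.

(** Only row sums of [sigma] enter: the absolute covariances of the L^2 pairs of indices add up to
    at most S L / n. *)
Lemma innov_lin_sqr_le (Z : 'I_L -> T -> R) (c : R) k : (k < n)%N ->
  (forall l, gmeas (G k) (Z l)) -> (forall l, L2 (Z l)) ->
  (forall l, E (fun w => Z l w ^+ 2) <= c) ->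
  E (fun w => (\sum_l x k l w * Z l w) ^+ 2) <= c * S * L%:R / n%:R.
Proof.
move=> kn GZ LZ Zc.
rewrite (innov_sqr kn (fun l => x_H l kn) (fun l => x_L2 l kn) GZ LZ).
apply: (@le_trans _ _ (\sum_(i < L) c * S / n%:R)); last first.
  by rewrite sumr_const card_ord -mulr_natr le_eqVlt; apply/orP; left; apply/eqP; ring.
apply: ler_sum => i _.
have c0 : 0 <= c.
  by apply: le_trans (Zc i); apply: expect_ge0 => w; exact: sqr_ge0.
apply: (@le_trans _ _ (\sum_j `|sigma i j| * (c / n%:R))); last first.
  rewrite -mulr_suml mulrC mulrAC; apply: ler_wpM2r.
    by rewrite invr_ge0 ltW.
  by apply: ler_wpM2l.
apply: ler_sum => j _; rewrite x_cov//.
apply: (le_trans (ler_norm _)); rewrite !normrM -mulrA.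
apply: ler_wpM2l => //.
rewrite ger0_norm ?invr_ge0 ?(ltW n0)// mulrC; apply: ler_wpM2r.
  by rewrite invr_ge0 ltW.
exact: expect_mul_le.
Qed.

(** The orthogonal innovation [D] just adds its second moment. For the drift, 2ab <= a^2 / n + n b^2
    keeps the growth factor at 1 + 1/n; the factor 1 + n put on the variance of [g] is affordable
    because [c] will be 1/n. *)
Lemma var_step (f g D : T -> R) (c : R) k : (k < n)%N ->
  gmeas (G k) f -> gmeas (G k) g -> L2 f -> L2 g -> L2 D ->
  (forall h, gmeas (G k) h -> L2 h -> E (fun w => h w * D w) = 0) ->
  var P (fun w => f w + c * g w + D w) <=
  (1 + n%:R^-1) * var P f + (1 + n%:R) * c ^+ 2 * var P g + E (fun w => D w ^+ 2).
Proof.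
move=> kn Gf Gg Lf Lg LD D0.
have ED : E D = 0.
  have := D0 (fun=> 1) (measurable_cst _) (L2_cst P 1).
  by under [X in expect _ X]eq_fun do rewrite mul1r.
pose h w := f w - E f + c * (g w - E g).
have Gh : gmeas (G k) h.
  apply: measurable_funD; first exact: measurable_funB.
  by apply: measurable_funM => //; exact: measurable_funB.
have Lf' : L2 (fun w => f w - E f) by apply: L2B => //; exact: L2_cst.
have Lg' : L2 (fun w => g w - E g) by apply: L2B => //; exact: L2_cst.
have Lh : L2 h by apply: L2D => //; exact: L2Z.
have ID : intble (fun w => D w ^+ 2) by case: LD.
have Ih : intble (fun w => h w ^+ 2) by case: Lh.
have IhD := L2_intbleM Lh LD.
have -> : var P (fun w => f w + c * g w + D w) =
    E (fun w => h w ^+ 2 + 2 * (h w * D w) + D w ^+ 2).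
  have If := L2_intble Lf; have Ig := L2_intble Lg.
  rewrite /var (expectD (intbleD If (intbleZ c Ig)) (L2_intble LD)).
  rewrite (expectD If (intbleZ c Ig)) (expectZ _ Ig) ED.
  by apply: expect_ext => w; rewrite /h; ring.
have I2hD := intbleZ 2 IhD.
rewrite (expectD (intbleD Ih I2hD) ID) (expectD Ih I2hD) expectZ// D0// mulr0 addr0.
rewrite lerD2r.
have If2 : intble (fun w => (f w - E f) ^+ 2) by case: Lf'.
have Ig2 : intble (fun w => (g w - E g) ^+ 2) by case: Lg'.
have I1 := intbleZ (1 + n%:R^-1) If2.
have I2 := intbleZ ((1 + n%:R) * c ^+ 2) Ig2.
rewrite /var -(expectZ _ If2) -(expectZ _ Ig2) -(expectD I1 I2).
apply: expect_le => //; first exact: intbleD.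
move=> w; rewrite /h; set a := f w - _; set b := g w - _.
have : 0 <= n%:R^-1 * (a - n%:R * (c * b)) ^+ 2.
  by rewrite mulr_ge0// ?sqr_ge0// invr_ge0 ltW.
have -> : n%:R^-1 * (a - n%:R * (c * b)) ^+ 2 =
   n%:R^-1 * a ^+ 2 - 2 * (a * (c * b)) + n%:R * c ^+ 2 * b ^+ 2.
  by field; rewrite gt_eqF.
nra.
Qed.

(* The conditional variances of the martingale below are combinations of these
   sums. Their own variance is bounded by induction on (a, b): one step in k
   produces a cross sum of index (a - 1, b - 1) and three centred innovations. *)
Definition cross a b (v : 'I_L -> 'I_L -> R) k (w : T) : R :=
  \sum_l \sum_l' v l l' * (elem a l k w * elem b l' k w).

Lemma cross_past a b v k : (k <= n)%N -> gmeas (G k) (cross a b v k).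
Proof.
move=> kn; apply: measurable_sum => l; apply: measurable_sum => l'.
apply: measurable_funM => //; apply: measurable_funM; exact: elem_past.
Qed.

Lemma cross_L2 a b v k : (k <= n)%N -> L2 (cross a b v k).
Proof.
move=> kn; apply: L2_sum => l; apply: L2_sum => l'.
by apply: L2Z; apply: L4_L2M; exact: elem_L4.
Qed.

Variable Mx : nat.
Let K : R := K1 ^+ Mx.

Lemma K_ge1 : 1 <= K.
Proof. exact/exprn_ege1/K1_ge1. Qed.

Lemma elem_fourth_le m l k : (m <= Mx)%N -> (k <= n)%N ->
  E (fun w => elem m l k w ^+ 4) <= K.
Proof.
move=> mM kn; apply: le_trans (elem_fourth m l kn) _.
by apply: ler_weXn2l => //; exact: K1_ge1.
Qed.

(** * Innovations in one step of a cross sum *)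

Section one_step.
Variables (v : 'I_L -> 'I_L -> R) (k : nat).
Hypothesis kn : (k < n)%N.
Hypothesis v_sigma : forall l l', `|v l l'| <= `|sigma l l'|.
Let kn' := ltnW kn.

(** When the recursion is applied to both factors of a product, [innov1] collects the terms where
    the new observation enters through the second factor only, [innov2] through the first only,
    [innov3] through both. In the last one the mean sigma / n is removed and left to the drift. *)
Definition innov1 a b (w : T) : R :=
  \sum_l' x k l' w * (\sum_l v l l' * (elem a l k w * elem b l' k w)).
Definition innov2 a b (w : T) : R :=
  \sum_l x k l w * (\sum_l' v l l' * (elem a l k w * elem b l' k w)).
Definition innov3 a b (w : T) : R :=
  \sum_(p : 'I_L * 'I_L) (x k p.1 w * x k p.2 w - sigma p.1 p.2 / n%:R) *
    (v p.1 p.2 * (elem a p.1 k w * elem b p.2 k w)).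

Let inner1_past a b l' :
  gmeas (G k) (fun w => \sum_l v l l' * (elem a l k w * elem b l' k w)).
Proof.
apply: measurable_sum => l.
by apply: measurable_funM => //; apply: measurable_funM; exact: elem_past.
Qed.

Let inner1_L2 a b l' : L2 (fun w => \sum_l v l l' * (elem a l k w * elem b l' k w)).
Proof. by apply: L2_sum => l; apply: L2Z; apply: L4_L2M; exact: elem_L4. Qed.

Let inner2_past a b l :
  gmeas (G k) (fun w => \sum_l' v l l' * (elem a l k w * elem b l' k w)).
Proof.
apply: measurable_sum => l'.
by apply: measurable_funM => //; apply: measurable_funM; exact: elem_past.
Qed.

Let inner2_L2 a b l : L2 (fun w => \sum_l' v l l' * (elem a l k w * elem b l' k w)).
Proof. by apply: L2_sum => l'; apply: L2Z; apply: L4_L2M; exact: elem_L4. Qed.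

Let xx_H (p : 'I_L * 'I_L) :
  gmeas (H k) (fun w => x k p.1 w * x k p.2 w - sigma p.1 p.2 / n%:R).
Proof. by apply: measurable_funB => //; apply: measurable_funM; exact: x_H. Qed.

Let xx_L2 (p : 'I_L * 'I_L) :
  L2 (fun w => x k p.1 w * x k p.2 w - sigma p.1 p.2 / n%:R).
Proof. by apply: L2B; [apply: L4_L2M; exact: x_L4|exact: L2_cst]. Qed.

Let xx_mean (p : 'I_L * 'I_L) :
  E (fun w => x k p.1 w * x k p.2 w - sigma p.1 p.2 / n%:R) = 0.
Proof.
rewrite expectB ?x_cov ?expect_cst ?subrr//; last exact: intble_cst.
by apply: L4_intble2; exact: x_L4.
Qed.

Let z_past a b (p : 'I_L * 'I_L) :
  gmeas (G k) (fun w => v p.1 p.2 * (elem a p.1 k w * elem b p.2 k w)).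
Proof. by apply: measurable_funM => //; apply: measurable_funM; exact: elem_past. Qed.

Let z_L2 a b (p : 'I_L * 'I_L) :
  L2 (fun w => v p.1 p.2 * (elem a p.1 k w * elem b p.2 k w)).
Proof. by apply: L2Z; apply: L4_L2M; exact: elem_L4. Qed.

Lemma innov1_orth a b : L2 (innov1 a b) /\
  forall f, gmeas (G k) f -> L2 f -> E (fun w => f w * innov1 a b w) = 0.
Proof.
apply: (@innov_orth _ (fun l => x k l) _ _ kn) => l //;
  [exact: x_H|exact: x_L2|exact: x_mean].
Qed.

Lemma innov2_orth a b : L2 (innov2 a b) /\
  forall f, gmeas (G k) f -> L2 f -> E (fun w => f w * innov2 a b w) = 0.
Proof.
apply: (@innov_orth _ (fun l => x k l) _ _ kn) => l //;
  [exact: x_H|exact: x_L2|exact: x_mean].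
Qed.

Lemma innov3_orth a b : L2 (innov3 a b) /\
  forall f, gmeas (G k) f -> L2 f -> E (fun w => f w * innov3 a b w) = 0.
Proof. exact: (innov_orth kn). Qed.

Lemma v_row l : \sum_l' `|v l l'| <= S.
Proof. by apply: le_trans (sigma_sum l); apply: ler_sum. Qed.

Lemma v_col l' : \sum_l `|v l l'| <= S.
Proof.
apply: le_trans (sigma_sum l'); apply: ler_sum => l _.
by rewrite (sigma_sym l' l).
Qed.

Let sum_sqr_le (s : R) : 0 <= s -> s <= S -> s ^+ 2 * K <= S ^+ 2 * K.
Proof.
move=> s0 sS; apply: ler_wpM2r; first exact: le_trans ler01 K_ge1.
by apply: lerXn2r => //; rewrite nnegrE// (le_trans s0).
Qed.

(** For fixed [l'] the inner sum has absolute weight at most [S] by the column sums, hence second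
    moment at most S^2 K; the outer linear sum costs S L / n. *)
Lemma innov1_sqr a b : (a <= Mx)%N -> (b <= Mx)%N ->
  E (fun w => innov1 a b w ^+ 2) <= S ^+ 3 * K * L%:R / n%:R.
Proof.
move=> aM bM.
rewrite (_ : S ^+ 3 * K = S ^+ 2 * K * S); last by ring.
apply: innov_lin_sqr_le => // l'.
apply: le_trans (@expect_sqr_sum_le _ _ _ P _ (fun l => v l l') _ K _ _) _.
- by move=> l; apply: L4_L2M; exact: elem_L4.
- by move=> l; apply: expect_sqr_mul_le; [exact: elem_L4|exact: elem_L4| |];
    exact: elem_fourth_le.
- by apply: sum_sqr_le; [exact: sumr_ge0|exact: v_col].
Qed.

Lemma innov2_sqr a b : (a <= Mx)%N -> (b <= Mx)%N ->
  E (fun w => innov2 a b w ^+ 2) <= S ^+ 3 * K * L%:R / n%:R.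
Proof.
move=> aM bM.
rewrite (_ : S ^+ 3 * K = S ^+ 2 * K * S); last by ring.
apply: innov_lin_sqr_le => // l.
apply: le_trans (@expect_sqr_sum_le _ _ _ P _ (fun l' => v l l') _ K _ _) _.
- by move=> l'; apply: L4_L2M; exact: elem_L4.
- by move=> l'; apply: expect_sqr_mul_le; [exact: elem_L4|exact: elem_L4| |];
    exact: elem_fourth_le.
- by apply: sum_sqr_le; [exact: sumr_ge0|exact: v_row].
Qed.

(** Crude over pairs of pairs: each weighted product contributes at most B K / n^2, and the total
    weight of [v] is at most S L. Over n steps this amounts to L^2 / n, negligible against L^2. *)
Lemma innov3_sqr a b : (a <= Mx)%N -> (b <= Mx)%N ->
  E (fun w => innov3 a b w ^+ 2) <= S ^+ 2 * B * K * L%:R ^+ 2 / n%:R ^+ 2.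
Proof.
move=> aM bM; rewrite /innov3 (innov_sqr kn)//.
have K0 : 0 <= K by exact: le_trans ler01 K_ge1.
have B0 : 0 <= B by exact: le_trans ler01 B_ge1.
(* Centring can only decrease a second moment. *)
have xx2 (p : 'I_L * 'I_L) :
    E (fun w => (x k p.1 w * x k p.2 w - sigma p.1 p.2 / n%:R) ^+ 2) <=
    B / n%:R ^+ 2.
  have Lxx : L2 (fun w => x k p.1 w * x k p.2 w).
    by apply: L4_L2M; exact: x_L4.
  apply: (@le_trans _ _ (E (fun w => (x k p.1 w * x k p.2 w) ^+ 2))).
    rewrite (_ : (fun w => (_ - _) ^+ 2) = fun w => (x k p.1 w * x k p.2 w) ^+ 2 -
       2 * (sigma p.1 p.2 / n%:R) * (x k p.1 w * x k p.2 w)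
       + (sigma p.1 p.2 / n%:R) ^+ 2); last by apply/funext => w; ring.
    have I1 : intble (fun w => (x k p.1 w * x k p.2 w) ^+ 2) by case: Lxx.
    have I2 := intbleZ (2 * (sigma p.1 p.2 / n%:R)) (L2_intble Lxx).
    rewrite (expectD (intbleB I1 I2) (intble_cst _ _)) (expectB I1 I2).
    rewrite (expectZ _ (L2_intble Lxx)) x_cov// expect_cst.
    by have := sqr_ge0 (sigma p.1 p.2 / n%:R); lra.
  by apply: expect_sqr_mul_le; [exact: x_L4|exact: x_L4| |]; exact: x_4.
have zz (p q : 'I_L * 'I_L) :
    `|E (fun w => v p.1 p.2 * (elem a p.1 k w * elem b p.2 k w) *
                (v q.1 q.2 * (elem a q.1 k w * elem b q.2 k w)))| <=
    `|v p.1 p.2| * `|v q.1 q.2| * K.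
  have Lz (r : 'I_L * 'I_L) : L2 (fun w => elem a r.1 k w * elem b r.2 k w).
    by apply: L4_L2M; exact: elem_L4.
  rewrite (_ : (fun w => _) = (fun w => v p.1 p.2 * v q.1 q.2 *
    ((elem a p.1 k w * elem b p.2 k w) * (elem a q.1 k w * elem b q.2 k w)))); last first.
    by apply/funext => w; ring.
  rewrite expectZ; last exact: L2_intbleM.
  rewrite !normrM; apply: ler_wpM2l => //; apply: expect_mul_le => //;
    by apply: expect_sqr_mul_le; [exact: elem_L4|exact: elem_L4| |]; exact: elem_fourth_le.
apply: (@le_trans _ _ (\sum_(p : 'I_L * 'I_L) \sum_(q : 'I_L * 'I_L)
   (B / n%:R ^+ 2 * K) * (`|v p.1 p.2| * `|v q.1 q.2|))).
  apply: ler_sum => p _; apply: ler_sum => q _.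
  apply: (le_trans (ler_norm _)); rewrite normrM.
  rewrite -mulrA [K * _]mulrC; apply: ler_pM => //.
  by apply: expect_mul_le => //; exact: xx2.
set s := \sum_(p : 'I_L * 'I_L) `|v p.1 p.2|.
have -> : \sum_(p : 'I_L * 'I_L) \sum_(q : 'I_L * 'I_L)
    (B / n%:R ^+ 2 * K) * (`|v p.1 p.2| * `|v q.1 q.2|) =
    B / n%:R ^+ 2 * K * s ^+ 2.
  rewrite (expr2 s) /s mulr_suml mulr_sumr; apply: eq_bigr => p _.
  by rewrite -!mulr_sumr.
have s0 : 0 <= s by exact: sumr_ge0.
have sS : s <= L%:R * S.
  rewrite /s -(pair_bigA _ (fun l l' => `|v l l'|))/=.
  apply: (@le_trans _ _ (\sum_(l < L) S)); first by apply: ler_sum => l _; exact: v_row.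
  by rewrite sumr_const card_ord mulr_natl.
rewrite (_ : S ^+ 2 * B * K * L%:R ^+ 2 / n%:R ^+ 2 =
  B / n%:R ^+ 2 * K * (L%:R * S) ^+ 2); last by field; rewrite gt_eqF.
apply: ler_wpM2l.
  by apply: mulr_ge0 => //; apply: divr_ge0 => //; exact: sqr_ge0.
by apply: lerXn2r => //; rewrite nnegrE// (le_trans s0).
Qed.

End one_step.

(** Order of the variance of a cross sum over n steps: the linear innovations give L and the
    quadratic one L^2 / n. Both are negligible against L^2. *)
Let ell : R := L%:R + L%:R ^+ 2 / n%:R.
(** The 6 is the 3 of (u + v + w)^2 <= 3 (u^2 + v^2 + w^2) times 2 for the two linear innovations;
    powers of [S] and [B], both at least 1, are raised to common values. *)
Let K3 : R := 6 * S ^+ 3 * B * K.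

(** Solves the recursion of [var_cross]: the 2 bounds (1 + n) / n and the factor e comes from
    Gronwall. *)
Fixpoint var_const (a : nat) : R :=
  match a with
  | 0 => expR 1 * K3
  | a'.+1 => expR 1 * (2 * var_const a' + K3)
  end.

Let S0 : 0 <= S. Proof. exact: le_trans ler01 S_ge1. Qed.
Let B0 : 0 <= B. Proof. exact: le_trans ler01 B_ge1. Qed.
Let K0 : 0 <= K. Proof. exact: le_trans ler01 K_ge1. Qed.

Lemma K3_ge0 : 0 <= K3.
Proof. by rewrite /K3 !mulr_ge0// exprn_ge0. Qed.

Lemma ell_ge0 : 0 <= ell.
Proof. by rewrite addr_ge0// divr_ge0// ltW. Qed.

Lemma var_const_ge a : expR 1 * K3 <= var_const a.
Proof.
have h : 0 <= expR (1 : R) * K3 by rewrite mulr_ge0 ?expR_ge0// K3_ge0.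
elim: a => [//|a IH] /=.
rewrite mulrDr lerDr mulr_ge0 ?expR_ge0// mulr_ge0//.
exact: le_trans h IH.
Qed.

Lemma innov_sqr_le (innov1' innov2' innov3' : T -> R) :
  L2 innov1' -> L2 innov2' -> L2 innov3' ->
  E (fun w => innov1' w ^+ 2) <= S ^+ 3 * K * L%:R / n%:R ->
  E (fun w => innov2' w ^+ 2) <= S ^+ 3 * K * L%:R / n%:R ->
  E (fun w => innov3' w ^+ 2) <= S ^+ 2 * B * K * L%:R ^+ 2 / n%:R ^+ 2 ->
  E (fun w => (innov1' w + innov2' w + innov3' w) ^+ 2) <= K3 * ell / n%:R.
Proof.
move=> [m1 I1] [m2 I2] [m3 I3] h1 h2 h3.
have J1 := intbleZ 3 I1; have J2 := intbleZ 3 I2; have J3 := intbleZ 3 I3.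
have IS : intble (fun w => (innov1' w + innov2' w + innov3' w) ^+ 2).
  by have [] : L2 (fun w => innov1' w + innov2' w + innov3' w) by do 2 apply: L2D => //.
apply: (@le_trans _ _ (3 * (E (fun w => innov1' w ^+ 2) + E (fun w => innov2' w ^+ 2)
   + E (fun w => innov3' w ^+ 2)))).
  rewrite !mulrDr -(expectZ _ I1) -(expectZ _ I2) -(expectZ _ I3).
  rewrite -(expectD J1 J2) -(expectD (intbleD J1 J2) J3).
  apply: expect_le => //; first exact: intbleD (intbleD J1 J2) J3.
  move=> w; set a := innov1' w; set b := innov2' w; set c := innov3' w.
  by have := sqr_ge0 (a - b); have := sqr_ge0 (a - c); have := sqr_ge0 (b - c); nra.
apply: (@le_trans _ _ (3 * (S ^+ 3 * K * L%:R / n%:R + S ^+ 3 * K * L%:R / n%:R +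
  S ^+ 2 * B * K * L%:R ^+ 2 / n%:R ^+ 2))).
  by apply: ler_wpM2l => //; apply: lerD => //; exact: lerD.
have -> : K3 * ell / n%:R = 3 * (2 * (S ^+ 3 * B * K) * L%:R / n%:R +
    2 * (S ^+ 3 * B * K) * L%:R ^+ 2 / n%:R ^+ 2).
  by rewrite /K3 /ell; field; rewrite gt_eqF.
apply: ler_wpM2l => //; apply: lerD.
  have -> : S ^+ 3 * K * L%:R / n%:R + S ^+ 3 * K * L%:R / n%:R =
    1 * (2 * (S ^+ 3 * K) * L%:R / n%:R) by field; rewrite gt_eqF.
  have -> : 2 * (S ^+ 3 * B * K) * L%:R / n%:R =
    B * (2 * (S ^+ 3 * K) * L%:R / n%:R) by field; rewrite gt_eqF.
  by apply: ler_wpM2r => //; rewrite !mulr_ge0// ?exprn_ge0// invr_ge0 ltW.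
have -> : S ^+ 2 * B * K * L%:R ^+ 2 / n%:R ^+ 2 =
  1 * (S ^+ 2 * B * K * L%:R ^+ 2 / n%:R ^+ 2) by rewrite mul1r.
have -> : 2 * (S ^+ 3 * B * K) * L%:R ^+ 2 / n%:R ^+ 2 =
  (2 * S) * (S ^+ 2 * B * K * L%:R ^+ 2 / n%:R ^+ 2) by field; rewrite gt_eqF.
apply: ler_wpM2r; last by have := S_ge1; lra.
by rewrite !mulr_ge0// ?exprn_ge0// invr_ge0 exprn_ge0// ltW.
Qed.

(** The product of two new observations is split into its mean sigma / n and a centred part; the
    mean produces the cross sum of lower degrees, with weights multiplied by [sigma]. *)
Lemma crossSS a b v k w : cross a.+1 b.+1 v k.+1 w =
  cross a.+1 b.+1 v k w + n%:R^-1 * cross a b (fun l l' => v l l' * sigma l l') k w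
  + (innov1 v k a.+1 b w + innov2 v k a b.+1 w + innov3 v k a b w).
Proof.
rewrite /cross /innov1 /innov2 /innov3.
under [X in _ + (X + _ + _)]eq_bigr do rewrite mulr_sumr.
rewrite [X in _ + (X + _ + _)]exchange_big/=.
under [X in _ + (_ + X + _)]eq_bigr do rewrite mulr_sumr.
rewrite -(pair_bigA _ (fun l l' => (x k l w * x k l' w - sigma l l' / n%:R) *
    (v l l' * (elem a l k w * elem b l' k w))))/=.
rewrite mulr_sumr -!big_split/=; apply: eq_bigr => l _.
rewrite mulr_sumr -!big_split/=; apply: eq_bigr => l' _.
by rewrite !elemS; ring.
Qed.

(** A factor of degree 0 is constant, so there is no drift; this is the base of the induction on
    degrees. *)
Lemma cross0S b v k w : cross 0 b.+1 v k.+1 w = cross 0 b.+1 v k w + innov1 v k 0 b w.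
Proof.
rewrite /cross /innov1.
under [X in _ + X]eq_bigr do rewrite mulr_sumr.
rewrite [X in _ + X]exchange_big/= -big_split/=; apply: eq_bigr => l _.
rewrite -big_split/=; apply: eq_bigr => l' _.
by rewrite !elemS !elem0; ring.
Qed.

Lemma var_cst (c : R) : var P (fun=> c) = 0.
Proof. by rewrite /var !expect_cst subrr expr0n. Qed.

Lemma var_ge0 (f : T -> R) : 0 <= var P f.
Proof. by apply: expect_ge0 => w; exact: sqr_ge0. Qed.

(** [var_step] followed by Gronwall: each of the n steps is fed by 2 V / n from the drift and K3 ell
    / n from the innovation. *)
Lemma var_recursion (F g : nat -> T -> R) (D : nat -> T -> R) (c V : R) :
  0 <= V -> var P (F 0) = 0 ->
  (forall k, (k < n)%N -> [/\ gmeas (G k) (F k), gmeas (G k) (g k), L2 (F k)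
     & L2 (g k)]) ->
  (forall k, (k < n)%N -> L2 (D k) /\
    forall h, gmeas (G k) h -> L2 h -> E (fun w => h w * D k w) = 0) ->
  (forall k w, (k < n)%N -> F k.+1 w = F k w + c * g k w + D k w) ->
  (forall k, (k < n)%N -> (1 + n%:R) * c ^+ 2 * var P (g k) <= 2 * V / n%:R) ->
  (forall k, (k < n)%N -> E (fun w => D k w ^+ 2) <= K3 * ell / n%:R) ->
  forall k, (k <= n)%N -> var P (F k) <= expR 1 * (2 * V + K3 * ell).
Proof.
move=> V0 F0 Fg DD Frec gV DK k kn.
have KL : 0 <= K3 * ell by rewrite mulr_ge0 ?K3_ge0 ?ell_ge0.
have -> : expR 1 * (2 * V + K3 * ell) =
    expR 1 * n%:R * (2 * V / n%:R + K3 * ell / n%:R).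
  by field; rewrite gt_eqF.
apply: (@discrete_gronwall R n (fun k => var P (F k))) kn.
- by rewrite addr_ge0// divr_ge0// ?mulr_ge0// ltW.
- by rewrite F0.
move=> j jn; have [GF Gg LF Lg] := Fg j jn; have [LD D0] := DD j jn.
rewrite (_ : F j.+1 = fun w => F j w + c * g j w + D j w); last first.
  by apply/funext => w; exact: Frec.
apply: (le_trans (var_step c jn GF Gg LF Lg LD D0)).
by rewrite -addrA lerD2l; apply: lerD; [exact: gV|exact: DK].
Qed.

(** The condition on [v] is the one that survives the descent in the degrees: multiplying the
    weights by [sigma] keeps them below |sigma| because |sigma| <= 1. The constant depends on [a]
    alone, as the descent has at most [a] stages. *)
Lemma var_cross a b v k : (a <= Mx)%N -> (b <= Mx)%N -> (k <= n)%N ->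
  (forall l l', `|v l l'| <= `|sigma l l'|) ->
  var P (cross a b v k) <= var_const a * ell.
Proof.
have L0 : L2 (fun=> 0 : R) by exact: L2_cst.
have z2 : E (fun=> 0 ^+ 2 : R) = 0 by rewrite expr0n expect_cst.
have q1 : 0 <= S ^+ 3 * K * L%:R / n%:R.
  by rewrite !mulr_ge0// ?exprn_ge0// invr_ge0 ltW.
have q2 : 0 <= S ^+ 2 * B * K * L%:R ^+ 2 / n%:R ^+ 2.
  by rewrite !mulr_ge0// ?exprn_ge0// invr_ge0 exprn_ge0// ltW.
have Hz a' b' v' : (0 < a' + b')%N -> cross a' b' v' 0 = fun=> 0.
  move=> ab; apply/funext => w; apply: big1 => l _; apply: big1 => l' _.
  case: a' b' ab => [|a'] [|b'] // _; by rewrite /elem /= ?mulr0 ?mul0r ?mulr0.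
have zero b' v' k' : (b' <= Mx)%N -> (k' <= n)%N ->
    (forall l l', `|v' l l'| <= `|sigma l l'|) ->
    var P (cross 0 b' v' k') <= expR 1 * K3 * ell.
  move=> bM' kn' vs'; case: b' bM' => [|b'] bM'.
    rewrite (_ : cross 0 0 v' k' = fun=> \sum_l \sum_l' v' l l').
      by rewrite var_cst mulr_ge0 ?ell_ge0// mulr_ge0 ?expR_ge0 ?K3_ge0.
    apply/funext => w; apply: eq_bigr => l _; apply: eq_bigr => l' _.
    by rewrite !elem0 !mulr1.
  rewrite [leRHS](_ : _ = expR 1 * (2 * 0 + K3 * ell)); last first.
    by rewrite mulr0 add0r mulrA.
  apply: (@var_recursion (cross 0 b'.+1 v') (fun _ _ => 0)
    (fun j => innov1 v' j 0 b') 0 0) => //.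
  - by rewrite Hz// var_cst.
  - move=> j jn; have jn' := ltnW jn.
    split; [exact: cross_past|exact: measurable_cst|exact: cross_L2|exact: L2_cst].
  - by move=> j jn; exact: innov1_orth.
  - by move=> j w _; rewrite mulr0 addr0; exact: cross0S.
  - by move=> j _; rewrite expr0n/= !mulr0 !mul0r.
  - move=> j jn.
    have := @innov_sqr_le (innov1 v' j 0 b') (fun=> 0) (fun=> 0).
    under [X in expect _ X <= K3 * _ / _]eq_fun do rewrite !addr0.
    apply => //; rewrite ?z2//; first by case: (innov1_orth v' jn 0 b').
    by apply: innov1_sqr => //; exact: ltnW.
elim: a b v k => [|a IH] [|b] v k aM bM kn vs; [exact: zero|exact: zero| |].
- apply: (@le_trans _ _ (expR 1 * K3 * ell)); last first.
    by apply: ler_wpM2r; [exact: ell_ge0|exact: var_const_ge].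
  (* Transposing [v] exchanges the two factors and puts the degree 0 on the left; symmetry of
     [sigma] preserves the domination. *)
  rewrite (_ : cross a.+1 0 v k = cross 0 a.+1 (fun l l' => v l' l) k).
    by apply: zero => // l l'; rewrite sigma_sym.
  apply/funext => w; rewrite /cross exchange_big/=.
  by apply: eq_bigr => l _; apply: eq_bigr => l' _; rewrite [elem a.+1 _ _ _ * _]mulrC.
- have vs' l l' : `|v l l' * sigma l l'| <= `|sigma l l'|.
    rewrite normrM ler_piMl//.
    by apply: le_trans (sigma_le1 l l').
  rewrite [leRHS](_ : _ = expR 1 * (2 * (var_const a * ell) + K3 * ell));
    last by rewrite /=; ring.
  have V0 : 0 <= var_const a.
    by apply: le_trans (var_const_ge a); rewrite mulr_ge0 ?expR_ge0 ?K3_ge0.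
  apply: (@var_recursion (cross a.+1 b.+1 v)
    (cross a b (fun l l' => v l l' * sigma l l'))
    (fun j w => innov1 v j a.+1 b w + innov2 v j a b.+1 w + innov3 v j a b w) n%:R^-1
    (var_const a * ell)) => //.
  + by rewrite mulr_ge0// ell_ge0.
  + by rewrite Hz// var_cst.
  + move=> j jn; have jn' := ltnW jn.
    split; [exact: cross_past|exact: cross_past|exact: cross_L2|exact: cross_L2].
  + move=> j jn.
    have [LD1 O1] := innov1_orth v jn a.+1 b.
    have [LD2 O2] := innov2_orth v jn a b.+1.
    have [LD3 O3] := innov3_orth v jn a b.
    split; first by do 2 apply: L2D => //.
    move=> f Gf Lf.
    have J1 := L2_intbleM Lf LD1; have J2 := L2_intbleM Lf LD2.
    have J3 := L2_intbleM Lf LD3.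
    under [X in expect _ X]eq_fun do rewrite 2!mulrDr.
    by rewrite (expectD (intbleD J1 J2) J3) (expectD J1 J2) O1// O2// O3// !addr0.
  + by move=> j w _; exact: crossSS.
  + move=> j jn.
    have /(_ (var P _)) := @ler_pM R ((1 + n%:R) * n%:R^-1 ^+ 2) (2 / n%:R).
    move=> /(_ (cross a b (fun l l' => v l l' * sigma l l') j) (var_const a * ell)).
    rewrite (_ : 2 / n%:R * _ = 2 * (var_const a * ell) / n%:R); last by ring.
    apply.
    * by rewrite mulr_ge0// ?sqr_ge0// addr_ge0// ltW.
    * exact: var_ge0.
    * rewrite (_ : 2 / n%:R = 2 * n%:R * n%:R^-1 ^+ 2); last by field; rewrite gt_eqF.
      by apply: ler_wpM2r; [exact: sqr_ge0|have := n1; lra].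
    * by apply: IH => //; [exact: ltnW|exact: ltnW|exact: ltnW].
  + move=> j jn; have a' := ltnW aM; have b' := ltnW bM.
    apply: innov_sqr_le.
    * by case: (innov1_orth v jn a.+1 b).
    * by case: (innov2_orth v jn a b.+1).
    * by case: (innov3_orth v jn a b).
    * exact: innov1_sqr.
    * exact: innov2_sqr.
    * exact: innov3_sqr.
Qed.

(** * Characteristic function of the martingale, with a rate *)

Section clt.
Variables (I : finType) (m : I -> nat) (b : I -> R) (beta : R).
Hypothesis L_gt0 : (0 < L)%N.
Hypothesis m_Mx : forall i, (m i <= Mx)%N.
Hypothesis m_inj : injective m.
Hypothesis beta_ge0 : 0 <= beta.
Hypothesis b_sum : (\sum_i `|b i|) ^+ 2 <= beta / L%:R.

Let L0 : (0 : R) < L%:R. Proof. by rewrite ltr0n. Qed.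

(** The predictable coefficient of the new observation [x k l] in the increment; [m i] is the degree
    of the i-th statistic minus one, and [b_sum] makes the coefficient of order L^(-1/2). *)
Definition pcoef l k (w : T) : R := \sum_i b i * elem (m i) l k w.
Definition incr k (w : T) : R := \sum_l x k l w * pcoef l k w.
(** The conditional variance of [incr k] given the past, as [incr_sqr] shows. It is written through
    cross sums so that [var_cross] applies. *)
Definition cond_var k (w : T) : R :=
  \sum_(p : I * I) (n%:R^-1 * (b p.1 * b p.2)) * cross (m p.1) (m p.2) sigma k w.
Definition mart k (w : T) : R := \sum_(j < k) incr j w.

Lemma cond_varE k w :
  cond_var k w = \sum_l \sum_l' sigma l l' / n%:R * (pcoef l k w * pcoef l' k w).
Proof.
rewrite /cond_var -(pair_bigA _ (fun i j => (n%:R^-1 * (b i * b j)) *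
  cross (m i) (m j) sigma k w))/=.
under eq_bigr do under eq_bigr do rewrite /cross mulr_sumr.
under eq_bigr do rewrite exchange_big/=.
rewrite exchange_big/=; apply: eq_bigr => l _.
under eq_bigr do under eq_bigr do rewrite mulr_sumr.
under eq_bigr do rewrite exchange_big/=.
rewrite exchange_big/=; apply: eq_bigr => l' _.
rewrite /pcoef mulr_suml mulr_sumr; apply: eq_bigr => i _.
by rewrite !mulr_sumr; apply: eq_bigr => j _; ring.
Qed.

Lemma pcoef_past l k : (k <= n)%N -> gmeas (G k) (pcoef l k).
Proof.
move=> kn; apply: measurable_sum => i; apply: measurable_funM => //; exact: elem_past.
Qed.

Lemma pcoef_L4 l k : (k <= n)%N -> L4 (pcoef l k).
Proof. by move=> kn; apply: L4_sum => i; apply: L4Z; exact: elem_L4. Qed.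

Lemma pcoef_4 l k : (k <= n)%N ->
  E (fun w => pcoef l k w ^+ 4) <= beta ^+ 2 / L%:R ^+ 2 * K.
Proof.
move=> kn.
apply: le_trans (@expect_4_sum_le _ _ _ P _ b (fun i => elem (m i) l k) K _ _) _.
- by move=> i; exact: elem_L4.
- by move=> i; exact: elem_fourth_le.
apply: ler_wpM2r => //; rewrite (exprM _ 2 2) -expr_div_n.
apply: lerXn2r => //; rewrite nnegrE; first exact: sqr_ge0.
by rewrite divr_ge0// ltW.
Qed.

Lemma cond_var_L2 k : (k <= n)%N -> L2 (cond_var k).
Proof. by move=> kn; apply: L2_sum => p; apply: L2Z; exact: cross_L2. Qed.

(** As ell / L^2 = 1/L + 1/n, the standard deviation is of order (1/n) sqrt(1/L + 1/n), whose sum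
    over the n steps still tends to 0. *)
Lemma cond_var_var k : (k <= n)%N ->
  var P (cond_var k) <= beta ^+ 2 / L%:R ^+ 2 / n%:R ^+ 2 * (var_const Mx * ell).
Proof.
move=> kn.
have VC : 0 <= var_const Mx.
  by apply: le_trans (var_const_ge _); rewrite mulr_ge0 ?expR_ge0 ?K3_ge0.
(* The degrees [m i] differ, so the constant is taken at the largest degree allowed. *)
have mono a c : (a <= c)%N -> var_const a <= var_const c.
  elim: c => [|c IH]; first by rewrite leqn0 => /eqP ->.
  rewrite leq_eqVlt => /predU1P[->//|/IH h]; apply: (le_trans h).
  have h0 : 0 <= var_const c.
    by apply: le_trans (var_const_ge _); rewrite mulr_ge0 ?expR_ge0 ?K3_ge0.
  have e1 : 1 <= expR (1 : R) by have := @expR_ge1Dx R 1; lra.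
  have k3 := K3_ge0; rewrite /=; nra.
apply: le_trans (@var_sum_le _ _ _ P _ _ _ (var_const Mx * ell) _ _) _.
- by move=> p; exact: cross_L2.
- move=> p; apply: le_trans (var_cross _ _ _ _) _ => //.
  by apply: ler_wpM2r; [exact: ell_ge0|exact: mono].
apply: ler_wpM2r; first by rewrite mulr_ge0// ell_ge0.
rewrite (_ : \sum_(p : I * I) _ = n%:R^-1 * (\sum_i `|b i|) ^+ 2); last first.
  rewrite expr2 mulr_suml mulr_sumr.
  rewrite -(pair_bigA _ (fun i j => `|n%:R^-1 * (b i * b j)|))/=.
  apply: eq_bigr => i _; rewrite !mulr_sumr; apply: eq_bigr => j _.
  by rewrite !normrM ger0_norm// invr_ge0 ltW.
rewrite exprMn mulrC exprVn; apply: ler_wpM2r; first by rewrite invr_ge0 exprn_ge0// ltW.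
rewrite -expr_div_n; apply: lerXn2r => //; rewrite nnegrE; first exact: sqr_ge0.
by rewrite divr_ge0// ltW.
Qed.

Lemma x_pcoef_L4 k l : (k < n)%N -> L4 (fun w => x k l w * pcoef l k w).
Proof.
move=> kn; have kn' := ltnW kn; apply: (past_indep_L4 kn).
- exact: pcoef_past.
- exact: x_H.
- exact: pcoef_L4.
- exact: x_L4.
Qed.

Lemma incr_L4 k : (k < n)%N -> L4 (incr k).
Proof. by move=> kn; apply: L4_sum => l; exact: x_pcoef_L4. Qed.

Lemma incr_orth f k : (k < n)%N -> gmeas (G k) f -> L4 f ->
  E (fun w => f w * incr k w) = 0.
Proof.
move=> kn Gf Lf; have kn' := ltnW kn.
have [_] := @innov_orth _ (fun l => x k l) (fun l => pcoef l k) _ kn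
  (fun l => x_H l kn) (fun l => x_L2 l kn) (fun l => x_mean l kn)
  (fun l => pcoef_past l kn') (fun l => L4_L2 (pcoef_L4 l kn')).
by apply => //; exact: L4_L2.
Qed.

(** E[incr^2 | past] = [cond_var], tested against a function of the past: each product of two new
    observations averages to sigma / n. *)
Lemma incr_sqr f k : (k < n)%N -> gmeas (G k) f -> L4 f ->
  E (fun w => f w * incr k w ^+ 2) = E (fun w => f w * cond_var k w).
Proof.
move=> kn Gf Lf; have kn' := ltnW kn.
have IQ l l' : intble (fun w => f w * (pcoef l k w * pcoef l' k w)).
  apply: (intble_ext _ (L4_prod Lf (pcoef_L4 l kn') (pcoef_L4 l' kn') (L4_cst P 1))) => w.
  by rewrite mulr1 mulrA.
have GQ l l' : gmeas (G k) (fun w => f w * (pcoef l k w * pcoef l' k w)).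
  by apply: measurable_funM => //; apply: measurable_funM; exact: pcoef_past.
have Ix l l' := L4_intble2 (x_L4 l kn) (x_L4 l' kn).
have Hx l l' := measurable_funM (x_H l kn) (x_H l' kn).
have C l l' := past_indep kn (GQ l l') (Hx l l') (IQ l l') (Ix l l').
rewrite (_ : (fun w => f w * incr k w ^+ 2) = fun w => \sum_l \sum_l'
    (f w * (pcoef l k w * pcoef l' k w)) * (x k l w * x k l' w)); last first.
  apply/funext => w; rewrite /incr mulr_sum_sqr; apply: eq_bigr => l _.
  by apply: eq_bigr => l' _; ring.
rewrite (_ : (fun w => f w * cond_var k w) = fun w => \sum_l \sum_l'
    sigma l l' / n%:R * (f w * (pcoef l k w * pcoef l' k w))); last first.
  apply/funext => w; rewrite cond_varE mulr_sumr; apply: eq_bigr => l _.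
  by rewrite mulr_sumr; apply: eq_bigr => l' _; ring.
rewrite !expect_sum; last 2 first.
- by move=> l _; apply: intble_sum => l' _; exact: intbleZ.
- by move=> l _; apply: intble_sum => l' _; case: (C l l').
apply: eq_bigr => l _; rewrite !expect_sum; last 2 first.
- by move=> l' _; exact: intbleZ.
- by move=> l' _; case: (C l l').
apply: eq_bigr => l' _; rewrite expectZ//.
by rewrite (proj2 (C l l')) x_cov// mulrC.
Qed.

Let Gam : R := B * beta ^+ 2 * K.

(** The Lyapunov bound. Past and present separate in each quadruple of indices; the coefficients
    contribute L^-2 uniformly and [x_quad] bounds the total of the mixed moments by L^2 / n^2 up to
    a constant, so L cancels. *)
Lemma incr_4 k : (k < n)%N -> E (fun w => incr k w ^+ 4) <= Gam / n%:R ^+ 2.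
Proof.
move=> kn; have kn' := ltnW kn.
pose qq (p q : 'I_L * 'I_L) w := pcoef p.1 k w * pcoef p.2 k w * pcoef q.1 k w * pcoef q.2 k w.
pose xx (p q : 'I_L * 'I_L) w := x k p.1 w * x k p.2 w * x k q.1 w * x k q.2 w.
have Iq p q : intble (qq p q) by apply: L4_prod; exact: pcoef_L4.
have Ix p q : intble (xx p q) by apply: L4_prod; exact: x_L4.
have Gq p q : gmeas (G k) (qq p q).
  by do 3 (apply: measurable_funM; last exact: pcoef_past); exact: pcoef_past.
have Hx p q : gmeas (H k) (xx p q).
  by do 3 (apply: measurable_funM; last exact: x_H); exact: x_H.
have C p q := past_indep kn (Gq p q) (Hx p q) (Iq p q) (Ix p q).
rewrite (_ : (fun w => incr k w ^+ 4) = fun w => \sum_p \sum_q qq p q w * xx p q w).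
  rewrite expect_sum; last first.
    by move=> p _; apply: intble_sum => q _; case: (C p q).
  apply: (@le_trans _ _ (\sum_p \sum_q
      beta ^+ 2 / L%:R ^+ 2 * K * `|E (xx p q)|)).
    apply: ler_sum => p _; rewrite expect_sum; last by move=> q _; case: (C p q).
    apply: ler_sum => q _; rewrite (proj2 (C p q)).
    apply: (le_trans (ler_norm _)); rewrite normrM; apply: ler_wpM2r => //.
    by apply: expect_prod4_le; by [exact: pcoef_L4|exact: pcoef_4].
  under eq_bigr do rewrite -mulr_sumr.
  rewrite -mulr_sumr.
  apply: (@le_trans _ _ (beta ^+ 2 / L%:R ^+ 2 * K * (B * L%:R ^+ 2 / n%:R ^+ 2))).
    apply: ler_wpM2l; last exact: x_quad.
    by rewrite !mulr_ge0 ?sqr_ge0// invr_ge0 exprn_ge0// ltW.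
  rewrite le_eqVlt; apply/orP; left; apply/eqP; rewrite /Gam; field.
  by rewrite !gt_eqF.
apply/funext => w; rewrite (exprM _ 2 2).
have -> : incr k w ^+ 2 = \sum_(p : 'I_L * 'I_L)
    (pcoef p.1 k w * pcoef p.2 k w) * (x k p.1 w * x k p.2 w).
  rewrite /incr -[LHS]mul1r mulr_sum_sqr.
  rewrite -(pair_bigA _ (fun l l' => (pcoef l k w * pcoef l' k w) * (x k l w * x k l' w)))/=.
  by apply: eq_bigr => l _; apply: eq_bigr => l' _; ring.
rewrite -[LHS]mul1r mulr_sum_sqr; apply: eq_bigr => p _.
by apply: eq_bigr => q _; rewrite /qq /xx; ring.
Qed.

Lemma Gam_ge0 : 0 <= Gam.
Proof. by rewrite /Gam !mulr_ge0// sqr_ge0. Qed.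

Lemma incr_2 k : (k < n)%N -> E (fun w => incr k w ^+ 2) = E (cond_var k).
Proof.
move=> kn; have := incr_sqr kn (measurable_cst (1 : R)) (L4_cst P 1).
under [X in expect _ X = _]eq_fun do rewrite mul1r.
by under [X in _ = expect _ X -> _]eq_fun do rewrite mul1r.
Qed.

(** Jensen's inequality, since [cond_var] has the mean of the squared increment. *)
Lemma cond_var_sqr_le k : (k < n)%N -> E (cond_var k) ^+ 2 <= Gam / n%:R ^+ 2.
Proof.
move=> kn; rewrite -incr_2//; apply: le_trans (incr_4 kn).
have [_ I4] := incr_L4 kn; have I2 := L4_sqr (incr_L4 kn).
have := var_ge0 (fun w => incr k w ^+ 2); rewrite /var.
set c := E (fun w => incr k w ^+ 2).
rewrite (_ : (fun w => _) = fun w => incr k w ^+ 4 - 2 * c * incr k w ^+ 2 + c ^+ 2); last first.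
  by apply/funext => w; ring.
have I2' := intbleZ (2 * c) I2.
rewrite (expectD (intbleB I4 I2') (intble_cst _ _)) (expectB I4 I2').
rewrite (expectZ _ I2) expect_cst -/c; lra.
Qed.

Lemma cond_var_mean_ge0 k : (k < n)%N -> 0 <= E (cond_var k).
Proof. by move=> kn; rewrite -incr_2//; apply: expect_ge0 => w; exact: sqr_ge0. Qed.

Lemma mart_past k : (k <= n)%N -> gmeas (G k) (mart k).
Proof.
elim: k => [|k IH] kn.
  by rewrite (_ : mart 0 = fun=> 0); [exact: measurable_cst|
    apply/funext => w; rewrite /mart big_ord0].
rewrite (_ : mart k.+1 = fun w => mart k w + incr k w); last first.
  by apply/funext => w; rewrite /mart big_ord_recr.
apply: measurable_funD.
  by apply: (gmeas_sub (@G_mono k)); apply: IH; exact: ltnW.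
apply: measurable_sum => l; apply: measurable_funM.
  by apply: (gmeas_sub (H_next kn)); exact: x_H.
by apply: (gmeas_sub (@G_mono k)); apply: pcoef_past; exact: ltnW.
Qed.

Lemma past_comp (phi : R -> R) k f : continuous phi -> gmeas (G k) f ->
  gmeas (G k) (phi \o f).
Proof.
by move=> cphi Gf; apply: measurableT_comp => //; exact: continuous_measurable_fun.
Qed.

Lemma bounded_L4 (f : T -> R) (c : R) : measurable_fun setT f -> (forall w, `|f w| <= c) -> L4 f.
Proof.
move=> mf fc; split => //; apply: (@intble_bounded _ _ _ _ _ (c ^+ 4)).
  exact: measurable_funX.
move=> w; rewrite normrX; apply: lerXn2r => //; rewrite nnegrE//.
exact: le_trans (fc w).
Qed.

(** Second-order Taylor expansion around the past value. The linear term has mean zero; in the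
    quadratic one the squared increment becomes the conditional variance, then its mean v, and
    finally 1 - v/2 becomes exp(-v/2). The errors are the fluctuation of the conditional variance,
    the cubic remainder and the error on the exponential. *)
Lemma cos_step (alpha : R) k : (k < n)%N ->
  `|E (fun w => cos (mart k.+1 w + alpha))
    - expR (- (E (cond_var k) / 2)) * E (fun w => cos (mart k w + alpha))| <=
  2^-1 * E (fun w => `|cond_var k w - E (cond_var k)|) + E (fun w => `|incr k w| ^+ 3)
  + E (cond_var k) ^+ 2 / 4.
Proof.
move=> kn; have kn' := ltnW kn.
set v := E (cond_var k); have v0 : 0 <= v by exact: cond_var_mean_ge0.
pose c w := cos (mart k w + alpha); pose s w := sin (mart k w + alpha).
have GW : gmeas (G k) (fun w => mart k w + alpha).
  by apply: measurable_funD => //; exact: mart_past.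
have Gc : gmeas (G k) c by apply: past_comp GW; exact: continuous_cos.
have Gs : gmeas (G k) s by apply: past_comp GW; exact: continuous_sin.
have c1 w : `|c w| <= 1 by exact: cos_max.
have s1 w : `|s w| <= 1 by exact: sin_max.
have mc := gmeas_measurable (@G_meas k) Gc.
have ms := gmeas_measurable (@G_meas k) Gs.
have Lc : L4 c by exact: bounded_L4 mc c1.
have Ls : L4 s by exact: bounded_L4 ms s1.
have Lx := incr_L4 kn; have Lv := cond_var_L2 kn'.
have Ic := L4_intble Lc.
have Isx := L4_intble2 Ls Lx.
have Icx : intble (fun w => c w * incr k w ^+ 2).
  apply: (intble_ext _ (L4_prod Lc Lx Lx (L4_cst P 1))) => w.
  by rewrite mulr1 expr2 mulrA.
have Icv : intble (fun w => c w * cond_var k w).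
  by apply: L2_intbleM => //; exact: L4_L2.
have Ix3 : intble (fun w => `|incr k w| ^+ 3).
  by apply: (intble_ext _ (intble_norm (L4_cube Lx))) => w; rewrite normrX.
have mn : measurable_fun setT (fun w => cos (mart k.+1 w + alpha)).
  apply: (gmeas_measurable (@G_meas k.+1)).
  apply: (past_comp (f := fun w => mart k.+1 w + alpha)); first exact: continuous_cos.
  by apply: measurable_funD => //; exact: mart_past.
have In : intble (fun w => cos (mart k.+1 w + alpha)).
  by apply: (@intble_bounded _ _ _ P _ 1 mn) => w; exact: cos_max.
pose app w := c w - s w * incr k w - 2^-1 * (c w * incr k w ^+ 2).
have Icx2 := intbleZ 2^-1 Icx.
have Iapp : intble app by exact: intbleB (intbleB Ic Isx) Icx2.
have Eapp : E app = E c - 2^-1 * E (fun w => c w * cond_var k w).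
  rewrite /app (expectB (intbleB Ic Isx) Icx2) (expectB Ic Isx) expectZ//.
  by rewrite incr_orth// incr_sqr// subr0.
have h1 : `|E (fun w => cos (mart k.+1 w + alpha)) - E app| <=
    E (fun w => `|incr k w| ^+ 3).
  rewrite -(expectB In Iapp); apply: expect_le_norm => //; first exact: intbleB.
  move=> w; rewrite /app.
  have -> : mart k.+1 w + alpha = (mart k w + alpha) + incr k w.
    by rewrite /mart big_ord_recr/=; ring.
  have := cosD_taylor2 (mart k w + alpha) (incr k w); rewrite -/(c w) -/(s w).
  rewrite (_ : _ - incr k w * s w - _ =
     c w - s w * incr k w - 2^-1 * (c w * incr k w ^+ 2))//.
  by field.
have Ivc : intble (fun w => cond_var k w - v).
  by apply: L2_intble; apply: L2B => //; exact: L2_cst.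
have h2 : `|E (fun w => c w * cond_var k w) - v * E c| <=
    E (fun w => `|cond_var k w - v|).
  rewrite -expectZ// -(expectB Icv (intbleZ v Ic)).
  apply: expect_le_norm; [exact: intbleB Icv (intbleZ v Ic)|exact: intble_norm|].
  move=> w; rewrite (_ : _ - _ = c w * (cond_var k w - v)); last by ring.
  by rewrite normrM ler_piMl.
have h3 : `|E c| <= 1.
  rewrite -[leRHS](expect_cst P); apply: expect_le_norm => //; exact: intble_cst.
have h4 : `|1 - v / 2 - expR (- (v / 2))| <= v ^+ 2 / 4.
  have v20 : 0 <= v / 2 by rewrite divr_ge0.
  have /andP[a1 a2] := expRN_bounds v20.
  rewrite ler_norml; apply/andP; split; last by have := sqr_ge0 v; lra.
  have -> : v ^+ 2 / 4 = (v / 2) ^+ 2 by field.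
  lra.
rewrite -/c.
have -> : E (fun w => cos (mart k.+1 w + alpha)) - expR (- (v / 2)) * E c =
   (E (fun w => cos (mart k.+1 w + alpha)) - E app)
   - 2^-1 * (E (fun w => c w * cond_var k w) - v * E c)
   + (1 - v / 2 - expR (- (v / 2))) * E c by rewrite Eapp; field.
apply: (le_trans (ler_normD _ _)); apply: lerD; last first.
  rewrite normrM -[leRHS]mulr1; exact: ler_pM.
apply: (le_trans (ler_normB _ _)); rewrite addrC; apply: lerD => //.
by rewrite normrM ger0_norm// ler_wpM2l.
Qed.

(** The factors exp(-v/2) are at most 1, so the errors of the single steps add up without
    amplification. *)
Lemma mart_cos_bound (alpha : R) :
  `|E (fun w => cos (mart n w + alpha))
    - expR (- ((\sum_(k < n) E (cond_var k)) / 2)) * cos alpha| <=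
  \sum_(k < n) (2^-1 * E (fun w => `|cond_var k w - E (cond_var k)|)
     + E (fun w => `|incr k w| ^+ 3) + E (cond_var k) ^+ 2 / 4).
Proof.
suff claim k : (k <= n)%N ->
  `|E (fun w => cos (mart k w + alpha))
    - expR (- ((\sum_(j < k) E (cond_var j)) / 2)) * cos alpha| <=
  \sum_(j < k) (2^-1 * E (fun w => `|cond_var j w - E (cond_var j)|)
     + E (fun w => `|incr j w| ^+ 3) + E (cond_var j) ^+ 2 / 4) by exact: claim.
elim: k => [_|k IH kn].
  rewrite !big_ord0 mul0r oppr0 expR0 mul1r.
  rewrite (_ : (fun w => _) = fun=> cos alpha).
    by rewrite expect_cst subrr normr0.
  by apply/funext => w; rewrite /mart big_ord0 add0r.
rewrite !big_ord_recr/=.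
have := IH (ltnW kn); have := cos_step alpha kn.
set v := E (cond_var k); have v0 : 0 <= v by exact: cond_var_mean_ge0.
set t := \sum_(j < k) _; set u1 := E (fun w => cos (mart k.+1 w + alpha)).
set u0 := E (fun w => cos (mart k w + alpha)); set r := \sum_(j < k) _.
set q := _ + _ + _ => h1 h2.
have -> : - ((t + v) / 2) = - (v / 2) + - (t / 2) by field.
rewrite expRD.
have -> : u1 - expR (- (v / 2)) * expR (- (t / 2)) * cos alpha =
  expR (- (v / 2)) * (u0 - expR (- (t / 2)) * cos alpha)
  + (u1 - expR (- (v / 2)) * u0) by ring.
apply: (le_trans (ler_normD _ _)); apply: lerD => //.
rewrite normrM ger0_norm ?expR_ge0//; apply: le_trans h2.
by rewrite ler_piMl// -expR0 ler_expR oppr_le0 divr_ge0.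
Qed.

(** Each step costs at most 1/n times the right side: the first term comes from the variance of
    [cond_var], the second from the third absolute moments and the squared means. *)
Lemma mart_cos_rate (alpha : R) :
  `|E (fun w => cos (mart n w + alpha))
    - expR (- ((\sum_(k < n) E (cond_var k)) / 2)) * cos alpha| <=
  beta * Num.sqrt (var_const Mx * (L%:R^-1 + n%:R^-1))
  + (1 + 2 * Gam) / Num.sqrt n%:R.
Proof.
apply: (le_trans (mart_cos_bound alpha)).
set q := Num.sqrt (_ * _); set r := Num.sqrt n%:R.
have r0 : 0 < r by rewrite sqrtr_gt0.
have rr : n%:R = r ^+ 2 by rewrite sqr_sqrtr// ltW.
have r1 : 1 <= r by rewrite -sqrtr1 ler_wsqrtr.
have VC : 0 <= var_const Mx.
  by apply: le_trans (var_const_ge _); rewrite mulr_ge0 ?expR_ge0 ?K3_ge0.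
have Gm := Gam_ge0.
apply: (@le_trans _ _ (\sum_(k < n) (beta * q + (1 + 2 * Gam) / r) / n%:R)); last first.
  by rewrite sumr_const card_ord -[X in X <= _]mulr_natr mulfVK// gt_eqF.
apply: ler_sum => k _; have kn := ltn_ord k; have kn' := ltnW kn.
have h1 : E (fun w => `|cond_var k w - E (cond_var k)|) <= beta * q / n%:R.
  have Lc : L2 (fun w => cond_var k w - E (cond_var k)).
    by apply: L2B; [exact: cond_var_L2|exact: L2_cst].
  apply: (le_trans (expect_sqr_norm (L2_intble Lc) (proj2 Lc))).
  rewrite -[leRHS]ger0_norm; last first.
    by rewrite divr_ge0// ?(ltW n0)// mulr_ge0// sqrtr_ge0.
  rewrite -sqrtr_sqr ler_wsqrtr//; apply: (le_trans (cond_var_var kn')).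
  rewrite expr_div_n exprMn /q sqr_sqrtr; last first.
    by rewrite mulr_ge0// addr_ge0// invr_ge0 ltW.
  rewrite le_eqVlt; apply/orP; left; apply/eqP; rewrite /ell; field.
  by rewrite !gt_eqF.
have L4x := incr_L4 kn.
have h4 := incr_4 kn.
(* From z <= z^2 + 1/4, a bound on the square of z = n E(cond_var) becomes one on z. *)
have h2 : E (fun w => incr k w ^+ 2) <= (1 + Gam) / n%:R.
  rewrite incr_2//; have c0 := cond_var_mean_ge0 kn.
  have : (E (cond_var k) * n%:R) ^+ 2 <= Gam.
    rewrite exprMn -ler_pdivlMr ?exprn_gt0//; exact: cond_var_sqr_le.
  rewrite ler_pdivlMr//; set z := _ * _ => zG.
  by have := sqr_ge0 (z - 2^-1); nra.
(* |a|^3 <= a^2 / (2 r) + r a^4 / 2 with r = sqrt n balances second moments of order 1/n against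
   fourth moments of order 1/n^2. *)
have h3 : E (fun w => `|incr k w| ^+ 3) <= 2^-1 * (1 + 2 * Gam) / r / n%:R.
  have I3 : intble (fun w => `|incr k w| ^+ 3).
    by apply: (intble_ext _ (intble_norm (L4_cube L4x))) => w; rewrite normrX.
  have I2 := intbleZ (2^-1 / r) (L4_sqr L4x).
  have I4 := intbleZ (2^-1 * r) (proj2 L4x).
  apply: (le_trans (expect_le I3 (intbleD I2 I4) _)).
    move=> w; set a := incr k w.
    have -> : a ^+ 4 = `|a| ^+ 4 by rewrite (exprM _ 2 2) -(real_normK (num_real a)) -exprM.
    rewrite -(real_normK (num_real a)); set u := `|a|.
    have : 0 <= 2^-1 / r * (u * (1 - r * u)) ^+ 2.
      by rewrite mulr_ge0 ?sqr_ge0// divr_ge0// ltW.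
    have -> : 2^-1 / r * (u * (1 - r * u)) ^+ 2 =
      2^-1 / r * u ^+ 2 - u ^+ 3 + 2^-1 * r * u ^+ 4 by field; rewrite gt_eqF.
    lra.
  rewrite (expectD I2 I4) !expectZ; [|exact: (proj2 L4x)|exact: L4_sqr].
  have e2 : 2^-1 / r * E (fun w => incr k w ^+ 2) <= 2^-1 / r * ((1 + Gam) / n%:R).
    by apply: ler_wpM2l => //; rewrite divr_ge0// ltW.
  have e4 : 2^-1 * r * E (fun w => incr k w ^+ 4) <= 2^-1 * r * (Gam / n%:R ^+ 2).
    by apply: ler_wpM2l => //; rewrite mulr_ge0// ltW.
  apply: (le_trans (lerD e2 e4)).
  rewrite le_eqVlt; apply/orP; left; apply/eqP; rewrite rr; field.
  by rewrite gt_eqF.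
have h5 : E (cond_var k) ^+ 2 / 4 <= Gam / r / n%:R / 4.
  apply: ler_wpM2r => //; apply: (le_trans (cond_var_sqr_le kn)).
  rewrite [in leLHS]expr2 invfM mulrA; apply: ler_wpM2r; first by rewrite invr_ge0 ltW.
  apply: ler_wpM2l => //; rewrite lef_pV2 ?posrE//.
  by rewrite rr expr2 ler_peMr// ltW.
have -> : (beta * q + (1 + 2 * Gam) / r) / n%:R =
  beta * q / n%:R + (1 + 2 * Gam) / r / n%:R by rewrite mulrDl.
have bq : 0 <= beta * q / n%:R by rewrite divr_ge0// ?(ltW n0)// mulr_ge0// sqrtr_ge0.
set rn : R := r^-1 / n%:R.
have rn0 : 0 <= rn by rewrite divr_ge0// ?invr_ge0 ltW.
have -> : (1 + 2 * Gam) / r / n%:R = (1 + 2 * Gam) * rn by rewrite /rn; ring.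
have h3' : E (fun w => `|incr k w| ^+ 3) <= 2^-1 * (1 + 2 * Gam) * rn.
  by rewrite (_ : _ * rn = 2^-1 * (1 + 2 * Gam) / r / n%:R)// /rn; ring.
have h5' : E (cond_var k) ^+ 2 / 4 <= Gam * rn / 4.
  by rewrite (_ : Gam * rn = Gam / r / n%:R)// /rn; ring.
nra.
Qed.

Lemma elem_sum m' l : forall w, elem m'.+1 l n w = \sum_(k < n) x k l w * elem m' l k w.
Proof. by move=> w; rewrite /elem elemsym_sum. Qed.

Lemma martE w : mart n w = \sum_i b i * \sum_l elem (m i).+1 l n w.
Proof.
rewrite /mart /incr /pcoef.
under eq_bigr do under eq_bigr do rewrite mulr_sumr.
under eq_bigr do rewrite exchange_big/=.
rewrite exchange_big/=; apply: eq_bigr => i _.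
rewrite exchange_big mulr_sumr/=; apply: eq_bigr => l _.
by rewrite elem_sum mulr_sumr; apply: eq_bigr => k _; ring.
Qed.

(** Orthogonality of distinct degrees leaves the diagonal of the double sum over [I], and the C(k,
    m) with k < n add up to C(n, m + 1). The total variance is thus exact, not only asymptotic. *)
Lemma cond_var_mean_sum : \sum_(k < n) E (cond_var k) =
  \sum_i b i ^+ 2 * ('C(n, (m i).+1)%:R *
     \sum_l \sum_l' (sigma l l' / n%:R) ^+ (m i).+1).
Proof.
have EH a c k : (k <= n)%N -> E (cross a c sigma k) =
    (a == c)%:R * 'C(k, a)%:R * \sum_l \sum_l' sigma l l' * (sigma l l' / n%:R) ^+ a.
  move=> kn; rewrite /cross expect_sum; last first.
    move=> l _; apply: intble_sum => l' _; apply: intbleZ.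
    by apply: L4_intble2; exact: elem_L4.
  rewrite mulr_sumr; apply: eq_bigr => l _; rewrite expect_sum; last first.
    by move=> l' _; apply: intbleZ; apply: L4_intble2; exact: elem_L4.
  rewrite mulr_sumr; apply: eq_bigr => l' _; rewrite expectZ; last first.
    by apply: L4_intble2; exact: elem_L4.
  by rewrite elem_cov//; ring.
have EC k : (k < n)%N -> E (cond_var k) = \sum_i b i ^+ 2 * ('C(k, m i)%:R *
    \sum_l \sum_l' (sigma l l' / n%:R) ^+ (m i).+1).
  move=> kn; have kn' := ltnW kn.
  rewrite /cond_var expect_sum; last first.
    by move=> p _; apply: intbleZ; apply: L2_intble; exact: cross_L2.
  rewrite -(pair_bigA _ (fun i j => E (fun w => n%:R^-1 * (b i * b j) *
    cross (m i) (m j) sigma k w)))/=.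
  apply: eq_bigr => i _; rewrite (bigD1 i)//= [X in _ + X]big1 ?addr0; last first.
    move=> j ji; rewrite expectZ; last by apply: L2_intble; exact: cross_L2.
    by rewrite EH// (inj_eq m_inj) eq_sym (negbTE ji) !mul0r mulr0.
  rewrite expectZ; last by apply: L2_intble; exact: cross_L2.
  rewrite EH// eqxx mul1r.
  have -> : \sum_l \sum_l' (sigma l l' / n%:R) ^+ (m i).+1 =
      n%:R^-1 * \sum_l \sum_l' sigma l l' * (sigma l l' / n%:R) ^+ m i.
    rewrite mulr_sumr; apply: eq_bigr => l _.
    by rewrite mulr_sumr; apply: eq_bigr => l' _; rewrite exprS; ring.
  ring.
under eq_bigr => k _ do rewrite EC//.
rewrite exchange_big/=; apply: eq_bigr => i _.
rewrite -mulr_sumr -mulr_suml; congr (_ * (_ * _)).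
rewrite -natr_sum; congr (_%:R).
elim: n => [|j IH]; first by rewrite big_ord0.
by rewrite big_ord_recr/= IH binS.
Qed.

End clt.

End martingale.

(** * From characteristic functions to orthants *)

Section sharpening.
Variable R : realType.

(* [sharpen] fixes -1, 0 and 1 and pushes every other point of [-1, 1] away
   from 0; its iterates of a sine approximate a square wave uniformly away from
   the zeros, while remaining trigonometric polynomials. *)
Definition sharpen (v : R) : R := (3 * v - v ^+ 3) / 2.

Lemma sharpenN v : sharpen (- v) = - sharpen v.
Proof. by rewrite /sharpen; field. Qed.

Lemma iter_sharpenN N v : iter N sharpen (- v) = - iter N sharpen v.
Proof. by elim: N => //= N ->; rewrite sharpenN. Qed.

Lemma sharpen_itv v : 0 <= v <= 1 -> v <= sharpen v <= 1.
Proof.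
move=> /andP[v0 v1]; have v2 : v ^+ 2 <= 1 by rewrite expr_le1.
have e : v ^+ 3 = v * v ^+ 2 by rewrite exprS.
apply/andP; split; rewrite /sharpen.
  have : v * v ^+ 2 <= v by rewrite ler_piMr.
  by rewrite e; lra.
have : 0 <= (1 - v) ^+ 2 * (2 + v) by rewrite mulr_ge0 ?sqr_ge0//; lra.
have -> : (1 - v) ^+ 2 * (2 + v) = 2 - 3 * v + v ^+ 3 by ring.
lra.
Qed.

Lemma iter_sharpen_itv N v : 0 <= v <= 1 -> v <= iter N sharpen v <= 1.
Proof.
move=> /andP[v0 v1]; elim: N => [|N /andP[h1 h2]] /=; first by rewrite lexx.
have /andP[a ->] : iter N sharpen v <= sharpen (iter N sharpen v) <= 1.
  by apply: sharpen_itv; rewrite h2 (le_trans v0).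
by rewrite (le_trans h1 a).
Qed.

Lemma iter_sharpen_norm N v : `|v| <= 1 -> `|iter N sharpen v| <= 1.
Proof.
move=> v1; have [v0|v0] := ger0P v.
  have /(iter_sharpen_itv N)/andP[a b] : 0 <= v <= 1.
    by rewrite v0 (le_trans (ler_norm _) v1).
  by rewrite ger0_norm// (le_trans v0).
have w0 : 0 <= - v by rewrite oppr_ge0 ltW.
have /(iter_sharpen_itv N)/andP[a b] : 0 <= - v <= 1.
  by rewrite w0 -(ltr0_norm v0).
rewrite iter_sharpenN in a b.
by rewrite -normrN ger0_norm// (le_trans w0).
Qed.

(** 1 - s(u) = (1 - u)^2 (2 + u) / 2 for s = [sharpen], and (1 - u)(2 + u) / 2 <= 1 - u/2 <= 1 -
    delta/2 because the iterates stay above delta. The distance to 1 shrinks geometrically. *)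
Lemma iter_sharpen_cvg N v delta : 0 <= delta -> delta <= v -> v <= 1 ->
  1 - iter N sharpen v <= (1 - delta / 2) ^+ N.
Proof.
move=> d0 dv v1.
have v0 : 0 <= v by exact: le_trans dv.
have vv : 0 <= v <= 1 by rewrite v0.
elim: N => [|N IH]; first by rewrite expr0 /=; lra.
have /andP[a b] := iter_sharpen_itv N vv.
rewrite iterS; set u := iter N sharpen v in IH a b *.
have -> : 1 - sharpen u = ((1 - u) * (2 + u) / 2) * (1 - u).
  by rewrite /sharpen; field.
rewrite exprS; apply: ler_pM => //; [|lra|].
  by rewrite divr_ge0// mulr_ge0//; lra.
have u0 : 0 <= u by exact: le_trans a.
have : 0 <= u ^+ 2 by exact: sqr_ge0.
nra.
Qed.

End sharpening.

(** * Trigonometric polynomials close to orthant indicators *)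

Section trigpoly.
Variables (R : realType) (I : finType).
Implicit Types f g : (I -> R) -> R.

(** The phase [alpha] makes sines available, so that real cosines do the work of complex
    exponentials. *)
Inductive trigpoly : ((I -> R) -> R) -> Prop :=
| trigpoly_cos (theta : I -> R) (alpha : R) :
    trigpoly (fun x => cos (\sum_i theta i * x i + alpha))
| trigpolyD f g : trigpoly f -> trigpoly g -> trigpoly (fun x => f x + g x)
| trigpolyZ (c : R) f : trigpoly f -> trigpoly (fun x => c * f x).

Lemma trigpoly_ext f g : f =1 g -> trigpoly f -> trigpoly g.
Proof. by move=> /funext ->. Qed.

Lemma trigpoly_cst (c : R) : trigpoly (fun=> c).
Proof.
apply: (trigpoly_ext _ (trigpolyZ c (trigpoly_cos (fun=> 0) 0))) => x.
by rewrite big1 ?add0r ?cos0 ?mulr1// => i _; rewrite mul0r.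
Qed.

(** The product-to-sum formula for two generators; the rest is bilinearity. *)
Lemma trigpolyM f g : trigpoly f -> trigpoly g -> trigpoly (fun x => f x * g x).
Proof.
move=> tf tg; elim: tf => [theta alpha|f1 f2 _ h1 _ h2|c f' _ h].
- elim: tg => [theta' alpha'|g1 g2 _ h1 _ h2|c g' _ h].
  + apply: (trigpoly_ext _ (trigpolyD
     (trigpolyZ 2^-1 (trigpoly_cos (fun i => theta i + theta' i) (alpha + alpha')))
     (trigpolyZ 2^-1 (trigpoly_cos (fun i => theta i - theta' i) (alpha - alpha'))))).
    move=> x.
    have -> : \sum_i (theta i + theta' i) * x i =
        \sum_i theta i * x i + \sum_i theta' i * x i.
      by rewrite -big_split/=; apply: eq_bigr => i _; rewrite mulrDl.
    have -> : \sum_i (theta i - theta' i) * x i =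
        \sum_i theta i * x i - \sum_i theta' i * x i.
      by rewrite -sumrB; apply: eq_bigr => i _; rewrite mulrBl.
    set a := \sum_i theta i * _; set b := \sum_i theta' i * _.
    have -> : a + b + (alpha + alpha') = (a + alpha) + (b + alpha') by ring.
    have -> : a - b + (alpha - alpha') = (a + alpha) - (b + alpha') by ring.
    by rewrite [cos (_ - _)]cosB [cos (_ + (b + _))]cosD; field.
  + by apply: (trigpoly_ext _ (trigpolyD h1 h2)) => x; rewrite mulrDr.
  + by apply: (trigpoly_ext _ (trigpolyZ c h)) => x; rewrite mulrCA.
- by apply: (trigpoly_ext _ (trigpolyD h1 h2)) => x; rewrite mulrDl.
- by apply: (trigpoly_ext _ (trigpolyZ c h)) => x; rewrite mulrA.
Qed.

Lemma trigpoly_sharpen N f :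
  trigpoly f -> trigpoly (fun x => iter N (@sharpen R) (f x)).
Proof.
move=> tf; elim: N => [//|N h].
have h3 := trigpolyM h (trigpolyM h h).
apply: (trigpoly_ext _ (trigpolyD (trigpolyZ (3 / 2) h) (trigpolyZ (- 2^-1) h3))).
by move=> x; rewrite iterS /sharpen; field.
Qed.

(** A square wave sharpened from a sine that is positive just below the jump at [t], rescaled to
    [0, 1]. With a = pi / (2 M) it approximates the indicator of x <= t as long as |x - t| <= M;
    beyond this window periodicity takes over. *)
Definition softstep (a : R) (N : nat) (t x : R) : R :=
  (1 + iter N (@sharpen R) (sin (a * (t - x)))) / 2.

Definition softorthant (a : R) (N : nat) (t x : I -> R) : R :=
  \prod_i softstep a N (t i) (x i).

Lemma trigpoly_softorthant a N t : trigpoly (softorthant a N t).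
Proof.
rewrite /softorthant; elim: (index_enum I) => [|i s IH].
  by apply: (trigpoly_ext _ (trigpoly_cst 1)) => x; rewrite big_nil.
suff h : trigpoly (fun x => softstep a N (t i) (x i)).
  by apply: (trigpoly_ext _ (trigpolyM h IH)) => x; rewrite big_cons.
pose g (x : I -> R) := sin (a * (t i - x i)).
have tg : trigpoly g.
  apply: (trigpoly_ext _ (trigpoly_cos (fun j => if j == i then - a else 0)
    (a * t i - pi / 2))) => x.
  rewrite (bigD1 i)//= eqxx big1 ?addr0; last first.
    by move=> j /negbTE ->; rewrite mul0r.
  by rewrite addrA cosBpihalf /g; congr sin; ring.
apply: (trigpoly_ext _ (trigpolyD (trigpoly_cst 2^-1)
  (trigpolyZ 2^-1 (trigpoly_sharpen N tg)))) => x.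
by rewrite /softstep /g; field.
Qed.

Lemma softstep_itv a N t x : 0 <= softstep a N t x <= 1.
Proof.
have := iter_sharpen_norm N (sin_max (a * (t - x))).
by rewrite ler_norml /softstep => /andP[h1 h2]; apply/andP; split; lra.
Qed.

Lemma softorthant_itv a N t x : 0 <= softorthant a N t x <= 1.
Proof.
apply/andP; split; first by apply: prodr_ge0 => i _; case/andP: (softstep_itv a N (t i) (x i)).
by apply: prodr_ile1 => i _; exact: softstep_itv.
Qed.

Section window.
Variables (M eps : R) (N : nat).
Hypotheses (eps_gt0 : 0 < eps) (epsM : eps <= M).
Let M0 : 0 < M. Proof. exact: lt_le_trans epsM. Qed.
Let a := pi / (2 * M).
Let a0 : 0 < a. Proof. by rewrite divr_gt0 ?pi_gt0// mulr_gt0. Qed.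
(** sin(a eps) is the least value of the sine at distance between eps and M from the jump; the form
    of the error is that of [iter_sharpen_cvg]. *)
Definition window_err := (1 - sin (pi / (2 * M) * eps) / 2) ^+ N.

Let aM : a * M = pi / 2. Proof. by rewrite /a; field; rewrite gt_eqF. Qed.

(** As a M = pi / 2, the window on either side of the jump is a quarter period, on which the sine is
    increasing. *)
Let sin_window y : eps <= y -> y <= M -> 0 <= sin (a * eps) <= sin (a * y).
Proof.
move=> ey yM; have e0 := ltW eps_gt0.
have ae0 : 0 <= a * eps by rewrite mulr_ge0// ltW.
have aey : a * eps <= a * y by rewrite ler_pM2l.
have ayM : a * y <= pi / 2 by rewrite -aM ler_pM2l.
have pi0 := @pi_gt0 R.
apply/andP; split.
  by apply: sin_ge0_pi; rewrite ae0/= (le_trans aey)// (le_trans ayM)//; lra.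
have i1 : a * eps \in `[- (pi / 2), pi / 2] by rewrite in_itv/=; lra.
have i2 : a * y \in `[- (pi / 2), pi / 2] by rewrite in_itv/=; lra.
by rewrite leNgt ltr_sin// -leNgt.
Qed.

Lemma softstep_left t x : x <= t - eps -> `|x - t| <= M ->
  1 - window_err / 2 <= softstep a N t x.
Proof.
move=> xt; rewrite ler_norml => /andP[h1 h2].
have /andP[d0 dy] : 0 <= sin (a * eps) <= sin (a * (t - x)).
  by apply: sin_window; lra.
have s1 : sin (a * (t - x)) <= 1 by exact: le_trans (ler_norm _) (sin_max _).
have := iter_sharpen_cvg N d0 dy s1; rewrite /softstep /window_err -/a; lra.
Qed.

Lemma softstep_right t x : t + eps <= x -> `|x - t| <= M ->
  softstep a N t x <= window_err / 2.
Proof.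
move=> xt; rewrite ler_norml => /andP[h1 h2].
have /andP[d0 dy] : 0 <= sin (a * eps) <= sin (a * (x - t)).
  by apply: sin_window; lra.
have s1 : sin (a * (x - t)) <= 1 by exact: le_trans (ler_norm _) (sin_max _).
have := iter_sharpen_cvg N d0 dy s1; rewrite /softstep /window_err -/a.
rewrite -[t - x]opprB mulrN sinN iter_sharpenN; lra.
Qed.

Lemma window_err_ge0 : 0 <= window_err.
Proof.
rewrite exprn_ge0// subr_ge0; have := sin_max (pi / (2 * M) * eps).
rewrite ler_norml => /andP[_]; lra.
Qed.

Lemma prod_ge_sub (f : I -> R) (c : R) : (forall i, 0 <= f i <= 1) ->
  (forall i, 1 - c <= f i) -> 1 - c *+ #|I| <= \prod_i f i.
Proof.
move=> f01 fc; rewrite -sum1_card.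
elim: (index_enum I) => [|i s IH]; first by rewrite !big_nil mulr0n subr0.
rewrite !big_cons mulrnDr mulr1n.
have /andP[p0 p1] : 0 <= \prod_(j <- s) f j <= 1.
  apply/andP; split; first by apply: prodr_ge0 => j _; case/andP: (f01 j).
  by apply: prodr_ile1 => j _; exact: f01.
have /andP[i0 i1] := f01 i; have ic := fc i.
set q := \prod_(j <- s) f j in IH p0 p1 *; set r := c *+ _ in IH *.
nra.
Qed.

Lemma softorthant_lower t x : (forall i, x i <= t i - eps) ->
  (forall i, `|x i - t i| <= M) ->
  1 - (window_err *+ #|I|) <= softorthant a N t x.
Proof.
move=> xt xM; apply: prod_ge_sub => i; first exact: softstep_itv.
apply: le_trans (softstep_left (xt i) (xM i)).
have := window_err_ge0; lra.
Qed.

Lemma softorthant_upper t x i : t i + eps <= x i -> `|x i - t i| <= M ->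
  softorthant a N t x <= window_err.
Proof.
move=> xt xM; rewrite /softorthant (bigD1 i)//=.
have /andP[i0 i1] := softstep_itv a N (t i) (x i).
have p1 : \prod_(j | j != i) softstep a N (t j) (x j) <= 1.
  by apply: prodr_ile1 => j _; exact: softstep_itv.
have := softstep_right xt xM; have w0 := window_err_ge0 => h.
apply: le_trans (ler_piMr i0 p1) _; lra.
Qed.

End window.

End trigpoly.

(** * Orthant indicators compared with their soft versions *)

Section orthant.
Variables (R : realType) (I : finType).

Definition orthant (t x : I -> R) : R := \prod_i \1_[set y | y <= t i] (x i).

Lemma orthantE t x : orthant t x = [forall i, x i <= t i]%:R.
Proof.
rewrite /orthant; have [/forallP h|/forallPn[i hi]] := boolP [forall i, x i <= t i].
  apply: big1 => i _; rewrite indicE (_ : (x i \in _) = true)//.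
  exact/mem_set/h.
rewrite (bigD1 i)//= indicE (_ : (x i \in _) = false) ?mul0r//.
by apply: memNset; exact/negP.
Qed.

Lemma orthant_itv t x : 0 <= orthant t x <= 1.
Proof. by rewrite orthantE; case: [forall _, _]; rewrite ?lexx ler01. Qed.

Section comparison.
Variables (M b eps : R) (N : nat).
Hypotheses (eps_gt0 : 0 < eps) (M_gt0 : 0 < M) (b_ge0 : 0 <= b) (epsM : eps <= M).
Let M1 := M + b.
Let so := @softorthant R I (pi / (2 * M1)) N.
Let err := window_err M1 eps N.
(** Chebyshev majorant of the indicator that some coordinate leaves [-M, M]. Outside the window the
    soft orthant carries no information, and this term pays for it. *)
Let bad (x : I -> R) := \sum_i M ^- 2 * x i ^+ 2.

Let epsM1 : eps <= M1. Proof. by rewrite (le_trans epsM)// lerDl. Qed.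

Lemma bad_ge0 x : 0 <= bad x.
Proof.
by apply: sumr_ge0 => i _; rewrite mulr_ge0 ?sqr_ge0// invr_ge0 sqr_ge0.
Qed.

Lemma bad_ge1 x i : M < `|x i| -> 1 <= bad x.
Proof.
move=> xM; rewrite /bad (bigD1 i)//=.
have : 1 <= M ^- 2 * x i ^+ 2.
  rewrite mulrC ler_pdivlMr ?exprn_gt0// mul1r -(real_normK (num_real (x i))).
  by apply: lerXn2r; [rewrite nnegrE ltW|rewrite nnegrE|exact: ltW].
move=> h; apply: (le_trans h); rewrite lerDl.
by apply: sumr_ge0 => j _; rewrite mulr_ge0 ?sqr_ge0// invr_ge0 sqr_ge0.
Qed.

Lemma in_window x t : (forall i, `|t i| <= b) -> bad x < 1 ->
  forall i, `|x i - t i| <= M1.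
Proof.
move=> tb bx i; have [h|h] := leP `|x i| M.
  by apply: (le_trans (ler_normB _ _)); apply: lerD.
by have := bad_ge1 h; rewrite leNgt bx.
Qed.

(** If [bad x] >= 1 the inequality is trivial. Otherwise |x i| <= M for every i, so x lies in the
    window of half-width M + b around t, and the gap eps keeps it away from the jump. *)
Lemma orthant_le_soft t x : (forall i, `|t i| <= b) ->
  orthant (fun i => t i - eps) x <= so t x + err *+ #|I| + bad x.
Proof.
move=> tb; have err0 : 0 <= err by exact: window_err_ge0.
have erI : 0 <= err *+ #|I| by rewrite mulrn_wge0.
have /andP[so0 so1] := softorthant_itv (pi / (2 * M1)) N t x.
have /andP[or0 or1] := orthant_itv (fun i => t i - eps) x.
have b0 := bad_ge0 x.
have [bx|bx] := leP 1 (bad x).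
  by rewrite /so; lra.
move: or1; rewrite orthantE; case: (boolP [forall i, _]) => [/forallP h _|_ _] /=;
  last by rewrite /so; lra.
have := @softorthant_lower _ _ M1 eps N eps_gt0 epsM1 t x h (in_window tb bx).
by rewrite -/so -/err; lra.
Qed.

Lemma soft_le_orthant t x : (forall i, `|t i| <= b) ->
  so t x <= orthant (fun i => t i + eps) x + err + bad x.
Proof.
move=> tb; have err0 : 0 <= err by exact: window_err_ge0.
have /andP[so0 so1] := softorthant_itv (pi / (2 * M1)) N t x.
have /andP[or0 or1] := orthant_itv (fun i => t i + eps) x.
have b0 := bad_ge0 x.
have [bx|bx] := leP 1 (bad x); first by rewrite /so; lra.
rewrite orthantE; case: (boolP [forall i, _]) => [h|/forallPn[i hi]] /=.
  by rewrite /so; lra.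
rewrite -ltNge in hi.
have := @softorthant_upper _ _ M1 eps N eps_gt0 epsM1 t x i (ltW hi) (in_window tb bx i).
by rewrite -/so -/err; lra.
Qed.

End comparison.
End orthant.

(** * A continuity theorem for probabilities of orthants *)

Section levy.
Variables (R : realType) (I : finType).

Section one_space.
Context d (T : measurableType d) (P : probability T R).
Variable Z : I -> T -> R.
Hypothesis mZ : forall i, measurable_fun setT (Z i).

Lemma trigpoly_intble f : trigpoly f -> intble P (fun w => f (fun i => Z i w)).
Proof.
elim=> [theta alpha|g1 g2 _ h1 _ h2|c g _ h].
- apply: (@intble_bounded _ _ _ _ _ 1); last by move=> w; exact: cos_max.
  apply: (measurableT_comp (f := @cos R)).
    by apply: continuous_measurable_fun; exact: continuous_cos.
  apply: measurable_funD => //; apply: measurable_sum => i.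
  exact: measurable_funM.
- exact: intbleD.
- exact: intbleZ.
Qed.

Lemma orthant_meas t : measurable_fun setT (fun w => orthant t (fun i => Z i w)).
Proof.
apply: measurable_prod => i _.
have mi : measurable_fun setT (\1_[set y | y <= t i] : R -> R);
  last exact: (measurableT_comp mi (mZ i)).
apply: measurable_indic; rewrite (_ : [set y | y <= t i] = `]-oo, t i]%classic)//.
Qed.

Lemma orthant_intble t : intble P (fun w => orthant t (fun i => Z i w)).
Proof.
apply: (@intble_bounded _ _ _ _ _ 1); first exact: orthant_meas.
by move=> w; have /andP[a b] := orthant_itv t (fun i => Z i w); rewrite ger0_norm.
Qed.

Lemma orthant_set_measurable t : measurable [set w | forall i, Z i w <= t i].
Proof.
rewrite (_ : [set w | _] = (fun w => orthant t (fun i => Z i w)) @^-1` [set 1]).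
  by rewrite -[_ @^-1` _]setTI; apply: orthant_meas.
apply/seteqP; split => w /=; rewrite orthantE.
  by move=> h; rewrite (introT forallP h).
by case: (boolP [forall i, _]) => [/forallP//|_ /eqP]; rewrite eq_sym oner_eq0.
Qed.

Lemma orthant_expect t : expect P (fun w => orthant t (fun i => Z i w)) =
  fine (P [set w | forall i, Z i w <= t i]).
Proof.
have mA := orthant_set_measurable t.
rewrite (_ : (fun w => _) = \1_[set w | forall i, Z i w <= t i]).
  by rewrite /expect /Rintegral integral_indic// setIT.
apply/funext => w; rewrite orthantE indicE; congr (_%:R); congr nat_of_bool.
apply/idP/idP => [/forallP h|/set_mem h]; last exact/forallP.
exact/mem_set.
Qed.

Section comparison.
Variables (M b eps : R) (N : nat) (K : R).
Hypotheses (eps_gt0 : 0 < eps) (M_gt0 : 0 < M) (b_ge0 : 0 <= b) (epsM : eps <= M).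
Hypothesis Z2 : forall i, intble P (fun w => Z i w ^+ 2) /\
  expect P (fun w => Z i w ^+ 2) <= K.
Let so := @softorthant R I (pi / (2 * (M + b))) N.
Let err := window_err (M + b) eps N.
Let badK := #|I|%:R * (M ^- 2 * K).

Let bad (w : T) := \sum_i M ^- 2 * Z i w ^+ 2.

Let bad_intble : intble P bad.
Proof. by apply: intble_sum => i _; apply: intbleZ; case: (Z2 i). Qed.

Let bad_expect : expect P bad <= badK.
Proof.
rewrite /badK mulr_natl -[leRHS]sumr_const.
rewrite expect_sum; last by move=> i _; apply: intbleZ; case: (Z2 i).
apply: ler_sum => i _; rewrite expectZ; last by case: (Z2 i).
by rewrite ler_wpM2l ?invr_ge0 ?sqr_ge0//; case: (Z2 i).
Qed.

Lemma expect_orthant_le_soft t : (forall i, `|t i| <= b) ->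
  expect P (fun w => orthant (fun i => t i - eps) (fun i => Z i w)) <=
  expect P (fun w => so t (fun i => Z i w)) + err *+ #|I| + badK.
Proof.
move=> tb.
have Is : intble P (fun w => so t (fun i => Z i w)).
  exact/trigpoly_intble/trigpoly_softorthant.
have Ie := intbleD Is (intble_cst P (err *+ #|I|)).
apply: (@le_trans _ _ (expect P (fun w => so t (fun i => Z i w) + err *+ #|I| + bad w))).
  apply: expect_le; [exact: orthant_intble|exact: intbleD|] => w.
  by apply: orthant_le_soft.
by rewrite expectD// expectD//; [rewrite expect_cst lerD2l|exact: intble_cst].
Qed.

Lemma expect_soft_le_orthant t : (forall i, `|t i| <= b) ->
  expect P (fun w => so t (fun i => Z i w)) <=
  expect P (fun w => orthant (fun i => t i + eps) (fun i => Z i w)) + err + badK.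
Proof.
move=> tb.
have Is : intble P (fun w => so t (fun i => Z i w)).
  exact/trigpoly_intble/trigpoly_softorthant.
have Io := orthant_intble (fun i => t i + eps).
have Ie := intbleD Io (intble_cst P err).
apply: (@le_trans _ _ (expect P (fun w =>
    orthant (fun i => t i + eps) (fun i => Z i w) + err + bad w))).
  by apply: expect_le => //; [exact: intbleD|move=> w; exact: soft_le_orthant].
by rewrite expectD// expectD//; [rewrite expect_cst lerD2l|exact: intble_cst].
Qed.

End comparison.

End one_space.

Variables (d : nat -> measure_display) (T : forall n, measurableType (d n)).
Variable (P : forall n, probability (T n) R).
Variable (Z : forall n, I -> T n -> R).
Arguments Z : clear implicits.
Hypothesis mZ : forall n i, measurable_fun setT (Z n i).
Variables (d' : measure_display) (T' : measurableType d') (P' : probability T' R).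
Variable (G : I -> T' -> R).
Hypothesis mG : forall i, measurable_fun setT (G i).
Variable K : R.
Hypothesis Z2 : \forall n \near \oo, forall i,
  intble (P n) (fun w => Z n i w ^+ 2) /\ expect (P n) (fun w => Z n i w ^+ 2) <= K.
Hypothesis G2 : forall i,
  intble P' (fun w => G i w ^+ 2) /\ expect P' (fun w => G i w ^+ 2) <= K.
Hypothesis charfun_cvg : forall (theta : I -> R) (alpha : R),
  expect (P n) (fun w => cos (\sum_i theta i * Z n i w + alpha)) @[n --> \oo] -->
  expect P' (fun w => cos (\sum_i theta i * G i w + alpha)).

Lemma trigpoly_cvg f : trigpoly f ->
  expect (P n) (fun w => f (fun i => Z n i w)) @[n --> \oo] -->
  expect P' (fun w => f (fun i => G i w)).
Proof.
elim=> [theta alpha|g1 g2 t1 h1 t2 h2|c g t h]; first exact: charfun_cvg.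
- rewrite expectD; [|exact: trigpoly_intble|exact: trigpoly_intble].
  rewrite (_ : (fun n => _) = fun n => expect (P n) (fun w => g1 (fun i => Z n i w))
    + expect (P n) (fun w => g2 (fun i => Z n i w))); first exact: cvgD.
  by apply/funext => n; rewrite expectD//; exact: trigpoly_intble.
- rewrite expectZ; last exact: trigpoly_intble.
  rewrite (_ : (fun n => _) = fun n => c * expect (P n) (fun w => g (fun i => Z n i w))).
    by apply: cvgM => //; exact: cvg_cst.
  by apply/funext => n; rewrite expectZ//; exact: trigpoly_intble.
Qed.

(** One sandwich for [Z] at distance eps and one for [G] at a further eps enclose the probabilities
    for [Z] between those of the limit at t - 2 eps and t + 2 eps. Only the diagonal shift of [t]
    occurs, whence the form of the continuity hypothesis. The choices are made in the order eps,
    window, number of iterations. *)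
Lemma levy_orthant (t : I -> R) :
  expect P' (fun w => orthant (fun i => t i + s) (fun i => G i w)) @[s --> 0] -->
  expect P' (fun w => orthant t (fun i => G i w)) ->
  expect (P n) (fun w => orthant t (fun i => Z n i w)) @[n --> \oo] -->
  expect P' (fun w => orthant t (fun i => G i w)).
Proof.
move=> ct; apply/cvgrPdist_le => e e0.
have e8 : 0 < e / 8 by rewrite divr_gt0.
have e16 : 0 < e / 16 by rewrite divr_gt0.
have [r /= r0 hr] : exists2 r : R, 0 < r & forall s, `|s| < r ->
    `|expect P' (fun w => orthant t (fun i => G i w)) -
      expect P' (fun w => orthant (fun i => t i + s) (fun i => G i w))| <= e / 8.
  move/cvgrPdist_le : ct => /(_ _ e8) /nbhs_normP[r /= r0 h].
  by exists r => // s sr; apply: h => /=; rewrite sub0r normrN.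
(* The shift by 2 eps has to stay below r; eps <= 1 keeps t + eps and t - eps within the bound [b],
   and eps below [M]. *)
pose eps := Num.min (r / 3) 1.
have eps0 : 0 < eps by rewrite lt_min ltr01 andbT divr_gt0.
have eps1 : eps <= 1 by rewrite ge_min lexx orbT.
have epsr : eps * 2 < r.
  have : eps <= r / 3 by rewrite ge_min lexx.
  lra.
pose Kp := `|K|; pose c : R := #|I|%:R.
have c0 : 0 <= c by rewrite /c.
have Kp0 : 0 <= Kp by exact: normr_ge0.
(* By Chebyshev the cost of leaving the window is at most c Kp / M^2 <= c Kp / M, which this choice
   makes at most e / 16. *)
pose M : R := 1 + c * Kp / (e / 16).
have M1 : 1 <= M by rewrite lerDl divr_ge0// ?mulr_ge0// ltW.
have M0 : 0 < M by exact: lt_le_trans M1.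
have epsM : eps <= M by exact: le_trans eps1 M1.
have badM : c * (M ^- 2 * Kp) <= e / 16.
  apply: (@le_trans _ _ (c * Kp / M)).
    rewrite [M ^- 2 * _]mulrC mulrA; apply: ler_wpM2l; first exact: mulr_ge0.
    by rewrite lef_pV2 ?posrE ?exprn_gt0// expr2 ler_peMr// ltW.
  by rewrite ler_pdivrMr// [e / 16 * M]mulrC -ler_pdivrMr// /M lerDr.
pose b : R := \sum_i `|t i| + 1.
have b0 : 0 <= b by rewrite addr_ge0// sumr_ge0.
have tb s : `|s| <= 1 -> forall i, `|t i + s| <= b.
  move=> s1 i; apply: (le_trans (ler_normD _ _)); apply: lerD => //.
  by rewrite (bigD1 i)//= lerDl sumr_ge0.
have neps1 : `|eps| <= 1 by rewrite ger0_norm// ltW.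
have neps1' : `|- eps| <= 1 by rewrite normrN.
(* [N] comes last, since the base z of the error depends on eps and on the window; |z| < 1 because
   the sine lies in (0, 1]. *)
have [N hN] : exists N, (1 + c) * window_err (M + b) eps N <= e / 16.
  pose z : R := 1 - sin (pi / (2 * (M + b)) * eps) / 2.
  have Mb : 0 < M + b by rewrite ltr_wpDr.
  have z1 : `|z| < 1.
    have s0 : 0 < sin (pi / (2 * (M + b)) * eps).
      have pi0 := @pi_gt0 R.
      apply: sin_gt0_pi; apply/andP; split.
        by rewrite mulr_gt0// divr_gt0// mulr_gt0.
      rewrite mulrAC ltr_pdivrMr ?mulr_gt0// ltr_pM2l//.
      have : eps <= M + b by rewrite (le_trans epsM)// lerDl.
      lra.
    have s1 : sin (pi / (2 * (M + b)) * eps) <= 1.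
      exact: le_trans (ler_norm _) (sin_max _).
    by rewrite ltr_norml /z; apply/andP; split; lra.
  have c1 : 0 < 1 + c by rewrite ltr_wpDr.
  have ec : 0 < e / 16 / (1 + c) by rewrite divr_gt0.
  have := cvg_expr z1 => /cvgrPdist_le /(_ _ ec)[N _ /(_ N (leqnn N))] /=.
  rewrite sub0r normrN => h; exists N.
  rewrite mulrC -ler_pdivlMr//; apply: le_trans h.
  by rewrite /window_err -/z ler_norm.
have err0 : 0 <= window_err (M + b) eps N by exact: window_err_ge0.
pose so := @softorthant R I (pi / (2 * (M + b))) N.
have cso s : expect (P n) (fun w => so (fun i => t i + s) (fun i => Z n i w))
   @[n --> \oo] --> expect P' (fun w => so (fun i => t i + s) (fun i => G i w)).
  by apply: trigpoly_cvg; exact: trigpoly_softorthant.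
have G2' i : intble P' (fun w => G i w ^+ 2) /\ expect P' (fun w => G i w ^+ 2) <= Kp.
  by have [h1 h2] := G2 i; split => //; exact: le_trans h2 (ler_norm _).
have ind1 (u : I -> R) : (fun i => u i + eps - eps) = u.
  by apply/funext => i; rewrite addrK.
have up' := expect_soft_le_orthant mG N eps0 M0 b0 epsM G2' (tb _ neps1).
have lo' := expect_orthant_le_soft mG N eps0 M0 b0 epsM G2' (tb _ neps1').
have F2 := hr (eps * 2); have F2' := hr (- (eps * 2)).
have /F2 {}F2 : `|eps * 2| < r by rewrite ger0_norm// mulr_ge0// ltW.
have /F2' {}F2' : `|- (eps * 2)| < r by rewrite normrN ger0_norm// mulr_ge0// ltW.
have E1 : (fun i => t i + eps + eps) = (fun i => t i + eps * 2).
  by apply/funext => i; ring.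
have E2 : (fun i => t i + - eps - eps) = (fun i => t i + - (eps * 2)).
  by apply/funext => i; ring.
rewrite E1 in up'; rewrite E2 in lo'.
near=> n.
have Z2' i : intble (P n) (fun w => Z n i w ^+ 2) /\
    expect (P n) (fun w => Z n i w ^+ 2) <= Kp.
  have : forall i, intble (P n) (fun w => Z n i w ^+ 2) /\
    expect (P n) (fun w => Z n i w ^+ 2) <= K by near: n.
  by move=> /(_ i)[h1 h2]; split => //; exact: le_trans h2 (ler_norm _).
have up := expect_orthant_le_soft (@mZ n) N eps0 M0 b0 epsM Z2' (tb _ neps1).
have lo := expect_soft_le_orthant (@mZ n) N eps0 M0 b0 epsM Z2' (tb _ neps1').
rewrite ind1 in up.
have E3 : (fun i => t i + - eps + eps) = t by apply/funext => i; ring.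
rewrite E3 in lo.
have c1 : `|expect P' (fun w => so (fun i => t i + eps) (fun i => G i w)) -
  expect (P n) (fun w => so (fun i => t i + eps) (fun i => Z n i w))| <= e / 8.
  by near: n; move/cvgrPdist_le : (cso eps) => /(_ _ e8).
have c2 : `|expect P' (fun w => so (fun i => t i + - eps) (fun i => G i w)) -
  expect (P n) (fun w => so (fun i => t i + - eps) (fun i => Z n i w))| <= e / 8.
  by near: n; move/cvgrPdist_le : (cso (- eps)) => /(_ _ e8).
have errI : window_err (M + b) eps N *+ #|I| = c * window_err (M + b) eps N.
  by rewrite mulr_natl.
have ce0 : 0 <= c * window_err (M + b) eps N by exact: mulr_ge0.
move: up lo up' lo' F2 F2' c1 c2 badM hN err0 ce0.
rewrite errI -/so -/c mulrDl mul1r !ler_norml.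
move: (c * window_err (M + b) eps N) (window_err (M + b) eps N) (c * (M ^- 2 * Kp)).
move=> ce err bad.
set a1 := expect (P n) _; set a2 := expect (P n) _; set a3 := expect (P n) _.
set a4 := expect P' _; set a5 := expect P' _; set a6 := expect P' _.
set a7 := expect P' _.
move=> h1 h2 h3 h4 /andP[h5 h6] /andP[h7 h8] /andP[h9 h10] /andP[h11 h12] h13 h14 h15 h16.
clearbody a1 a2 a3 a4 a5 a6 a7.
apply/andP; split; lra.
Unshelve. all: by end_near.
Qed.

End levy.

(** * Normal laws *)

Section normal_charfun.
Variable R : realType.
Local Notation mu := (@lebesgue_measure R).
Local Notation phi := (@normal_pdf R 0 1).
Local Notation N01 := (normal_prob 0 1 : probability _ R).

Let phiE x : phi x = normal_peak 1 * expR (- (x ^+ 2 / 2)).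
Proof.
rewrite normal_pdfE ?oner_eq0// /normal_fun subr0 expr1n; congr (_ * expR _).
by rewrite mulNr.
Qed.

Let phi_ge0 x : 0 <= phi x. Proof. exact: normal_pdf_ge0. Qed.

(** The Radon-Nikodym derivative of the law and the density have the same integral over every
    measurable set, hence agree almost everywhere. *)
Lemma ge0_integral_normal (f : R -> R) : measurable_fun setT f -> (forall x, 0 <= f x) ->
  (\int[normal_prob 0 1]_x (f x)%:E = \int[mu]_x (f x * phi x)%:E)%E.
Proof.
move=> mf f0.
have dom := @normal_prob_dominates R 0 1.
rewrite -(Radon_Nikodym_SigmaFinite.change_of_variables dom)//; last exact/measurable_EFinP.
apply: ae_eq_integral => //.
- apply: emeasurable_funM; first exact/measurable_EFinP.
  exact: measurable_int (Radon_Nikodym_SigmaFinite.f_integrable dom).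
- apply/measurable_EFinP; apply: measurable_funM => //.
  exact: measurable_normal_pdf.
under [X in ae_eq _ _ _ X]eq_fun do rewrite EFinM.
apply: ae_eqe_mul2l; apply: integral_ae_eq => //.
- exact: Radon_Nikodym_SigmaFinite.f_integrable.
- by apply/measurable_EFinP; exact: measurable_normal_pdf.
- by move=> A _ mA; rewrite -Radon_Nikodym_SigmaFinite.f_integral.
Qed.

(** The dominating density has variance 2: with y = x^2 / 4, x^2 exp(-x^2 / 2) = 4 y exp(-y)
    exp(-y), and y exp(-y) <= 1. The second moment is thus finite because another normal density is
    integrable. *)
Let phi_sqr_le : exists C : R, forall x,
  `|x ^+ 2 * phi x| <= C * normal_pdf 0 (Num.sqrt 2) x.
Proof.
exists (4 * normal_peak 1 / normal_peak (Num.sqrt 2)) => x.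
have s2 : Num.sqrt 2 != 0 :> R by rewrite gt_eqF// sqrtr_gt0.
rewrite ger0_norm; last by rewrite mulr_ge0// sqr_ge0.
rewrite phiE (normal_pdfE _ s2) /normal_fun subr0.
have -> : - x ^+ 2 / (Num.sqrt 2 ^+ 2 *+ 2) = - (x ^+ 2 / 4).
  by rewrite sqr_sqrtr// -mulr_natr; field.
have -> : - (x ^+ 2 / 2) = - (x ^+ 2 / 4) + - (x ^+ 2 / 4) by field.
rewrite expRD; set y := x ^+ 2 / 4.
have y0 : 0 <= y by rewrite divr_ge0// sqr_ge0.
have -> : 4 * normal_peak 1 / normal_peak (Num.sqrt 2) *
    (normal_peak (Num.sqrt 2) * expR (- y)) = 4 * (normal_peak 1 * expR (- y)) :> R.
  by field; rewrite gt_eqF// normal_peak_gt0.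
have -> : x ^+ 2 = 4 * y by rewrite /y; field.
have h : y * expR (- y) <= 1.
  rewrite expRN ler_pdivrMr ?expR_gt0// mul1r.
  by apply: le_trans (expR_ge1Dx y); rewrite lerDr.
rewrite (_ : 4 * y * _ = 4 * (normal_peak 1 * expR (- y)) * (y * expR (- y))); last ring.
by rewrite ler_piMr// mulr_ge0// mulr_ge0 ?expR_ge0// normal_peak_ge0.
Qed.

Let int_phi : mu.-integrable setT (EFin \o phi).
Proof. exact: integrable_normal_pdf. Qed.

Let m_phi : measurable_fun setT phi. Proof. exact: measurable_normal_pdf. Qed.

Let int_sqr_phi : mu.-integrable setT (EFin \o (fun x => x ^+ 2 * phi x)).
Proof.
have [C hC] := phi_sqr_le.
have iC : mu.-integrable setT (fun x => C%:E * (normal_pdf 0 (Num.sqrt 2) x)%:E)%E.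
  by apply: integrableZl => //; exact: integrable_normal_pdf.
apply: (le_integrable measurableT _ _ iC).
  apply/measurable_EFinP; apply: measurable_funM => //; exact: measurable_funX.
move=> x _ /=; rewrite lee_fin; apply: le_trans (hC x) _.
exact: ler_norm.
Qed.

Lemma normal_sqr_intble : intble N01 (fun x : R => x ^+ 2).
Proof.
apply/integrableP; split.
  by apply/measurable_EFinP; exact: measurable_funX.
under eq_integral => x _ do rewrite /= ger0_norm ?sqr_ge0//.
have mX : measurable_fun setT (fun x : R => x ^+ 2) by exact: measurable_funX.
rewrite (ge0_integral_normal mX (fun x => sqr_ge0 x)).
case/integrableP : int_sqr_phi => _; apply: le_lt_trans.
rewrite le_eqVlt; apply/orP; left; apply/eqP; apply: eq_integral => x _ /=.
by rewrite ger0_norm// mulr_ge0// sqr_ge0.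
Qed.

Variable alpha : R.

Let m_lin (f : R -> R) (theta : R) : continuous f ->
  measurable_fun setT (fun x : R => f (theta * x + alpha)).
Proof.
move=> cf; apply: (measurableT_comp (f := f)); first exact: continuous_measurable_fun.
by apply: measurable_funD => //; exact: measurable_funM.
Qed.

Let int_bounded_phi (f : R -> R) : measurable_fun setT f -> (forall x, `|f x| <= 1) ->
  mu.-integrable setT (EFin \o (fun x => f x * phi x)).
Proof.
move=> mf f1; apply: (le_integrable measurableT _ _ int_phi).
  by apply/measurable_EFinP; exact: measurable_funM.
move=> x _ /=; rewrite lee_fin normrM; apply: ler_piMl => //.
Qed.

Let int_lin_phi (f : R -> R) : measurable_fun setT f -> (forall x, `|f x| <= 1) ->
  mu.-integrable setT (EFin \o (fun x => x * f x * phi x)).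
Proof.
move=> mf f1.
apply: (le_integrable measurableT _ _ (integrableD measurableT int_phi int_sqr_phi)).
  by apply/measurable_EFinP; apply: measurable_funM => //; exact: measurable_funM.
move=> x _ /=; rewrite lee_fin !normrM (ger0_norm (phi_ge0 x)).
rewrite [leRHS]ger0_norm; last by rewrite addr_ge0// mulr_ge0// sqr_ge0.
rewrite -[X in _ <= X + _]mul1r -mulrDl; apply: ler_wpM2r => //.
apply: (@le_trans _ _ `|x|); first exact: ler_piMr.
by rewrite -(real_normK (num_real x)); have := sqr_ge0 (`|x| - 2^-1); nra.
Qed.

Let h (theta : R) : R := \int[mu]_x (cos (theta * x + alpha) * phi x).

Let der_cos (theta x : R) :
  is_derive theta 1 (fun t => cos (t * x + alpha) * phi x)
    (- (x * sin (theta * x + alpha) * phi x)).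
Proof.
have H : is_derive theta 1 (fun t : R => t * x + alpha) x.
  by apply: is_derive_eq; rewrite /GRing.scale /=; ring.
have H2 : is_derive theta 1 (cos \o (fun t : R => t * x + alpha))
    (- sin (theta * x + alpha) * x).
  apply: is_derive_eq; rewrite /GRing.scale /=; ring.
have H3 : is_derive theta 1 ((cos \o (fun t : R => t * x + alpha)) * cst (phi x))
   (- (x * sin (theta * x + alpha) * phi x)).
  by apply: is_derive_eq; rewrite /GRing.scale /=; ring.
exact: H3.
Qed.

(** Differentiation under the integral sign, with domination by |x| phi(x) uniformly in the
    parameter. *)
Let h_derive (theta : R) : is_derive theta 1 h
  (- \int[mu]_x (x * sin (theta * x + alpha) * phi x)).
Proof.
pose f (t x : R) := cos (t * x + alpha) * phi x.
pose Gd (x : R) := `|x * 1 * phi x|.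
have Ia : `]theta - 1, theta + 1[%classic theta by rewrite /= in_itv/=; lra.
have intf t : `]theta - 1, theta + 1[%classic t ->
    mu.-integrable setT (EFin \o f t).
  move=> _; apply: int_bounded_phi; first exact: m_lin (@continuous_cos R).
  by move=> x; exact: cos_max.
have derf t x : `]theta - 1, theta + 1[%classic t -> setT x -> derivable (f ^~ x) t 1.
  by move=> _ _; have [] := der_cos t x.
have d1f t x : partial1of2 f t x = - (x * sin (t * x + alpha) * phi x).
  by have [_ e] := der_cos t x; rewrite partial1of2E -e.
have G0 x : 0 <= Gd x by exact: normr_ge0.
have intG : mu.-integrable setT (EFin \o Gd).
  apply: (@integrable_norm _ _ _ mu setT (fun x => x * 1 * phi x)).
  by apply: (int_lin_phi (f := fun=> 1)) => // x; rewrite normr1.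
have G_ub t x : `]theta - 1, theta + 1[%classic t -> setT x ->
    `|partial1of2 f t x| <= Gd x.
  move=> _ _; rewrite d1f /Gd normrN !normrM normr1; apply: ler_wpM2r => //.
  by apply: ler_wpM2l => //; exact: sin_max.
have E := differentiation_under_integral measurableT Ia intf derf G0 intG G_ub.
have D := derivable_under_integral measurableT Ia intf derf G0 intG G_ub.
apply: DeriveDef => //.
rewrite -derive1E E.
under eq_Rintegral do rewrite d1f -mulN1r.
rewrite RintegralZl ?mulN1r//; apply: int_lin_phi; first exact: m_lin (@continuous_sin R).
by move=> x; exact: sin_max.
Qed.

Let phi_derive (x : R) : is_derive x 1 phi (- (x * phi x)).
Proof.
have e : phi = (fun=> normal_peak 1) * (expR \o (fun y : R => - (2^-1 * y ^+ 2))).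
  by apply/funext => y /=; rewrite phiE; congr (_ * expR (- _)); rewrite mulrC.
have H1 : is_derive x 1 (fun y : R => - (2^-1 * y ^+ 2)) (- x).
  by apply: is_derive_eq; rewrite /GRing.scale /=; field.
rewrite phiE [x ^+ 2 / 2]mulrC e; apply: is_derive_eq.
by rewrite /GRing.scale /=; ring.
Qed.

Let continuous_phi : continuous phi.
Proof. by apply: continuous_normal_pdf; rewrite oner_eq0. Qed.

(* Integration by parts, turning h' into - theta * h (theta). *)
Let stein (theta : R) :
  \int[mu]_x (x * sin (theta * x + alpha) * phi x) = theta * h theta.
Proof.
(* The integrand of the difference of the two sides is the derivative of [g]; it is integrated over
   growing symmetric intervals, and the boundary terms tend to 0. *)
pose g (x : R) := sin (theta * x + alpha) * phi x.
pose g' (x : R) := theta * (cos (theta * x + alpha) * phi x) -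
  x * sin (theta * x + alpha) * phi x.
have i1 : mu.-integrable setT (EFin \o (fun x => cos (theta * x + alpha) * phi x)).
  apply: int_bounded_phi; first exact: m_lin (@continuous_cos R).
  by move=> x; exact: cos_max.
have i2 : mu.-integrable setT
    (EFin \o (fun x => x * sin (theta * x + alpha) * phi x)).
  apply: int_lin_phi; first exact: m_lin (@continuous_sin R).
  by move=> x; exact: sin_max.
have i1' : mu.-integrable setT
    (EFin \o (fun x => theta * (cos (theta * x + alpha) * phi x))).
  exact: (eq_integrable measurableT _ _ _ (integrableZl measurableT theta i1)).
have ig' : mu.-integrable setT (EFin \o g').
  exact: (eq_integrable measurableT _ _ _ (integrableB measurableT i1' i2)).
suff : \int[mu]_x g' x = 0.
  rewrite /g' RintegralB// RintegralZl//.
  by move=> /eqP; rewrite subr_eq0 => /eqP <-.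
have dg (x : R) : is_derive x 1 g (g' x).
  have Hp := phi_derive x.
  have H1 : is_derive x 1 (fun y : R => theta * y + alpha) theta.
    by apply: is_derive_eq; rewrite /GRing.scale /=; ring.
  have H2 : is_derive x 1 ((sin \o (fun y : R => theta * y + alpha)) * phi) (g' x).
    by apply: is_derive_eq; rewrite /GRing.scale /= /g'; ring.
  exact: H2.
have cg : continuous g.
  by move=> x; apply: differentiable_continuous; apply/derivable1_diffP; have [] := dg x.
have cg' : continuous g'.
  have clin (f : R -> R) : continuous f -> continuous (fun x => f (theta * x + alpha)).
    move=> cf x; apply: (@continuous_comp _ _ _ (fun x => theta * x + alpha) f);
      last exact: cf.
    apply: cvgD; last exact: cvg_cst.
    by apply: cvgM; [exact: cvg_cst|exact: cvg_id].
  have k0 : continuous (fun x : R => cos (theta * x + alpha) * phi x).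
    by move=> y; exact: (continuousM (clin _ (@continuous_cos R) y) (@continuous_phi y)).
  have k1 : continuous (fun x : R => theta * (cos (theta * x + alpha) * phi x)).
    by move=> y; exact: (continuousM (@cst_continuous _ _ theta y) (k0 y)).
  have k3 : continuous (fun x : R => x * sin (theta * x + alpha)).
    have cid' : continuous (fun x : R => x) by move=> y; exact: cvg_id.
    by move=> y; exact: (continuousM (cid' y) (clin _ (@continuous_sin R) y)).
  have k2 : continuous (fun x : R => x * sin (theta * x + alpha) * phi x).
    by move=> y; exact: (continuousM (k3 y) (@continuous_phi y)).
  by move=> y; exact: (continuousB (k1 y) (k2 y)).
pose A (N : nat) : set R := `[- N.+1%:R, N.+1%:R]%classic.
have ftc N : (\int[mu]_(x in A N) (g' x)%:E = (g N.+1%:R)%:E - (g (- N.+1%:R))%:E)%E.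
  apply: continuous_FTC2.
  - by rewrite gtrN.
  - exact: continuous_subspaceT.
  - split; first by move=> x _; have [] := dg x.
    + by apply: cvg_at_right_filter; exact: cg.
    + by apply: cvg_at_left_filter; exact: cg.
  - by move=> x _; have [_ e] := dg x; rewrite derive1E -e.
pose f_ (N : nat) (x : R) : \bar R := ((EFin \o g') \_ (A N)) x.
have mA N : measurable (A N) by exact: measurable_itv.
have mg' : measurable_fun setT g' by exact: continuous_measurable_fun.
have [] := @dominated_convergence _ _ _ mu setT measurableT f_ (EFin \o g')
   (abse \o (EFin \o g')).
- move=> N; apply/(measurable_restrictT _ (mA N)).
  by apply: measurable_funTS; exact/measurable_EFinP.
- exact/measurable_EFinP.
- apply: aeW => x _; apply: cvg_near_cst.
  exists (Num.truncn `|x|) => // N /= hN.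
  rewrite /f_ patchE mem_set//= /A /= in_itv/= -ler_norml.
  apply: ltW; apply: (lt_le_trans (truncnS_gt _)).
  by rewrite ler_nat.
- exact: integrable_abse.
- apply: aeW => x N _; rewrite /f_ patchE; case: ifP => _ //=.
  by rewrite lee_fin normr0.
move=> _ _ lim; rewrite /Rintegral.
suff -> : (\int[mu]_x (g' x)%:E = 0)%E by [].
apply: (cvg_unique _ lim) => //.
rewrite (_ : [sequence _]_n = fun N => (g N.+1%:R - g (- N.+1%:R))%:E); last first.
  by apply/funext => N; rewrite EFinB -ftc /f_ [RHS]integral_mkcond.
apply: cvg_EFin; first exact: nearW.
apply/cvgr0Pnorm_le => e e0 /=.
pose c : R := 2 * normal_peak 1 * 2.
have c0 : 0 < c by rewrite /c mulr_gt0// mulr_gt0// normal_peak_gt0// oner_eq0.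
have ec : 0 < e / c by rewrite divr_gt0.
near=> N.
(* exp(y) >= 1 + y gives a decay in 1 / x^2, more than enough to compare the boundary terms with the
   harmonic sequence. *)
have gb x : `|g x| <= normal_peak 1 * (x ^+ 2 / 2 + 1)^-1.
  rewrite /g normrM (ger0_norm (phi_ge0 x)); apply: (@le_trans _ _ (phi x)).
    by rewrite ler_piMl// sin_max.
  rewrite phiE; apply: ler_wpM2l; first exact: normal_peak_ge0.
  rewrite expRN lef_pV2 ?posrE ?expR_gt0 ?ltr_wpDl ?divr_ge0 ?sqr_ge0//.
  by rewrite addrC; exact: expR_ge1Dx.
apply: (le_trans (ler_normB _ _)).
have gN1 := gb N.+1%:R; have gN2 := gb (- N.+1%:R); rewrite sqrrN in gN2.
apply: (le_trans (lerD gN1 gN2)).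
apply: (@le_trans _ _ (c * harmonic N)).
  rewrite -mulrDr; set k := normal_peak 1; pose y : R := N.+1%:R.
  have y1 : 1 <= y by rewrite /y ler1n.
  have k0 : 0 <= k by exact: normal_peak_ge0.
  have -> : c * harmonic N = k * (2 * (2 * y^-1)) by rewrite /c /harmonic /k /y /=; ring.
  rewrite -/y.
  apply: ler_wpM2l => //.
  have hh : (y ^+ 2 / 2 + 1)^-1 <= 2 * y^-1.
    rewrite -[2 * y^-1]invrK lef_pV2 ?posrE; last 2 first.
    - by rewrite ltr_wpDl// divr_ge0// sqr_ge0.
    - by rewrite invr_gt0 mulr_gt0// invr_gt0; lra.
    rewrite invfM invrK.
    have := sqr_ge0 y; nra.
  move: hh; rewrite [2 * (2 * _)]mulr_natl mulr2n => hh.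
  exact: lerD.
rewrite mulrC -ler_pdivlMr//; near: N.
have := @cvg_harmonic R => /cvgr0Pnorm_le /(_ _ ec).
apply: filterS => N; apply: le_trans; exact: ler_norm.
Unshelve. all: by end_near.
Qed.

(** By [stein] the function h(t) exp(t^2 / 2) has zero derivative, and h(0) = cos alpha. *)
Lemma normal_charfun (theta : R) :
  expect N01 (fun x : R => cos (theta * x + alpha)) =
  expR (- (theta ^+ 2 / 2)) * cos alpha.
Proof.
have i1 t : mu.-integrable setT (EFin \o (fun x => cos (t * x + alpha) * phi x)).
  apply: int_bounded_phi; first exact: m_lin (@continuous_cos R).
  by move=> x; exact: cos_max.
have int1 : \int[mu]_x phi x = 1 by rewrite /Rintegral integral_normal_pdf.
have -> : expect N01
    (fun x : R => cos (theta * x + alpha)) = h theta.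
  have mc : measurable_fun setT (fun x : R => cos (theta * x + alpha)).
    exact: m_lin (@continuous_cos R).
  have Ic : intble N01
      (fun x : R => cos (theta * x + alpha)).
    exact: (@intble_bounded _ _ R N01 _ 1 mc
      (fun x => cos_max _)).
  have I1 := intble_cst N01 (1 : R).
  (* Adding 1 makes the integrand nonnegative, as [ge0_integral_normal] requires. *)
  apply: (addrI 1); rewrite -{1}(expect_cst N01 1).
  have m1 : measurable_fun setT (fun x : R => 1 + cos (theta * x + alpha)).
    exact: measurable_funD.
  have p1 x : 0 <= 1 + cos (theta * x + alpha).
    by have := cos_geN1 (theta * x + alpha); lra.
  rewrite -(expectD I1 Ic) /expect {1}/Rintegral (ge0_integral_normal m1 p1).
  have -> : 1 + h theta = \int[mu]_x (phi x + cos (theta * x + alpha) * phi x).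
    by rewrite RintegralD// int1.
  rewrite /Rintegral; congr fine; apply: eq_integral => x _; congr EFin; ring.
pose F (t : R) := h t * expR (2^-1 * t ^+ 2).
have dF (t : R) : is_derive t 1 F 0.
  have Hh := h_derive t.
  have H1 : is_derive t 1 (fun y : R => 2^-1 * y ^+ 2) t.
    by apply: is_derive_eq; rewrite /GRing.scale /=; field.
  have H2 : is_derive t 1 (h * (expR \o (fun y : R => 2^-1 * y ^+ 2))) 0.
    by apply: is_derive_eq; rewrite stein /GRing.scale /=; ring.
  exact: H2.
have : F theta = F 0 by exact: is_derive_0_is_cst.
rewrite /F expr0n/= mulr0 expR0 mulr1.
have -> : h 0 = cos alpha.
  rewrite /h; under eq_Rintegral do rewrite mul0r add0r.
  by rewrite RintegralZl// int1 mulr1.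
move=> <-; rewrite mulrC -mulrA -expRD.
rewrite [2^-1 * _]mulrC addrC addNr expR0 mulr1//.
Qed.

End normal_charfun.

(** * Vectors of independent standard normals *)

Section independent_normals.
Variable R : realType.
Let N01 : probability (measurableTypeR R) R := normal_prob 0 1.

(** Induction by product with one more normal line. The phase in the cosine formula is what makes
    the induction work: Fubini freezes the earlier coordinates, and their combination enters
    [normal_charfun] as part of the phase. *)
Lemma exists_normal_vector (n : nat) :
  exists (d : measure_display) (T : measurableType d) (P : probability T R)
    (G : 'I_n -> {RV P >-> R}),
  (forall A : 'I_n -> set R, (forall i, measurable (A i)) ->
    P [set w | forall i, A i (G i w)] = (\prod_i N01 (A i))%E) /\
  (forall (theta : 'I_n -> R) (alpha : R),
    expect P (fun w => cos (\sum_i theta i * G i w + alpha)) =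
    expR (- (\sum_i theta i ^+ 2 / 2)) * cos alpha).
Proof.
elim: n => [|n [d [T [P [G [indepG cosG]]]]]].
  have mid : measurable_fun setT (id : measurableTypeR R -> R) by exact: measurable_id.
  pose X : {RV N01 >-> R} := HB.pack (id : measurableTypeR R -> R)
    (isMeasurableFun.Build _ _ _ _ _ mid).
  (* The family over ['I_0] is empty; [X] is a mere filler value. *)
  exists _, _, N01, (fun=> X); split => [A mA|theta alpha].
    rewrite big_ord0 (_ : [set w | _] = setT) ?probability_setT//.
    by apply/seteqP; split => w //= _ [].
  rewrite big_ord0 oppr0 expR0 mul1r.
  under [X in expect _ X]eq_fun do rewrite big_ord0 add0r.
  exact: expect_cst.
pose Q : probability (T * measurableTypeR R)%type R := (P \x N01)%E.
have mfst : measurable_fun setT (fst : (T * measurableTypeR R)%type -> T) by exact: measurable_fst.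
have msnd : measurable_fun setT (snd : (T * measurableTypeR R)%type -> R) by exact: measurable_snd.
pose g (i : 'I_n.+1) (z : T * measurableTypeR R) : R :=
  if unlift ord0 i is Some j then G j z.1 else z.2.
have mg i : measurable_fun setT (g i).
  rewrite /g; case: (unlift ord0 i) => [j|//].
  exact: (measurableT_comp (measurable_funP (G j)) mfst).
pose G' (i : 'I_n.+1) : {RV Q >-> R} :=
  HB.pack (g i) (isMeasurableFun.Build _ _ _ _ _ (mg i)).
exists _, _, Q, G'; split => [A mA|theta alpha].
  have -> : [set w | forall i, A i (G' i w)] =
      [set w | forall i, A (lift ord0 i) (G i w)] `*` A ord0.
    apply/seteqP; split => [[w x]|[w x] [h1 h2] i] /=.
      move=> h; split => /=.
        by move=> i; have := h (lift ord0 i); rewrite /= /g liftK.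
      by have := h ord0; rewrite /= /g unlift_none.
    rewrite /= /g; case: unliftP => [j ->|->]; [exact: h1|exact: h2].
  have mB : measurable [set w | forall i, A (lift ord0 i) (G i w)].
    rewrite (_ : [set w | _] =
       \bigcap_(i in [set: 'I_n]) (G i @^-1` A (lift ord0 i))); last first.
      by apply/seteqP; split => w /= h i; [move=> _|]; exact: h.
    apply: fin_bigcap_measurable => // i _.
    by rewrite -[_ @^-1` _]setTI; exact: measurable_funP.
  rewrite /Q /= product_measure1E//; last exact: mA.
  rewrite big_ord_recl muleC; congr (_ * _)%E.
  by apply: (indepG (fun i => A (lift ord0 i))) => i; exact: mA.
pose S (w : T) := \sum_i theta (lift ord0 i) * G i w.
have mS : measurable_fun setT S.
  by apply: measurable_sum => i; exact: measurable_funM.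
pose f (z : T * measurableTypeR R) : R := cos (S z.1 + theta ord0 * z.2 + alpha).
have -> : (fun w => cos (\sum_i theta i * G' i w + alpha)) = f.
  apply/funext => z; rewrite big_ord_recl /f; congr (cos (_ + _)).
  rewrite addrC /=; congr (_ + _).
    by apply: eq_bigr => i _; rewrite /= /g liftK.
  by rewrite /= /g unlift_none.
have mf : measurable_fun setT f.
  apply: (measurableT_comp (f := @cos R)).
    by apply: continuous_measurable_fun; exact: continuous_cos.
  apply: measurable_funD => //; apply: measurable_funD.
    exact: (measurableT_comp mS mfst).
  exact: measurable_funM.
have If : intble Q f by apply: (@intble_bounded _ _ _ Q _ 1 mf) => z; exact: cos_max.
rewrite big_ord_recl opprD expRD -mulrA -cosG.
rewrite /expect /Rintegral -(integral12_prod_meas1 If) /fubini_F.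
have inner w : (\int[N01]_y (f (w, y))%:E)%E =
    (expR (- (theta ord0 ^+ 2 / 2)) * cos (S w + alpha))%:E.
  rewrite -normal_charfun /expect /Rintegral fineK; last first.
    apply: integrable_fin_num => //.
    apply: (@intble_bounded _ _ _ N01 _ 1) => [|y]; last exact: cos_max.
    apply: (measurableT_comp (f := @cos R)).
      by apply: continuous_measurable_fun; exact: continuous_cos.
    by apply: measurable_funD => //; exact: measurable_funM.
  by apply: eq_integral => y _; rewrite /f /= -addrA addrCA.
rewrite [in LHS](eq_integral (fun w => (expR (- (theta ord0 ^+ 2 / 2)))%:E *
    (cos (S w + alpha))%:E)%E); last by move=> w _; rewrite -EFinM; exact: inner.
rewrite integralZl//; last first.
  apply: (@intble_bounded _ _ _ P _ 1) => [|y]; last exact: cos_max.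
  apply: (measurableT_comp (f := @cos R)).
    by apply: continuous_measurable_fun; exact: continuous_cos.
  exact: measurable_funD.
rewrite fineM//.
apply: integrable_fin_num => //.
apply: (@intble_bounded _ _ _ P _ 1) => [|y]; last exact: cos_max.
apply: (measurableT_comp (f := @cos R)).
  by apply: continuous_measurable_fun; exact: continuous_cos.
exact: measurable_funD.
Qed.

(** Transport along [enum_rank]. Marginals and subfamilies are read off the joint law by filling the
    other coordinates with the whole line. *)
Lemma exists_independent_normals (I : finType) :
  exists (d : measure_display) (T : measurableType d) (P : probability T R)
    (G : I -> {RV P >-> R}),
  [/\ mutually_independent P (fun i => G i : T -> R),
    forall i (A : set R), measurable A -> distribution P (G i) A = normal_prob 0 1 A &
    forall (theta : I -> R) (alpha : R),
    expect P (fun w => cos (\sum_i theta i * G i w + alpha)) =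
    expR (- (\sum_i theta i ^+ 2 / 2)) * cos alpha].
Proof.
have [d [T [P [G [indepG cosG]]]]] := exists_normal_vector #|I|.
have joint (A : I -> set R) : (forall i, measurable (A i)) ->
    P [set w | forall i, A i (G (enum_rank i) w)] = (\prod_i N01 (A i))%E.
  move=> mA.
  have := indepG (fun j => A (enum_val j)) (fun j => mA _).
  rewrite (_ : [set w | _] = [set w | forall i, A i (G (enum_rank i) w)]).
    move=> ->; rewrite [RHS](reindex (enum_val : 'I_#|I| -> I))//.
    by exists enum_rank => j _; rewrite ?enum_valK ?enum_rankK.
  apply/seteqP; split => w /= h i; first by have := h (enum_rank i); rewrite enum_rankK.
  by have := h (enum_val i); rewrite enum_valK.
have marg i (A : set R) : measurable A -> P (G (enum_rank i) @^-1` A) = N01 A.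
  move=> mA; have := joint (fun j => if j == i then A else setT).
  rewrite (bigD1 i)//= eqxx big1 ?mule1; last first.
    by move=> j /negbTE ->; rewrite probability_setT.
  rewrite (_ : [set w | _] = G (enum_rank i) @^-1` A).
    by apply => j; case: ifP.
  apply/seteqP; split => w /= h; first by have := h i; rewrite eqxx.
  by move=> j; case: ifP => // /eqP ->.
exists d, T, P, (fun i => G (enum_rank i)); split.
- move=> J A mA.
  have := joint (fun i => if i \in J then A i else setT).
  rewrite (_ : [set w | _] = [set w | forall i, i \in J -> A i (G (enum_rank i) w)]).
    move=> ->; last by move=> i; case: ifP.
    rewrite [RHS]big_mkcond/=; apply: eq_bigr => i _.
    by case: ifP => _; rewrite ?probability_setT// marg.
  apply/seteqP; split => w /= h i; first by move=> iJ; have := h i; rewrite iJ.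
  by case: ifP => // iJ; exact: h.
- by move=> i A mA; exact: marg.
- move=> theta alpha.
  have := cosG (fun j => theta (enum_val j)) alpha.
  have E (F : I -> R) : \sum_j F (enum_val (j : 'I_#|I|)) = \sum_i F i.
    rewrite [RHS](reindex (enum_val : 'I_#|I| -> I))//.
    by exists enum_rank => j _; rewrite ?enum_valK ?enum_rankK.
  rewrite (E (fun i => theta i ^+ 2 / 2)) => <-.
  apply: expect_ext => w; congr (cos (_ + _)); rewrite -E.
  by apply: eq_bigr => j _; rewrite enum_valK.
Qed.

End independent_normals.

(** * Injections, decay and cumulants *)

Section elementary_symmetric.
Variable R : comNzRingType.

(** The generating polynomial: multiplying by one more factor 1 + x X reproduces the defining
    recursion on coefficients. *)
Lemma elemsym_coef (x : nat -> R) m n :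
  elemsym x m n = (\prod_(i < n) (1 + x i *: 'X))`_m.
Proof.
elim: n m => [|n IH] m; first by case: m => [|m]; rewrite big_ord0 coef1.
rewrite big_ord_recr/= mulrDr mulr1 coefD -scalerAr coefZ coefMX.
by case: m => [|m]; rewrite /= -!IH ?elemsym0 ?mulr0 ?addr0.
Qed.

Lemma elemsym_sum_sets (x : nat -> R) m n :
  elemsym x m n = \sum_(A : {set 'I_n} | #|A| == m) \prod_(i in A) x i.
Proof.
rewrite elemsym_coef.
under eq_bigr do rewrite addrC.
rewrite bigA_distr/=.
rewrite coef_sum [RHS]big_mkcond/=; apply: eq_bigr => A _.
have -> : \prod_(i < n) (if i \in A then x i *: 'X else 1) =
    (\prod_(i in A) x i) *: 'X^(#|A|) :> {poly R}.
  rewrite -big_mkcond/= -mul_polyC rmorph_prod/= -prodr_const -big_split/=.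
  by apply: eq_bigr => i _; rewrite mul_polyC.
rewrite coefZ coefXn eq_sym.
by case: eqP => _; rewrite ?mulr1 ?mulr0.
Qed.

(** Grouping by image: each set of [q] indices is the image of exactly q! injections, all with the
    same product. *)
Lemma sum_injections (x : nat -> R) q n :
  \sum_(f : {ffun 'I_q -> 'I_n} | injectiveb f) \prod_(c < q) x (f c) =
  (q`!)%:R * elemsym x q n.
Proof.
rewrite elemsym_sum_sets mulr_sumr.
pose im (f : {ffun 'I_q -> 'I_n}) := [set f c | c : 'I_q].
rewrite (partition_big im (fun A : {set 'I_n} => #|A| == q)); last first.
  by move=> f /injectiveP fi; rewrite card_imset// card_ord.
apply: eq_bigr => A /eqP Aq.
transitivity (\sum_(f : {ffun 'I_q -> 'I_n} | injectiveb f && (im f == A))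
    \prod_(i in A) x i).
  apply: eq_bigr => f /andP[/injectiveP fi /eqP <-].
  by rewrite big_imset//=; move=> c c' _ _; exact: fi.
rewrite sumr_const mulr_natl; congr (_ *+ _).
have := card_inj_ffuns_on 'I_q (mem A).
rewrite card_ord Aq ffactnn => <-.
apply: eq_card => f; rewrite [LHS]unfold_in [RHS]inE.
apply/idP/idP => [/andP[fi /eqP fA]|/andP[/ffun_onP fA fi]]; apply/andP; split=> //.
  by apply/ffun_onP => c; rewrite -fA; exact: imset_f.
rewrite eqEcard Aq card_imset ?card_ord ?leqnn ?andbT; last exact/injectiveP.
by apply/fintype.subsetP => i /imsetP[c _ ->]; exact: fA.
Qed.

End elementary_symmetric.

(** * Sums over indices with decay in the distance *)

Section counting.
Variables (R : realType) (L : nat).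
Implicit Types i j : 'I_L.

Definition dist i j : nat := `|(i : nat)%:Z - (j : nat)%:Z|%N.
(** The exponent kappa is lowered to 2: the sum over k is then dominated by a telescoping one, and
    the squared size of a ball times the decay at its radius stays bounded, as the quadruple sums
    require. *)
Definition decay (k : nat) : R := (maxn 1 k)%:R ^- 2.

Lemma decay_ge0 k : 0 <= decay k.
Proof. by rewrite invr_ge0 exprn_ge0. Qed.

Lemma decay_le1 k : decay k <= 1.
Proof.
by rewrite invf_le1 ?exprn_gt0 ?ltr0n ?leq_max// exprn_ege1// ler1n leq_max.
Qed.

Lemma decay_anti (j k : nat) : (j <= k)%N -> decay k <= decay j.
Proof.
move=> jk; rewrite /decay lef_pV2 ?posrE ?exprn_gt0 ?ltr0n ?leq_max//.
apply: lerXn2r; rewrite ?nnegrE// ler_nat geq_max leq_maxl/=.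
by rewrite (leq_trans jk)// leq_maxr.
Qed.

(** From k = 2 on, 1 / k^2 <= 1 / (k - 1) - 1 / k telescopes to at most 1; the terms k = 0 and k = 1
    are 1 each. *)
Lemma sum_decay n : \sum_(k < n) decay k <= 3.
Proof.
suff H m : \sum_(k < m.+2) decay k <= 3 - m.+1%:R^-1.
  case: n => [|[|m]]; first by rewrite big_ord0.
    by rewrite big_ord_recl big_ord0 addr0; have := decay_le1 0; lra.
  by apply: le_trans (H m) _; rewrite lerBlDr lerDl invr_ge0.
elim: m => [|m IH].
  rewrite !big_ord_recr big_ord0/= add0r invr1.
  by have := decay_le1 0; have := decay_le1 1; lra.
rewrite big_ord_recr/=; apply: le_trans (lerD IH (lexx _)) _.
rewrite /decay (maxn_idPr _)//.
set a : R := m.+1%:R; have a1 : 1 <= a by rewrite ler1n.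
have -> : m.+2%:R = a + 1 by rewrite /a natr1.
rewrite -subr_ge0.
have -> : 3 - (a + 1)^-1 - (3 - a^-1 + (a + 1) ^- 2) = (a * (a + 1) ^+ 2)^-1.
  by field; rewrite !gt_eqF//; lra.
by rewrite invr_ge0 mulr_ge0 ?sqr_ge0//; lra.
Qed.

(** A point at distance [k] is determined by the side of [i] on which it lies. *)
Lemma card_sphere i k : (#|[pred j | dist i j == k]| <= 2)%N.
Proof.
rewrite -(@card_in_imset _ _ (fun j : 'I_L => (i <= j)%N)).
  by rewrite -card_bool max_card.
move=> j j'; rewrite !inE /dist => /eqP + /eqP + H; move: H.
by move=> H h1 h2; apply/val_inj => /=; lia.
Qed.

Lemma sum_sphere i (f : nat -> R) n : (forall k, 0 <= f k) ->
  \sum_(j | (dist i j < n)%N) f (dist i j) <= 2 * \sum_(k < n) f k.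
Proof.
move=> f0.
rewrite (eq_bigr (fun j => \sum_(k < n) if dist i j == k then f k else 0)); last first.
  by move=> j jn; rewrite -big_mkcond/= (big_pred1 (Ordinal jn)).
rewrite exchange_big/= mulr_sumr; apply: ler_sum => k _.
apply: (@le_trans _ _ (\sum_(j : 'I_L) if dist i j == k then f k else 0)).
  rewrite [leLHS]big_mkcond/=; apply: ler_sum => j _.
  by case: ifP => // _; case: ifP.
rewrite -big_mkcond/= sumr_const -[_ *+ _]mulr_natl; apply: ler_wpM2r => //.
rewrite ler_nat; apply: leq_trans (card_sphere i k).
by apply/eq_leq/eq_card => j; rewrite !inE.
Qed.

Lemma dist_ltL i j : (dist i j < L)%N.
Proof. by rewrite /dist; have := ltn_ord i; have := ltn_ord j; lia. Qed.

Lemma sum_decay_row i : \sum_j decay (dist i j) <= 6.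
Proof.
rewrite (eq_bigl (fun j => dist i j < L)%N); last by move=> j; rewrite dist_ltL.
apply: le_trans (sum_sphere i L decay_ge0) _.
by have := sum_decay L; lra.
Qed.

Lemma card_ball i a : (#|[pred j | (dist i j <= a)%N]|%:R : R) <= 2 * a.+1%:R.
Proof.
have := @sum_sphere i (fun=> 1) a.+1 (fun=> ler01).
by rewrite !sumr_const !card_ord -cardsE.
Qed.

(** Because a + 1 <= 2 max(1, a). *)
Lemma ball_decay a : (2 * a.+1%:R) ^+ 2 * decay a <= 16 :> R.
Proof.
rewrite /decay ler_pdivrMr ?exprn_gt0 ?ltr0n ?leq_max//.
have -> : 16 * (maxn 1 a)%:R ^+ 2 = (4 * (maxn 1 a)%:R) ^+ 2 :> R by ring.
apply: lerXn2r; rewrite ?nnegrE ?mulr_ge0//.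
by rewrite -!natrM ler_nat; lia.
Qed.

(* At a base point [i], the largest of the three distances being [a], the other
   two indices lie in the ball of radius [a], with at most 2 (a + 1) points. *)
Lemma sum_decay_quad :
  \sum_(p : 'I_L * 'I_L) \sum_(q : 'I_L * 'I_L)
    decay (maxn (dist p.1 p.2) (maxn (dist p.1 q.1) (dist p.1 q.2))) <=
  48 * L%:R ^+ 2.
Proof.
pose D (i j1 j2 j3 : 'I_L) : R :=
  decay (dist i j1) * ((dist i j2 <= dist i j1)%N%:R * (dist i j3 <= dist i j1)%N%:R).
have D0 i j1 j2 j3 : 0 <= D i j1 j2 j3 by rewrite mulr_ge0 ?decay_ge0// mulr_ge0.
have HD i : \sum_j1 \sum_j2 \sum_j3 D i j1 j2 j3 <= 16 * L%:R.
  rewrite mulr_natr -[X in _ *+ X]card_ord -sumr_const; apply: ler_sum => j _.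
  apply: le_trans (ball_decay (dist i j)).
  have c (a : nat) : \sum_j2 (dist i j2 <= a)%N%:R = #|[pred j2 | (dist i j2 <= a)%N]|%:R :> R.
    rewrite -sum1_card natr_sum [RHS]big_mkcond/=; apply: eq_bigr => j2 _.
    by rewrite inE; case: leqP.
  rewrite /D; under eq_bigr do under eq_bigr do rewrite mulrA.
  under eq_bigr do rewrite -mulr_sumr c.
  rewrite -mulr_suml -mulr_sumr c -mulrA mulrC -expr2.
  apply: ler_wpM2r; first exact: decay_ge0.
  by apply: lerXn2r; rewrite ?nnegrE ?mulr_ge0//; exact: card_ball.
have key (p q : 'I_L * 'I_L) :
    decay (maxn (dist p.1 p.2) (maxn (dist p.1 q.1) (dist p.1 q.2))) <=
    D p.1 p.2 q.1 q.2 + D p.1 q.1 p.2 q.2 + D p.1 q.2 p.2 q.1.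
  rewrite /D; set a := dist p.1 p.2; set b := dist p.1 q.1; set c := dist p.1 q.2.
  have H u v t : decay u * ((v <= u)%N%:R * (t <= u)%N%:R) >= 0.
    by rewrite mulr_ge0 ?decay_ge0// mulr_ge0.
  have := H a b c; have := H b a c; have := H c a b.
  have [/andP[ba ca]|nab] := boolP ((b <= a) && (c <= a))%N.
    rewrite (maxn_idPl _) ?geq_max ?ba// ca !mulr1; lra.
  have [/andP[ab cb]|nbc] := boolP ((a <= b) && (c <= b))%N.
    by rewrite (maxn_idPl cb) (maxn_idPr ab) ab cb !mulr1; lra.
  have -> : (a <= c)%N by lia.
  have bc : (b <= c)%N by lia.
  have -> : maxn a (maxn b c) = c by lia.
  by rewrite bc !mulr1; lra.
have S1 : \sum_(p : 'I_L * 'I_L) \sum_(q : 'I_L * 'I_L) D p.1 p.2 q.1 q.2 <= 16 * L%:R ^+ 2.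
  rewrite -(pair_bigA _ (fun i j1 => \sum_q D i j1 q.1 q.2))/=.
  apply: le_trans (_ : \sum_(i < L) 16 * L%:R <= _); last first.
    by rewrite sumr_const card_ord -[_ *+ L]mulr_natr -mulrA -expr2.
  apply: ler_sum => i _; apply: le_trans (HD i); apply: ler_sum => j _.
  by rewrite -(pair_bigA _ (fun j2 j3 => D i j j2 j3)).
have S2 : \sum_(p : 'I_L * 'I_L) \sum_(q : 'I_L * 'I_L) D p.1 q.1 p.2 q.2 <= 16 * L%:R ^+ 2.
  rewrite -(pair_bigA _ (fun i j1 => \sum_q D i q.1 j1 q.2))/=.
  apply: le_trans (_ : \sum_(i < L) 16 * L%:R <= _); last first.
    by rewrite sumr_const card_ord -[_ *+ L]mulr_natr -mulrA -expr2.
  apply: ler_sum => i _; apply: le_trans (HD i).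
  rewrite [leRHS]exchange_big/=; apply: ler_sum => j _.
  by rewrite -(pair_bigA _ (fun j2 j3 => D i j2 j j3)).
have S3 : \sum_(p : 'I_L * 'I_L) \sum_(q : 'I_L * 'I_L) D p.1 q.2 p.2 q.1 <= 16 * L%:R ^+ 2.
  apply: le_trans S2; rewrite le_eqVlt; apply/orP; left; apply/eqP.
  apply: eq_bigr => p _.
  rewrite -(pair_bigA _ (fun j2 j3 => D p.1 j3 p.2 j2)) exchange_big/=.
  by rewrite pair_bigA.
apply: le_trans (_ : _ <= \sum_(p : 'I_L * 'I_L) \sum_(q : 'I_L * 'I_L)
   (D p.1 p.2 q.1 q.2 + D p.1 q.1 p.2 q.2 + D p.1 q.2 p.2 q.1)) _.
  by apply: ler_sum => p _; apply: ler_sum => q _; exact: key.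
under eq_bigr do rewrite !big_split/=.
rewrite !big_split/=.
apply: le_trans (lerD (lerD S1 S2) S3) _.
by rewrite -!mulrDl; apply: ler_wpM2r; [exact: sqr_ge0|lra].
Qed.

End counting.

(** * Moments bounded by cumulants *)

Section cumulants.
Context {R : realType} d (T : measurableType d) (P : probability T R).

Lemma fine_expectation (f : T -> R) : fine 'E_P[f] = expect P f.
Proof. by rewrite unlock. Qed.

(** The partitions that survive in the cumulant of centred variables besides the one-block
    partition. *)
Definition thick_partition u (pi : {set {set 'I_u}}) :=
  [&& finset.partition pi (finset.setTfor 'I_u), (1 < #|pi|)%N &
      [forall (B | B \in pi), (1 < #|B|)%N]].

(* A singleton block contributes the factor E[Z i] = 0. *)
Lemma moment_le_cumulant u (Z : 'I_u -> T -> R) : (0 < u)%N ->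
    (forall i, expect P (Z i) = 0) ->
  `|expect P (fun w => \prod_i Z i w)| <= `|joint_cumulant P Z| +
    \sum_(pi : {set {set 'I_u}} | thick_partition pi) ((#|pi|.-1)`!)%:R *
      \prod_(B in pi) `|expect P (fun w => \prod_(i in B) Z i w)|.
Proof.
move=> u0 Z0.
pose c (pi : {set {set 'I_u}}) : R := (-1) ^+ (#|pi|.-1) * ((#|pi|.-1)`!)%:R *
  \prod_(B in pi) expect P (fun w => \prod_(i in B) Z i w).
pose top : {set {set 'I_u}} := finset.set1 (finset.setTfor 'I_u).
have topP : finset.partition top (finset.setTfor 'I_u).
  rewrite /finset.partition finset.cover1 eqxx finset.trivIset1/= !inE eq_sym.
  by apply/finset.set0Pn; exists (Ordinal u0); rewrite inE.
have -> : joint_cumulant P Z = c top + \sum_(pi | thick_partition pi) c pi.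
  rewrite /joint_cumulant (bigD1 top)//=; congr (_ + _).
    by rewrite /c; congr (_ * _); apply: eq_bigr => B _; rewrite fine_expectation.
  rewrite (bigID (fun pi => thick_partition pi))/= [X in _ + X]big1 ?addr0.
    apply: eq_big => pi.
      apply/idP/idP => [/andP[]//|pit]; rewrite pit andbT.
      case/and3P: (pit) => -> pi1 _/=; apply: contraTneq pi1 => ->.
      by rewrite /top cards1.
    by move=> _; rewrite /c; congr (_ * _); apply: eq_bigr => B _; rewrite fine_expectation.
  move=> pi /andP[/andP[piP pit] npi].
  have [E0 _ pi0] := and3P piP.
  have pi1 : (1 < #|pi|)%N.
    rewrite ltn_neqAle lt0n eq_sym; apply/andP; split.
      apply: contra pit => /cards1P[B piB]; move: E0; rewrite piB finset.cover1 => /eqP ->.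
      by [].
    rewrite cards_eq0; apply/eqP => pie; move: E0.
    rewrite pie /finset.cover big_set0 => /eqP/setP/(_ (Ordinal u0)).
    by rewrite !inE.
  move: npi; rewrite /thick_partition piP pi1/= => /forallPn[B].
  rewrite negb_imply -leqNgt => /andP[Bpi B1].
  rewrite (bigD1 B)//=.
  have /cards1P[i ->] : #|B| == 1%N.
    rewrite eqn_leq B1/= lt0n cards_eq0; apply: contraNneq pi0 => B0.
    by rewrite -B0.
  rewrite fine_expectation (_ : (fun w => _) = Z i) ?Z0 ?mul0r ?mulr0//.
  by apply/funext => w; rewrite big_set1.
have -> : c top = expect P (fun w => \prod_i Z i w).
  rewrite /c /top cards1 expr0 !mul1r big_set1; congr expect; apply/funext => w.
  by apply: eq_bigl => i; rewrite inE.
set s := \sum_(pi | _) c pi.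
set m := expect P _.
have := ler_normB (m + s) s; rewrite addrK => /le_trans; apply.
rewrite lerD2l.
apply: le_trans (ler_norm_sum _ _ _) _; apply: ler_sum => pi _.
by rewrite /c !normrM normrX normrN1 expr1n mul1r normr_nat normr_prod.
Qed.

Lemma thick_partition_card u (pi : {set {set 'I_u}}) : thick_partition pi ->
  (#|pi| * 2 <= u)%N.
Proof.
case/and3P=> /card_partition; rewrite cardsT card_ord => pu _ /forallP piB.
apply: (@leq_trans (\sum_(B in pi) #|B|)%N); last by rewrite -pu.
rewrite -sum_nat_const; apply: leq_sum => B Bpi.
by have := piB B; rewrite Bpi.
Qed.

(** Two points have no partition into several blocks without a singleton. *)
Lemma second_moment_cumulant (Z : 'I_2 -> T -> R) :
    (forall i, expect P (Z i) = 0) ->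
  `|expect P (fun w => Z ord0 w * Z ord_max w)| <= `|joint_cumulant P Z|.
Proof.
move=> Z0; have := moment_le_cumulant (ltn0Sn 1) Z0.
rewrite big_pred0 ?addr0; last first.
  move=> pi; apply/negP => pit; have := thick_partition_card pit.
  by case/and3P: pit; lia.
move=> H; apply: le_trans H; rewrite le_eqVlt; apply/orP; left; apply/eqP.
congr (`|expect P _|); apply/funext => w.
rewrite !big_ord_recl big_ord0 mulr1; congr (_ * Z _ _); exact/val_inj.
Qed.

(** Four distinct numbers below 4 make {x, y}, {z, t} one of the three perfect matchings, so the
    left side is one of the three summands; the cases are enumerated. *)
Lemma matching_le (f : nat -> nat -> R) x y z t :
    (forall a b, f a b = f b a) -> (forall a b, 0 <= f a b) ->
    uniq [:: x; y; z; t] -> all (fun a => (a < 4)%N) [:: x; y; z; t] ->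
  f x y * f z t <= f 0 1 * f 2 3 + f 0 2 * f 1 3 + f 0 3 * f 1 2.
Proof.
move=> fC f0 xyzt /and5P[x4 y4 z4 t4 _].
have h1 : 0 <= f 0 1 * f 2 3 by rewrite mulr_ge0.
have h2 : 0 <= f 0 2 * f 1 3 by rewrite mulr_ge0.
have h3 : 0 <= f 0 3 * f 1 2 by rewrite mulr_ge0.
have [[e10 e20] e30] := (fC 1 0, fC 2 0, fC 3 0).
have [[e21 e31] e32] := (fC 2 1, fC 3 1, fC 3 2).
move: x x4 y y4 z z4 t t4 xyzt.
case=> [|[|[|[|//]]]] _; case=> [|[|[|[|//]]]] _; case=> [|[|[|[|//]]]] _;
  case=> [|[|[|[|//]]]] _; rewrite //= => _;
rewrite ?e10 ?e20 ?e30 ?e21 ?e31 ?e32; lra.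
Qed.

Definition pairings (c : 'I_4 -> 'I_4 -> R) : R :=
  c (inord 0) (inord 1) * c (inord 2) (inord 3) +
  c (inord 0) (inord 2) * c (inord 1) (inord 3) +
  c (inord 0) (inord 3) * c (inord 1) (inord 2).

(* The only thick partitions of four points are the three perfect matchings. *)
Lemma fourth_moment_cumulant (Z : 'I_4 -> T -> R) :
    (forall i, expect P (Z i) = 0) ->
  `|expect P (fun w => \prod_i Z i w)| <= `|joint_cumulant P Z| +
    #|{set {set 'I_4}}|%:R *
    pairings (fun a b => `|expect P (fun w => Z a w * Z b w)|).
Proof.
move=> Z0; apply: le_trans (moment_le_cumulant (ltn0Sn 3) Z0) _.
rewrite lerD2l.
pose c a b := `|expect P (fun w => Z a w * Z b w)|.
rewrite -/(pairings c); set M := pairings c.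
have M0 : 0 <= M by rewrite /M /pairings; do 2?apply: addr_ge0; apply: mulr_ge0; exact: normr_ge0.
(* Summing over all families of sets instead of the three matchings is crude, but the constant is
   universal. *)
have -> : #|{set {set 'I_4}}|%:R * M = \sum_(pi : {set {set 'I_4}}) M.
  by rewrite sumr_const mulr_natl.
rewrite big_mkcond/=; apply: ler_sum => pi _.
case: ifPn => // pit; have pi2 : #|pi| = 2.
  by have := thick_partition_card pit; case/and3P: pit; lia.
have /cards2P[A [B [AB piAB]]] : #|pi| == 2 by rewrite pi2.
have [piP _ /forallP thick] := and3P pit.
have Api : A \in pi by rewrite piAB !inE eqxx.
have Bpi : B \in pi by rewrite piAB !inE eqxx orbT.
have A2 : (1 < #|A|)%N by have := thick A; rewrite Api.
have B2 : (1 < #|B|)%N by have := thick B; rewrite Bpi.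
have c4 : #|A| + #|B| = 4.
  by have := card_partition piP; rewrite cardsT card_ord piAB big_setU1 ?inE//= big_set1.
have [_ /finset.trivIsetP dis _] := and3P piP.
have {}dis := dis _ _ Api Bpi AB.
have /cards2P[x [y [xy eA]]] : #|A| == 2 by lia.
have /cards2P[z [t [zt eB]]] : #|B| == 2 by lia.
rewrite pi2 mul1r piAB big_setU1 ?inE//= big_set1.
have pr a b : a != b ->
   `|expect P (fun w => \prod_(i in finset.setU (finset.set1 a) (finset.set1 b)) Z i w)| = c a b.
  move=> ab; rewrite /c; congr (`|expect P _|); apply/funext => w.
  by rewrite big_setU1 ?inE//= big_set1.
rewrite eA eB !pr//.
pose f a b := c (inord a) (inord b).
have -> : c x y * c z t = f x y * f z t by rewrite /f !inord_val.
apply: matching_le.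
- by move=> a b; rewrite /f /c; congr (`|expect P _|); apply/funext => w; rewrite mulrC.
- by move=> a b; exact: normr_ge0.
- have nAB i j : i \in A -> j \in B -> i != j.
    move=> iA jB; apply: contraTneq iA => ->; apply/negP => jA.
    by move/pred0P : dis => /(_ j) /=; rewrite jA jB.
  have [xA yA] : x \in A /\ y \in A by rewrite eA !inE !eqxx orbT.
  have [zB tB] : z \in B /\ t \in B by rewrite eB !inE !eqxx orbT.
  by rewrite /= !inE !negb_or !(inj_eq val_inj) xy zt !nAB.
- by rewrite /= !ltn_ord.
Qed.

End cumulants.

Section cumulant_decay_bounds.
Context {R : realType} d (T : measurableType d) (P : probability T R).
Variables (L : nat) (Y : 'I_L -> T -> R) (c kappa : R).
Hypotheses (c_gt0 : 0 < c) (kappa_gt2 : 2 < kappa).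
Hypothesis Y_mean : forall l, expect P (Y l) = 0.
Hypothesis Y_cum : forall u (l : 'I_u -> 'I_L), (2 <= u <= 4)%N ->
  `|joint_cumulant P (fun a => Y (l a))| <=
  c `^ (u%:R / 2) * (maxn 1 (index_spread l))%:R `^ (- kappa).

Lemma powR_decay k : (maxn 1 k)%:R `^ (- kappa) <= decay R k.
Proof.
rewrite powRN /decay lef_pV2 ?posrE ?exprn_gt0 ?powR_gt0 ?ltr0n ?leq_max//.
rewrite -powR_mulrn//; apply: ler_powR; last exact: ltW.
by rewrite ler1n leq_max.
Qed.

Lemma cum_decay u (l : 'I_u -> 'I_L) k : (2 <= u <= 4)%N ->
    (k <= index_spread l)%N ->
  `|joint_cumulant P (fun a => Y (l a))| <= c `^ (u%:R / 2) * decay R k.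
Proof.
move=> u24 kl; apply: le_trans (Y_cum l u24) _.
apply: ler_wpM2l; first exact: powR_ge0.
by apply: (le_trans (powR_decay _)); exact: decay_anti.
Qed.

Lemma dist_le_spread u (l : 'I_u -> 'I_L) i j : (dist (l i) (l j) <= index_spread l)%N.
Proof.
rewrite /index_spread; apply: leq_trans (leq_bigmax i).
exact: (@leq_bigmax _ (fun j => dist (l i) (l j))).
Qed.

Lemma cov_decay l l' : `|expect P (fun w => Y l w * Y l' w)| <= c * decay R (dist l l').
Proof.
pose s (a : 'I_2) := if a == ord0 then l else l'.
apply: le_trans (_ : `|joint_cumulant P (fun a => Y (s a))| <= _).
  exact: (@second_moment_cumulant _ _ _ P (fun a => Y (s a))).
have := @cum_decay 2 s (dist l l') isT (dist_le_spread s ord0 ord_max).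
by rewrite divff// powRr1// ltW.
Qed.

Let N : R := #|{set {set 'I_4}}|%:R.

Let dec (l l' : 'I_L) : R := decay R (dist l l').

Lemma quad_decay l1 l2 l3 l4 :
  `|expect P (fun w => Y l1 w * Y l2 w * Y l3 w * Y l4 w)| <=
  c ^+ 2 * (decay R (maxn (dist l1 l2) (maxn (dist l1 l3) (dist l1 l4))) +
   N * (dec l1 l2 * dec l3 l4 + dec l1 l3 * dec l2 l4 + dec l1 l4 * dec l2 l3)).
Proof.
pose s (a : 'I_4) := nth l1 [:: l1; l2; l3; l4] a.
have -> : expect P (fun w => Y l1 w * Y l2 w * Y l3 w * Y l4 w) =
    expect P (fun w => \prod_a Y (s a) w).
  congr expect; apply/funext => w.
  by rewrite !big_ord_recl big_ord0 mulr1 /s /= !mulrA.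
apply: le_trans (@fourth_moment_cumulant _ _ _ P (fun a => Y (s a)) _) _.
  by move=> a; exact: Y_mean.
rewrite [leRHS]mulrDr; apply: lerD.
  have -> : c ^+ 2 = c `^ (4%:R / 2) :> R.
    have -> : 4%:R / 2 = 2%:R :> R by lra.
    by rewrite powR_mulrn// ltW.
  apply: cum_decay => //; rewrite !geq_max.
  have h (j : nat) : (j < 4)%N -> (dist l1 (nth l1 [:: l1; l2; l3; l4] j) <= index_spread s)%N.
    by move=> j4; have := dist_le_spread s ord0 (Ordinal j4).
  by rewrite (h 1)// (h 2)// (h 3).
rewrite mulrCA; apply: ler_wpM2l; first by rewrite /N.
rewrite /pairings /s !inordK//=.
have H a b a' b' : `|expect P (fun w => Y a w * Y b w)| *
   `|expect P (fun w => Y a' w * Y b' w)| <= c ^+ 2 * (dec a b * dec a' b').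
  by rewrite expr2 mulrACA; apply: ler_pM => //; exact: cov_decay.
by rewrite !mulrDr !lerD.
Qed.

(** 48 is the constant of [sum_decay_quad]; 108 is 3 times 36, for three pairings, each at most the
    square of 6 L. *)
Definition quad_const : R := 48 + 108 * N.

Lemma quad_const_ge1 : 1 <= quad_const.
Proof. by rewrite /quad_const; have : 0 <= N by []; lra. Qed.

Lemma quad_sum :
  \sum_(p : 'I_L * 'I_L) \sum_(q : 'I_L * 'I_L)
    `|expect P (fun w => Y p.1 w * Y p.2 w * Y q.1 w * Y q.2 w)| <=
  quad_const * (c * L%:R) ^+ 2.
Proof.
have sum1 : \sum_i \sum_j dec i j <= 6 * L%:R.
  rewrite mulr_natr -[X in _ *+ X]card_ord -sumr_const.
  by apply: ler_sum => i _; exact: sum_decay_row.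
have sum0 : 0 <= \sum_i \sum_j dec i j.
  by apply: sumr_ge0 => i _; apply: sumr_ge0 => j _; exact: decay_ge0.
have sum2 : (\sum_i \sum_j dec i j) ^+ 2 <= 36 * L%:R ^+ 2.
  have -> : 36 * L%:R ^+ 2 = (6 * L%:R) ^+ 2 :> R by ring.
  by apply: lerXn2r; rewrite ?nnegrE// mulr_ge0.
have S1 : \sum_(p : 'I_L * 'I_L) \sum_(q : 'I_L * 'I_L) dec p.1 p.2 * dec q.1 q.2 =
    (\sum_i \sum_j dec i j) ^+ 2.
  by rewrite (pair_bigA _ dec)/= expr2 big_distrlr.
have S2 : \sum_(p : 'I_L * 'I_L) \sum_(q : 'I_L * 'I_L) dec p.1 q.1 * dec p.2 q.2 =
    (\sum_i \sum_j dec i j) ^+ 2.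
  rewrite expr2 big_distrlr [RHS]pair_bigA; apply: eq_bigr => p _.
  by rewrite -(pair_bigA _ (fun a b => dec p.1 a * dec p.2 b)) big_distrlr.
have S3 : \sum_(p : 'I_L * 'I_L) \sum_(q : 'I_L * 'I_L) dec p.1 q.2 * dec p.2 q.1 =
    (\sum_i \sum_j dec i j) ^+ 2.
  rewrite -S2; apply: eq_bigr => p _.
  rewrite -(pair_bigA _ (fun a b => dec p.1 b * dec p.2 a)) exchange_big/=.
  by rewrite pair_bigA.
apply: (@le_trans _ _ (\sum_(p : 'I_L * 'I_L) \sum_(q : 'I_L * 'I_L)
  c ^+ 2 * (decay R (maxn (dist p.1 p.2) (maxn (dist p.1 q.1) (dist p.1 q.2))) +
   N * (dec p.1 p.2 * dec q.1 q.2 + dec p.1 q.1 * dec p.2 q.2 + dec p.1 q.2 * dec p.2 q.1)))).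
  by apply: ler_sum => p _; apply: ler_sum => q _; exact: quad_decay.
under eq_bigr do rewrite -mulr_sumr.
rewrite -mulr_sumr exprMn mulrCA; apply: ler_wpM2l; first exact: sqr_ge0.
under eq_bigr do rewrite big_split/= -mulr_sumr.
rewrite big_split/= -mulr_sumr.
under [X in N * X]eq_bigr do rewrite !big_split/=.
rewrite !big_split/= S1 S2 S3.
have Q := sum_decay_quad R L.
have N0 : 0 <= N by [].
have : N * ((\sum_i \sum_j dec i j) ^+ 2) <= N * (36 * L%:R ^+ 2) by apply: ler_wpM2l.
rewrite /quad_const; move: ((\sum_i \sum_j dec i j) ^+ 2) (L%:R ^+ 2) Q => s l Q.
have -> : (48 + 108 * N) * l = 48 * l + 3 * (N * (36 * l)) by ring.
have -> : N * (s + s + s) = 3 * (N * s) by ring.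
by move: (N * s) (N * (36 * l)) => u v; lra.
Qed.

(** The case of four equal indices, where every decay factor is 1. *)
Lemma fourth_moment_le l : expect P (fun w => Y l w ^+ 4) <= quad_const * c ^+ 2.
Proof.
have := quad_decay l l l l; rewrite /dec.
have -> : (fun w => Y l w * Y l w * Y l w * Y l w) = (fun w => Y l w ^+ 4).
  by apply/funext => w; rewrite !exprS expr0 mulr1 !mulrA.
move=> H; apply: le_trans (ler_norm _) _; apply: le_trans H _.
rewrite mulrC; apply: ler_wpM2r; first exact: sqr_ge0.
have -> : dist l l = 0 by rewrite /dist distnn.
rewrite !maxnn /decay maxn0 expr1n invr1 !mulr1 /quad_const.
by have : 0 <= N by []; lra.
Qed.

End cumulant_decay_bounds.

(** * The normalized sample *)

Section equality_in_law.
Context {R : realType} d1 (T1 : measurableType d1) (P1 : probability T1 R)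
  d2 (T2 : measurableType d2) (P2 : probability T2 R)
  d' (T' : measurableType d').

(** Both sides are integrals against push-forward measures, which coincide. *)
Lemma eq_law_moment (X : T1 -> T') (Y : T2 -> T') (f : T' -> R) :
    measurable_fun setT X -> measurable_fun setT Y -> measurable_fun setT f ->
    (forall A, measurable A -> P1 (X @^-1` A) = P2 (Y @^-1` A)) ->
    intble P2 (f \o Y) ->
  intble P1 (f \o X) /\ expect P1 (f \o X) = expect P2 (f \o Y).
Proof.
move=> mX mY mf XY If.
have mF : measurable_fun setT (EFin \o f) by exact/measurable_EFinP.
have eqPF (g : T' -> \bar R) : measurable_fun setT g ->
    (\int[pushforward P1 X]_y g y = \int[pushforward P2 Y]_y g y)%E.
  by move=> mg; apply: eq_measure_integral => A mA _; exact: XY.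
have IX : intble P1 (f \o X).
  apply/integrableP; split; first by apply/measurable_EFinP; exact: measurableT_comp.
  have mG : measurable_fun setT (fun y => `|(f y)%:E|%E) by exact: measurableT_comp mF.
  have /integrableP[_] := If.
  rewrite -(@ge0_integral_pushforward _ _ _ _ _ _ mX P1 setT (fun y => `|(f y)%:E|%E))//.
  by rewrite -(@ge0_integral_pushforward _ _ _ _ _ _ mY P2 setT (fun y => `|(f y)%:E|%E))// eqPF.
split=> //; rewrite /expect /Rintegral.
rewrite -(integral_pushforward mX mF IX measurableT).
by rewrite -(integral_pushforward mY mF If measurableT) eqPF.
Qed.

End equality_in_law.

(** * Past and present of the sample *)

Section past_of_sample.
Context {R : realType} d (T : measurableType d) (P : probability T R)
  d' (T' : measurableType d') (n : nat) (X : 'I_n -> {mfun T >-> T'}).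
Hypothesis X_indep : mutually_independent P (fun i => X i : T -> T').

(** Rectangles in the observations of index below [k] form a pi-system, on which independence can be
    checked. *)
Definition past_sets (k : nat) : set (set T) :=
  [set A | exists2 B : 'I_n -> set T', (forall i, measurable (B i)) &
    A = [set w | forall i : 'I_n, (i < k)%N -> B i (X i w)]].

(** The index is a natural number, as in the martingale; for [k] at least [n] the family is
    empty. *)
Definition next_sets (k : nat) : set (set T) :=
  [set A | exists i : 'I_n, exists2 B : set T', measurable B &
    (i : nat) = k /\ A = X i @^-1` B].

Let mX i (B : set T') : measurable B -> measurable (X i @^-1` B).
Proof. by move=> mB; rewrite -[_ @^-1` _]setTI; exact: measurable_funP. Qed.

Lemma past_measurable k : past_sets k `<=` measurable.
Proof.
move=> A [B mB ->].
rewrite (_ : [set _ | _] = \bigcap_(i in [set i : 'I_n | (i < k)%N]) (X i @^-1` B i)).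
  by apply: fin_bigcap_measurable => // i _; exact: mX.
by apply/seteqP; split => w h i; exact: h.
Qed.

Lemma next_measurable k : next_sets k `<=` measurable.
Proof. by move=> A [i [B mB [_ ->]]]; exact: mX. Qed.

Lemma past_setI_closed k : setI_closed (past_sets k).
Proof.
move=> _ _ [B mB ->] [B' mB' ->]; exists (fun i => B i `&` B' i).
  by move=> i; exact: measurableI.
apply/seteqP; split => w /=; first by case=> h h' i ik; split; [exact: h|exact: h'].
by move=> h; split=> i ik; case: (h i ik).
Qed.

Lemma next_setI_closed k : setI_closed (next_sets k).
Proof.
move=> _ _ [i [B mB [ik ->]]] [i' [B' mB' [ik' ->]]].
have -> : i' = i by apply/val_inj; rewrite /= ik ik'.
by exists i; exists (B `&` B'); [exact: measurableI|].
Qed.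

Lemma past_mono k : <<s past_sets k >> `<=` <<s past_sets k.+1 >>.
Proof.
apply: sub_sigma_algebra2 => A [B mB ->].
exists (fun i : 'I_n => if (i < k)%N then B i else setT).
  by move=> i; case: ifP.
apply/seteqP; split => w /= h i ik; first by case: ifP => // /h.
by have := h i (leqW ik); rewrite ik.
Qed.

Lemma next_past k : <<s next_sets k >> `<=` <<s past_sets k.+1 >>.
Proof.
apply: sub_sigma_algebra2 => A [i [B mB [ik ->]]].
exists (fun j => if j == i then B else setT).
  by move=> j; case: ifP.
apply/seteqP; split => w /= h; first by move=> j _; case: eqP => // ->.
by have := h i; rewrite eqxx ik; exact.
Qed.

(** After reduction to rectangles, the product rule over the indices at most k is the one over the
    indices below k with one more factor. *)
Lemma past_next_indep k A B : <<s past_sets k >> A -> <<s next_sets k >> B ->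
  P (A `&` B) = (P A * P B)%E.
Proof.
move: A B; apply: sigma_indep.
- exact: past_setI_closed.
- exact: next_setI_closed.
- exact: past_measurable.
- exact: next_measurable.
move=> _ _ [B mB ->] [i [B' mB' [ik ->]]].
pose C j := if j == i then B' else B j.
have mC j : measurable (C j) by rewrite /C; case: ifP.
have Cj (j : 'I_n) : (j < k)%N -> C j = B j.
  by rewrite /C; case: eqP => // ->; rewrite ik ltnn.
have Ci : C i = B' by rewrite /C eqxx.
have := X_indep (finset (fun j : 'I_n => (j <= k)%N)) mC.
have := X_indep (finset (fun j : 'I_n => (j < k)%N)) mC.
have -> : [set w | forall j, j \in finset (fun j : 'I_n => (j < k)%N) -> C j (X j w)] =
    [set w | forall j : 'I_n, (j < k)%N -> B j (X j w)].
  apply/seteqP; split => w /= h j.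
    by move=> jk; rewrite -(Cj _ jk); apply: h; rewrite inE.
  by rewrite inE => jk; rewrite (Cj _ jk); exact: h.
have -> : [set w | forall j, j \in finset (fun j : 'I_n => (j <= k)%N) -> C j (X j w)] =
    [set w | forall j : 'I_n, (j < k)%N -> B j (X j w)] `&` X i @^-1` B'.
  apply/seteqP; split => w /= h.
    split; last by rewrite -Ci; apply: h; rewrite inE ik.
    by move=> j jk; rewrite -(Cj _ jk); apply: h; rewrite inE ltnW.
  case: h => h1 h2 j; rewrite inE leq_eqVlt => /orP[/eqP jk|jk].
    by have -> : j = i by [apply/val_inj; rewrite /= jk ik]; rewrite Ci.
  by rewrite (Cj _ jk); exact: h1.
move=> -> ->; rewrite (bigD1 i) ?inE ?ik//= Ci muleC; congr (_ * _)%E.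
apply: eq_bigl => j; rewrite !inE ltn_neqAle andbC; congr (_ && _).
by rewrite -(inj_eq val_inj)/= ik.
Qed.

Lemma next_gmeas (i : 'I_n) (f : T' -> R) : measurable_fun setT f ->
  gmeas (next_sets i) (f \o X i).
Proof.
move=> mf _ A mA; rewrite setTI; apply: sub_gen_smallest.
exists i; exists (f @^-1` A) => //.
by rewrite -[_ @^-1` _]setTI; exact: mf.
Qed.

End past_of_sample.

(** Its inverse is exactly the second moment of the normalized statistic. *)
Definition falling_ratio (R : realType) (q n : nat) : R :=
  (n ^_ q)%:R / n%:R ^+ q.

Section normalized_sample.
Context {R : realType} d (T : measurableType d) (P : probability T R).
Variables (n L p : nat) (X : 'I_n -> {RV P >-> p.-tuple R}).
Variables (h : 'I_L -> {mfun p.-tuple R >-> R}) (Y0 : {RV P >-> L.-tuple R}).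
Variables (c C kappa : R).
Hypothesis X_iid : iid P (fun i : 'I_n => X i : T -> p.-tuple R).
Hypothesis Y_copies : forall i : 'I_n,
  eq_in_distribution P (fun w => [tuple h l (X i w) | l < L])
    (Y0 : T -> L.-tuple R).
Hypothesis c_gt0 : 0 < c.
Hypothesis trace_lb : c * L%:R <= \tr (covariance_mx P Y0).
Hypothesis fourth_moment :
  (ereal_sup [set 'E_P[fun w => (tnth (Y0 w) l ^+ 4)%R] | l in [set: 'I_L]] < C%:E)%E.
Hypothesis kappa_gt2 : 2 < kappa.
Hypothesis cumulant_decay : forall (u : nat) (l : 'I_u -> 'I_L),
  (2 <= u <= 4)%N ->
  `|joint_cumulant P (fun (a : 'I_u) w => tnth (Y0 w) (l a))|
  <= c `^ (u%:R / 2) * (maxn 1 (index_spread l))%:R `^ (- kappa).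
Hypothesis null_hypothesis : forall l : 'I_L, ('E_P[fun w => tnth (Y0 w) l] = 0)%E.
Hypothesis n_gt0 : (0 < n)%N.

Let Y l w : R := tnth (Y0 w) l.

Let mY l : measurable_fun setT (Y l).
Proof. exact: measurableT_comp (measurable_tnth l) (measurable_funP Y0). Qed.

Let Y_mean l : expect P (Y l) = 0.
Proof. by rewrite -fine_expectation null_hypothesis. Qed.

Let Y_L4 l : L4 P (Y l).
Proof.
split; first exact: mY.
apply/integrableP; split.
  by apply/measurable_EFinP; apply: measurable_funX; exact: mY.
apply: le_lt_trans (lt_trans fourth_moment (ltry C)).
apply: ereal_sup_ubound; exists l => //.
rewrite unlock; apply: eq_integral => w _ /=.
by rewrite ger0_norm ?exprn_even_ge0.
Qed.

Let cov l l' : R := expect P (fun w => Y l w * Y l' w).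

Lemma covariance_mxE l l' : covariance_mx P Y0 l l' = cov l l'.
Proof.
rewrite /covariance_mx mxE unlock !null_hypothesis fine_expectation.
by apply: expect_ext => w; exact: (congr2 *%R (subr0 _) (subr0 _)).
Qed.

Let cov_le l l' : `|cov l l'| <= c * decay R (dist l l').
Proof. exact: cov_decay Y_mean cumulant_decay l l'. Qed.

(** The cumulant bound makes each variance at most [c], and the trace bound makes their sum at least
    c L, so no variance can be smaller. *)
Let cov_diag l : cov l l = c.
Proof.
have le_c l' : cov l' l' <= c.
  apply: le_trans (ler_norm _) (le_trans (cov_le l' l') _).
  by rewrite ler_piMr ?decay_le1// ltW.
have tr : \sum_l' (c - cov l' l') <= 0.
  rewrite sumrB sumr_const card_ord subr_le0 -[c *+ L]mulr_natr.
  apply: le_trans trace_lb _; rewrite /mxtrace le_eqVlt; apply/orP; left; apply/eqP.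
  by apply: eq_bigr => l' _; exact: covariance_mxE.
have ge0 l' : 0 <= c - cov l' l' by rewrite subr_ge0.
have tr0 : \sum_l' (c - cov l' l') = 0.
  by apply/eqP; rewrite eq_le tr sumr_ge0.
by have /eqP := psumr_eq0P (fun l' _ => ge0 l') tr0 (i := l) isT; rewrite subr_eq0 => /eqP.
Qed.

Definition obs_scale : R := Num.sqrt (c * n%:R).
Let s_gt0 : 0 < obs_scale. Proof. by rewrite sqrtr_gt0 mulr_gt0// ltr0n. Qed.
Let s_sqr : obs_scale ^+ 2 = c * n%:R.
Proof. by rewrite sqr_sqrtr// mulr_ge0// ltW. Qed.

(* Beyond the sample size the sequence is continued by 0. *)
Definition obs (k : nat) (l : 'I_L) (w : T) : R :=
  if insub k is Some i then obs_scale^-1 * h l (X i w) else 0.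

Definition ncov (l l' : 'I_L) : R := cov l l' / c.

Lemma obsE (i : 'I_n) l w : obs i l w = obs_scale^-1 * h l (X i w).
Proof. by rewrite /obs valK. Qed.

Let transfer (i : 'I_n) (f : L.-tuple R -> R) : measurable_fun setT f ->
    intble P (fun w => f (Y0 w)) ->
  intble P (fun w => f [tuple h l (X i w) | l < L]) /\
  expect P (fun w => f [tuple h l (X i w) | l < L]) = expect P (fun w => f (Y0 w)).
Proof.
move=> mf If.
apply: (eq_law_moment _ _ mf (Y_copies i) If) => //.
apply/measurable_fun_tnthP => l.
rewrite (_ : _ \o _ = fun w => h l (X i w)).
  by apply: measurableT_comp.
by apply/funext => w /=; rewrite tnth_mktuple.
Qed.

Let obs_prod (i : 'I_n) (l1 l2 l3 l4 : 'I_L) :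
  expect P (fun w => obs i l1 w * obs i l2 w * obs i l3 w * obs i l4 w) =
  expect P (fun w => Y l1 w * Y l2 w * Y l3 w * Y l4 w) / (c * n%:R) ^+ 2.
Proof.
pose f (t : L.-tuple R) := tnth t l1 * tnth t l2 * tnth t l3 * tnth t l4.
have mf : measurable_fun setT f.
  by repeat apply: measurable_funM; exact: measurable_tnth.
have [I E] := transfer i mf (L4_prod (Y_L4 l1) (Y_L4 l2) (Y_L4 l3) (Y_L4 l4)).
rewrite mulrC -[expect P (fun w => Y l1 w * _ * _ * _)]E -expectZ//.
apply: expect_ext => w; rewrite /f !tnth_mktuple !obsE -s_sqr.
by field; rewrite gt_eqF.
Qed.

Lemma obs_L4 k l : (k < n)%N -> L4 P (obs k l).
Proof.
move=> kn; rewrite -[k]/(val (Ordinal kn)).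
rewrite (_ : obs _ l = fun w => obs_scale^-1 * h l (X (Ordinal kn) w)); last first.
  by apply/funext => w; rewrite obsE.
apply: L4Z; split; first exact: measurableT_comp.
have mf : measurable_fun setT (fun t : L.-tuple R => tnth t l ^+ 4).
  by apply: measurable_funX; exact: measurable_tnth.
have [I _] := transfer (Ordinal kn) mf (Y_L4 l).2.
by apply: intble_ext I => w; rewrite tnth_mktuple.
Qed.

Lemma obs_mean k l : (k < n)%N -> expect P (obs k l) = 0.
Proof.
move=> kn; rewrite -[k]/(val (Ordinal kn)).
have [I E] := transfer (Ordinal kn) (measurable_tnth l) (L4_intble (Y_L4 l)).
rewrite -[0](mulr0 obs_scale^-1) -(Y_mean l) -E -expectZ//.
by apply: expect_ext => w; rewrite obsE tnth_mktuple.
Qed.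

Lemma obs_cov k l l' : (k < n)%N ->
  expect P (fun w => obs k l w * obs k l' w) = ncov l l' / n%:R.
Proof.
move=> kn; rewrite -[k]/(val (Ordinal kn)).
have mf : measurable_fun setT (fun t : L.-tuple R => tnth t l * tnth t l').
  by apply: measurable_funM; exact: measurable_tnth.
have [I E] := transfer (Ordinal kn) mf (L4_intble2 (Y_L4 l) (Y_L4 l')).
rewrite /ncov -mulrA -invfM -s_sqr mulrC /cov -E -expectZ//.
apply: expect_ext => w; rewrite !obsE !tnth_mktuple.
by field; rewrite gt_eqF.
Qed.

Lemma obs_4 k l : (k < n)%N -> expect P (fun w => obs k l w ^+ 4) <= @quad_const R / n%:R ^+ 2.
Proof.
move=> kn; rewrite -[k]/(val (Ordinal kn)).
have -> : (fun w => obs (Ordinal kn) l w ^+ 4) = fun w =>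
    obs (Ordinal kn) l w * obs (Ordinal kn) l w * obs (Ordinal kn) l w * obs (Ordinal kn) l w.
  by apply/funext => w; rewrite !exprS expr0 mulr1 !mulrA.
rewrite obs_prod ler_pdivrMr ?exprn_gt0 ?mulr_gt0 ?ltr0n//.
have -> : @quad_const R / n%:R ^+ 2 * (c * n%:R) ^+ 2 = @quad_const R * c ^+ 2.
  by field; rewrite pnatr_eq0 -lt0n.
apply: le_trans (fourth_moment_le c_gt0 kappa_gt2 Y_mean cumulant_decay l).
rewrite le_eqVlt; apply/orP; left; apply/eqP.
by apply: expect_ext => w; rewrite !exprS expr0 mulr1 !mulrA.
Qed.

Lemma obs_quad k : (k < n)%N ->
  \sum_(i : 'I_L * 'I_L) \sum_(j : 'I_L * 'I_L)
    `|expect P (fun w => obs k i.1 w * obs k i.2 w * obs k j.1 w * obs k j.2 w)|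
    <= @quad_const R * L%:R ^+ 2 / n%:R ^+ 2.
Proof.
move=> kn; rewrite -[k]/(val (Ordinal kn)).
under eq_bigr => i _ do under eq_bigr => j _ do
  rewrite obs_prod normrM [X in _ * X]ger0_norm ?invr_ge0 ?sqr_ge0//.
under eq_bigr do rewrite -mulr_suml.
rewrite -mulr_suml ler_pdivrMr ?exprn_gt0 ?mulr_gt0 ?ltr0n//.
apply: le_trans (quad_sum c_gt0 kappa_gt2 Y_mean cumulant_decay) _.
rewrite le_eqVlt; apply/orP; left; apply/eqP.
by field; rewrite pnatr_eq0 -lt0n.
Qed.

Lemma ncov_le l l' : `|ncov l l'| <= decay R (dist l l').
Proof.
rewrite /ncov normrM [X in _ * X]ger0_norm ?invr_ge0 ?(ltW c_gt0)//.
by rewrite ler_pdivrMr// mulrC.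
Qed.

Lemma ncov_le1 l l' : `|ncov l l'| <= 1.
Proof. exact: le_trans (ncov_le l l') (decay_le1 _ _). Qed.

Lemma ncov_sum l : \sum_l' `|ncov l l'| <= 6.
Proof.
apply: le_trans (sum_decay_row R l); apply: ler_sum => l' _; exact: ncov_le.
Qed.

Lemma ncov_diag l : ncov l l = 1.
Proof. by rewrite /ncov cov_diag divff// gt_eqF. Qed.

Lemma obs_next k l : (k < n)%N -> gmeas (next_sets X k) (obs k l).
Proof.
move=> kn; rewrite -[k]/(val (Ordinal kn)).
rewrite (_ : obs _ l = (fun v => obs_scale^-1 * h l v) \o X (Ordinal kn)); last first.
  by apply/funext => w; rewrite obsE.
by apply: next_gmeas; apply: measurable_funM => //; exact: measurable_cst.
Qed.

Let Gm k : past_sets X k `<=` measurable := @past_measurable _ _ _ _ _ X k.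
Let Gs k : <<s past_sets X k >> `<=` <<s past_sets X k.+1 >> := @past_mono _ _ _ _ _ X k.
Let Hn k : (k < n)%N -> <<s next_sets X k >> `<=` <<s past_sets X k.+1 >> :=
  fun _ => @next_past _ _ _ _ _ X k.
Let Gi k : (k < n)%N -> forall A B, <<s past_sets X k >> A -> <<s next_sets X k >> B ->
  P (A `&` B) = (P A * P B)%E := fun _ => past_next_indep X_iid.1 (k := k).

Definition ncov_pow q : R := \sum_l \sum_l' ncov l l' ^+ q.

(** The diagonal consists of ones and even powers are nonnegative. Hence the factor L^(-1/2) in the
    coefficients of the martingale. *)
Lemma ncov_pow_ge q : ~~ odd q -> L%:R <= ncov_pow q.
Proof.
move=> eq; rewrite -[L in L%:R]card_ord -[leLHS]/(_ *+ _) -sumr_const.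
apply: ler_sum => l _; rewrite (bigD1 l)//= ncov_diag expr1n lerDl.
by apply: sumr_ge0 => l' _; exact: exprn_even_ge0.
Qed.

(** The constant that remains in front of the elementary symmetric polynomials of the rescaled
    observations, where the powers of C_p have cancelled. *)
Definition stat_scale q : R :=
  Num.sqrt (q`!)%:R * (falling_ratio R q n)^-1 / Num.sqrt (ncov_pow q).

Hypothesis L_gt0 : (0 < L)%N.

Let V0 q : ~~ odd q -> 0 < ncov_pow q.
Proof. by move=> eq; apply: lt_le_trans (ncov_pow_ge eq); rewrite ltr0n. Qed.

Lemma normalized_UstatE q w : ~~ odd q -> (q <= n)%N ->
  normalized_Ustat (covariance_mx P Y0) q h X w =
  stat_scale q * \sum_l elem obs q l n w.
Proof.
move=> eq qn; rewrite /normalized_Ustat /Ustat.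
have s0 := s_gt0; have n0 : 0 < n%:R :> R by rewrite ltr0n.
under eq_bigr => l _.
  rewrite (eq_bigr (fun i : {ffun 'I_q -> 'I_n} =>
      obs_scale ^+ q * \prod_(a < q) obs (i a) l w)); last first.
    move=> i _; rewrite -[q in _ ^+ q]card_ord -prodr_const -big_split/=.
    apply: eq_bigr => a _; rewrite obsE mulrA divff ?mul1r// gt_eqF//.
  rewrite -mulr_sumr (sum_injections (fun k => obs k l w)) -/(elem obs q l n w).
  over.
rewrite -!mulr_sumr !mulrA; congr (_ * _).
(* Evenness makes q / 2 an integer k, so that the real powers of [n] and [c] become ordinary
   ones. *)
have [k qE] : exists k, q = (k * 2)%N.
  by exists q./2; rewrite muln2 -[LHS]odd_double_half (negbTE eq).
have -> : qnorm_pow q (covariance_mx P Y0) = (c ^+ k) ^+ 2 * ncov_pow q.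
  rewrite /qnorm_pow /ncov_pow mulr_sumr; apply: eq_bigr => l _.
  rewrite mulr_sumr; apply: eq_bigr => l' _.
  by rewrite covariance_mxE /ncov -exprM -qE -exprMn mulrC divfK// gt_eqF.
have -> : q%:R / 2 = k%:R :> R by rewrite qE natrM mulfK.
rewrite powR_mulrn// !powRN !powR12_sqrt ?ler0n ?mulr_ge0 ?sqr_ge0 ?(ltW (V0 eq))//.
rewrite sqrtrM ?sqr_ge0// sqrtr_sqr ger0_norm ?exprn_ge0 ?(ltW c_gt0)//.
have -> : obs_scale ^+ q = (c * n%:R) ^+ k by rewrite qE mulnC exprM s_sqr.
rewrite /stat_scale /falling_ratio -(ffact_fact qn) natrM.
have -> : n%:R ^+ q = n%:R ^+ k * n%:R ^+ k :> R by rewrite -exprD addnn -muln2 -qE.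
have f0 : (q`!)%:R = Num.sqrt (q`!)%:R ^+ 2 :> R by rewrite sqr_sqrtr.
have a0 : 0 < Num.sqrt (q`!)%:R :> R by rewrite sqrtr_gt0 ltr0n fact_gt0.
have b0 : 0 < Num.sqrt (ncov_pow q) by rewrite sqrtr_gt0; exact: V0.
have d0 : 0 < (n ^_ q)%:R :> R by rewrite ltr0n ffact_gt0.
have e0 : 0 < ((n - q)`!)%:R :> R by rewrite ltr0n fact_gt0.
have ck : 0 < c ^+ k by rewrite exprn_gt0.
have nk : 0 < n%:R ^+ k :> R by rewrite exprn_gt0.
rewrite exprMn {2}f0.
move: (Num.sqrt _) (Num.sqrt _) (_ ^_ _)%:R ((n - q)`!)%:R (c ^+ k) (n%:R ^+ k) a0 b0 d0 e0 ck nk.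
move=> a b f g u v a0 b0 f0' g0 u0 v0.
by field; rewrite !gt_eqF.
all: by apply: exprn_ge0; exact: ltW.
Qed.

(** An identity for every n >= q: the binomial coefficient cancels the q! of the scale and one of
    its two falling ratios. *)
Lemma stat_scale_sqr q : ~~ odd q -> (q <= n)%N ->
  stat_scale q ^+ 2 * ('C(n, q)%:R * \sum_l \sum_l' (ncov l l' / n%:R) ^+ q) =
  (falling_ratio R q n)^-1.
Proof.
move=> eq qn; have n0 : 0 < n%:R :> R by rewrite ltr0n.
have -> : \sum_l \sum_l' (ncov l l' / n%:R) ^+ q = ncov_pow q / n%:R ^+ q.
  rewrite /ncov_pow mulr_suml; apply: eq_bigr => l _.
  by rewrite mulr_suml; apply: eq_bigr => l' _; rewrite expr_div_n.
rewrite /stat_scale expr_div_n exprMn !sqr_sqrtr ?ltW ?V0// /falling_ratio.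
have d0 : 0 < (n ^_ q)%:R :> R by rewrite ltr0n ffact_gt0.
have f0 : 0 < (q`!)%:R :> R by rewrite ltr0n fact_gt0.
have -> : 'C(n, q)%:R = (n ^_ q)%:R / (q`!)%:R :> R.
  by rewrite -bin_ffact natrM mulfK// gt_eqF.
have := V0 eq; have : 0 < n%:R ^+ q :> R by rewrite exprn_gt0.
move: (q`!)%:R (_ ^_ _)%:R (n%:R ^+ q) (ncov_pow q) d0 f0 => a b f g.
move=> a0 b0 f0 g0.
by field; rewrite !gt_eqF.
Qed.

Lemma normalized_Ustat_L4 q : ~~ odd q -> (q <= n)%N ->
  L4 P (normalized_Ustat (covariance_mx P Y0) q h X).
Proof.
move=> eq qn.
rewrite (_ : normalized_Ustat _ _ _ _ = fun w => stat_scale q * \sum_l elem obs q l n w).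
  by apply: L4Z; apply: L4_sum => l; exact: (elem_L4 Gs Hn Gi obs_next obs_L4).
by apply/funext => w; exact: normalized_UstatE.
Qed.

Lemma normalized_Ustat_sqr q : ~~ odd q -> (q <= n)%N ->
  expect P (fun w => normalized_Ustat (covariance_mx P Y0) q h X w ^+ 2) =
  (falling_ratio R q n)^-1.
Proof.
move=> eq qn; rewrite -(stat_scale_sqr eq qn).
have Ie l l' : intble P (fun w => elem obs q l n w * elem obs q l' n w).
  by apply: L4_intble2; exact: (elem_L4 Gs Hn Gi obs_next obs_L4).
transitivity (expect P (fun w => stat_scale q ^+ 2 *
    \sum_l \sum_l' elem obs q l n w * elem obs q l' n w)).
  by apply: expect_ext => w; rewrite normalized_UstatE// exprMn [X in _ * X]expr2 big_distrlr.
rewrite expectZ; last by apply: intble_sum => l _; apply: intble_sum => l' _.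
congr (_ * _); rewrite mulr_sumr expect_sum; last first.
  by move=> l _; apply: intble_sum => l' _.
apply: eq_bigr => l _; rewrite mulr_sumr expect_sum//; apply: eq_bigr => l' _.
by rewrite (elem_cov Gs Hn Gi obs_next obs_L4 obs_mean obs_cov)// eqxx mul1r.
Qed.

Section several_statistics.
Variables (I : finType) (q : I -> nat) (theta : I -> R) (Mx : nat).
Hypothesis q_gt0 : forall i, (0 < q i)%N.
Hypothesis q_even : forall i, ~~ odd (q i).
Hypothesis q_inj : injective q.
Hypothesis q_n : forall i, (q i <= n)%N.
Hypothesis q_Mx : forall i, (q i <= Mx)%N.
Hypothesis q_ratio : forall i, (falling_ratio R (q i) n)^-1 <= 2.

(** Bounds L times the square of the sum of the |b i| in [charfun_bound]; the 2 comes from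
    [q_ratio], the removal of L from [ncov_pow_ge]. *)
Definition weight_bound : R := (\sum_i `|theta i| * (Num.sqrt ((q i)`!)%:R * 2)) ^+ 2.

(** The rate of [mart_cos_rate] with S = 6 and B = [quad_const]; the sample enters only through L
    and n. *)
Definition charfun_rate (l m : R) : R :=
  weight_bound * Num.sqrt (var_const (@quad_const R) 6 Mx Mx * (l^-1 + m^-1)) +
  (1 + 2 * (@quad_const R * weight_bound ^+ 2 * (19 * expR 1 * @quad_const R) ^+ Mx))
    / Num.sqrt m.

Lemma charfun_bound alpha :
  `|expect P (fun w => cos (\sum_i theta i *
       normalized_Ustat (covariance_mx P Y0) (q i) h X w + alpha))
    - expR (- (\sum_i theta i ^+ 2 / falling_ratio R (q i) n) / 2) * cos alpha|
  <= charfun_rate L%:R n%:R.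
Proof.
(* The increments of a polynomial of degree q have coefficients of degree q - 1; positivity of the
   degrees keeps the shift injective. *)
pose m i := (q i).-1; pose b i := theta i * stat_scale (q i).
have mS i : (m i).+1 = q i by rewrite prednK.
have m_inj : injective m.
  by move=> i j ij; apply: q_inj; rewrite -mS ij mS.
have m_Mx i : (m i <= Mx)%N by apply: leq_trans (q_Mx i); rewrite -mS.
have L0 : 0 < L%:R :> R by rewrite ltr0n.
have b_sum : (\sum_i `|b i|) ^+ 2 <= weight_bound / L%:R.
  have -> : weight_bound / L%:R =
      ((\sum_i `|theta i| * (Num.sqrt ((q i)`!)%:R * 2)) / Num.sqrt L%:R) ^+ 2.
    by rewrite expr_div_n sqr_sqrtr.
  have sL : 0 < Num.sqrt L%:R :> R by rewrite sqrtr_gt0.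
  apply: lerXn2r; rewrite ?nnegrE ?sumr_ge0 ?divr_ge0 ?sumr_ge0 ?sqrtr_ge0//.
  rewrite mulr_suml; apply: ler_sum => i _.
  rewrite /b normrM -mulrA; apply: ler_wpM2l => //.
  rewrite /stat_scale ger0_norm; last first.
    by rewrite !mulr_ge0 ?invr_ge0 ?sqrtr_ge0// /falling_ratio divr_ge0.
  apply: ler_pM; rewrite ?invr_ge0 ?mulr_ge0 ?sqrtr_ge0//.
  - by rewrite invr_ge0 /falling_ratio divr_ge0.
  - by apply: ler_wpM2l => //; exact: sqrtr_ge0.
  - rewrite lef_pV2 ?posrE ?sqrtr_gt0 ?V0//; apply: ler_wsqrtr; exact: ncov_pow_ge.
have B1 := @quad_const_ge1 R.
have S1 : 1 <= 6 :> R by rewrite ler1n.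
have beta0 : 0 <= weight_bound by exact: sqr_ge0.
have := mart_cos_rate n_gt0 Gm Gs Hn Gi obs_next obs_L4 obs_mean obs_cov B1 S1
  obs_4 ncov_sum ncov_le1 obs_quad L_gt0 m_Mx beta0 b_sum alpha.
rewrite (cond_var_mean_sum Gs Hn Gi obs_next obs_L4 obs_mean obs_cov b m_inj).
have -> : \sum_i b i ^+ 2 * ('C(n, (m i).+1)%:R *
     \sum_l \sum_l' (ncov l l' / n%:R) ^+ (m i).+1) =
     \sum_i theta i ^+ 2 / falling_ratio R (q i) n.
  by apply: eq_bigr => i _; rewrite mS /b exprMn -mulrA stat_scale_sqr.
rewrite mulNr.
have -> : (fun w => cos (mart obs m b n w + alpha)) = (fun w => cos (\sum_i theta i *
       normalized_Ustat (covariance_mx P Y0) (q i) h X w + alpha)).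
  apply/funext => w; congr (cos (_ + _)); rewrite martE; apply: eq_bigr => i _.
  by rewrite normalized_UstatE// /b mS mulrA.
by [].
Qed.

End several_statistics.

End normalized_sample.

(** * Asymptotics *)

Section limits.
Variable R : realType.

Lemma inv_natr_cvg0 (u : nat -> nat) : u n @[n --> \oo] --> \oo ->
  ((u n)%:R^-1 : R) @[n --> \oo] --> 0.
Proof.
move=> u_oo; have /cvgrnyP u_y := u_oo.
apply: (proj2 (gtr0_cvgV0 _)); last exact: u_y.
have h : nbhs \oo [set m : nat | (0 < m)%N] by exists 1.
have h' : nbhs \oo [set n | (0 < u n)%N] := u_oo _ h.
by apply: filterS h' => n /=; rewrite ltr0n.
Qed.

(** Passing from q to q + 1 multiplies the ratio by (n - q) / n. *)
Lemma falling_ratio_cvg q : falling_ratio R q n @[n --> \oo] --> (1 : R).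
Proof.
elim: q => [|q IH].
  rewrite (_ : falling_ratio R 0 = fun=> 1); first exact: cvg_cst.
  by apply/funext => n; rewrite /falling_ratio ffactn0 expr0 invr1 mulr1.
rewrite (_ : falling_ratio R q.+1 = fun n => falling_ratio R q n * ((n - q)%N%:R / n%:R)).
  rewrite -[X in _ --> X](mulr1 1); apply: cvgM => //.
  have h : (1 - q%:R * n%:R^-1 : R) @[n --> \oo] --> (1 - q%:R * 0 : R).
    apply: cvgB; first exact: cvg_cst.
    by apply: cvgM; [exact: cvg_cst|exact: (@inv_natr_cvg0 id (fun A h => h))].
  rewrite mulr0 subr0 in h; apply: cvg_trans h; apply: near_eq_cvg.
  near=> n.
  have qn : (q < n)%N by near: n; exists q.+1.
  have n0 : (n%:R : R) != 0 by rewrite pnatr_eq0 -lt0n (leq_trans _ qn).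
  by rewrite natrB ?(ltnW qn)// mulrBl divff.
apply/funext => n; rewrite /falling_ratio ffactnSr natrM exprSr invfM.
by rewrite mulrACA.
Unshelve. all: by end_near.
Qed.

Lemma falling_ratioV_cvg q : (falling_ratio R q n)^-1 @[n --> \oo] --> (1 : R).
Proof.
rewrite -[X in _ --> X]invr1.
by apply: cvgV; [exact: oner_neq0|exact: falling_ratio_cvg].
Qed.

Lemma sqrt_cvg0 (u : nat -> R) : u n @[n --> \oo] --> 0 ->
  Num.sqrt (u n) @[n --> \oo] --> 0.
Proof.
move=> u0; rewrite -[X in _ --> X](@sqrtr0 R).
exact: (continuous_cvg _ (@sqrt_continuous R 0) u0).
Qed.

Lemma charfun_rate_cvg0 (I : finType) (q : I -> nat) (theta : I -> R) Mx (L : nat -> nat) :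
    L n @[n --> \oo] --> \oo ->
  charfun_rate q theta Mx (L n)%:R n%:R @[n --> \oo] --> 0.
Proof.
move=> L_oo; rewrite /charfun_rate.
have iL := inv_natr_cvg0 L_oo.
have iN : ((n%:R : R)^-1) @[n --> \oo] --> 0.
  by exact: (@inv_natr_cvg0 id (fun A h => h)).
rewrite -[X in _ --> X]addr0; apply: cvgD.
  rewrite -[X in _ --> X](mulr0 (weight_bound q theta)).
  apply: cvgM; first exact: cvg_cst.
  apply: sqrt_cvg0; set v := var_const _ _ _ _.
  rewrite -[X in _ --> X](mulr0 v) -[X in _ --> v * X](addr0 0).
  by apply: cvgM; [exact: cvg_cst|exact: cvgD].
set v := 1 + _; rewrite -[X in _ --> X](mulr0 v).
apply: cvgM; first exact: cvg_cst.
by apply: cvg_trans (sqrt_cvg0 iN); apply: near_eq_cvg; apply: nearW => n; rewrite sqrtrV.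
Qed.

Lemma cvg_of_dist (f a r : nat -> R) (l : R) :
  (\forall n \near \oo, `|f n - a n| <= r n) ->
  a n @[n --> \oo] --> l -> r n @[n --> \oo] --> 0 -> f n @[n --> \oo] --> l.
Proof.
move=> fa al r0.
have fa0 : (fun n => f n - a n) @ \oo --> 0.
  apply/norm_cvg0P; apply: (squeeze_cvgr _ (cvg_cst 0) r0).
  by apply: filterS fa => n ->; rewrite normr_ge0.
have fal : (fun n => f n - a n + a n) @ \oo --> 0 + l by exact: cvgD.
rewrite add0r in fal.
by rewrite (_ : f = fun n => f n - a n + a n)//; apply/funext => n; rewrite subrK.
Qed.

End limits.

Section joint_cdf.
Context {R : realType} d (T : measurableType d) (P : probability T R).
Variables (I : finType) (G : I -> T -> R).
Hypothesis mG : forall i, measurable_fun setT (G i).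

Lemma joint_cdfE (t : I -> R) :
  joint_cdf P G t = (expect P (fun w => orthant t (fun i => G i w)))%:E.
Proof. by rewrite (orthant_expect P mG) fineK// fin_num_measure//; exact: orthant_set_measurable. Qed.

End joint_cdf.

(** Checked coordinate by coordinate. It turns continuity of a joint distribution function at [t]
    into continuity along the diagonal, the form that [levy_orthant] takes. *)
Lemma cvg_ptws_shift (R : realType) (I : finType) (t : {ptws I -> R}) :
  ((fun i => t i + s) : {ptws I -> R}) @[s --> (0 : R)] --> t.
Proof.
apply/cvg_sup => i.
rewrite cvg_image; last by rewrite eqEsubset; split=> v // _; exists (cst v).
move=> W /= tW.
have : (t i + s) @[s --> (0 : R)] --> t i.
  rewrite -[X in _ --> X]addr0; apply: cvgD; [exact: cvg_cst|exact: cvg_id].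
move=> /(_ W tW) h; exists (@^~ i @^-1` W) => //.
by rewrite eqEsubset; split => [j [? + <-//]|j Wj]; exists (fun _ => j).
Qed.

Section standard_normal.
Variable R : realType.
Local Notation N01 := (normal_prob 0 1 : probability (measurableTypeR R) R).

Lemma standard_normal_sqr d (T : measurableType d) (P : probability T R) (G : T -> R) :
    measurable_fun setT G ->
    (forall A : set R, measurable A -> P (G @^-1` A) = normal_prob 0 1 A) ->
  intble P (fun w => G w ^+ 2) /\
  expect P (fun w => G w ^+ 2) = expect N01 (fun x => x ^+ 2).
Proof.
move=> mG law.
have mf : measurable_fun setT (fun x : measurableTypeR R => x ^+ 2 : R).
  by apply: measurable_funX; exact: measurable_id.
exact: (@eq_law_moment _ _ _ P _ _ N01 _ (measurableTypeR R) G id _ mG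
  (@measurable_id _ _ _) mf law (normal_sqr_intble R)).
Qed.

End standard_normal.

Section asymptotic_normality.
Context {R : realType} (d : nat -> measure_display)
  (Omega : forall n : nat, measurableType (d n))
  (P : forall n : nat, probability (Omega n) R)
  (p L : nat -> nat)
  (X : forall n : nat, 'I_n -> {RV (P n) >-> (p n).-tuple R})
  (h : forall n : nat, 'I_(L n) -> {mfun (p n).-tuple R >-> R})
  (Y0 : forall n : nat, {RV (P n) >-> (L n).-tuple R})
  (Cp : nat -> R) (C kappa : R).
Arguments X : clear implicits.
Arguments h : clear implicits.
Arguments Y0 : clear implicits.
Hypothesis L_infty : L n @[n --> \oo] --> \oo.
Hypothesis X_iid : forall n : nat,
  iid (P n) (fun i : 'I_n => X n i : Omega n -> (p n).-tuple R).
Hypothesis Y_copies : forall (n : nat) (i : 'I_n),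
  eq_in_distribution (P n) (fun w => [tuple h n l (X n i w) | l < L n])
    (Y0 n : Omega n -> (L n).-tuple R).
Hypothesis Cp_gt0 : forall n : nat, 0 < Cp n.
Hypothesis trace_lb : forall n : nat,
  Cp n * (L n)%:R <= \tr (covariance_mx (P n) (Y0 n)).
Hypothesis fourth_moment : forall n : nat,
  (ereal_sup [set 'E_(P n)[fun w => (tnth (Y0 n w) l ^+ 4)%R]
             | l in [set: 'I_(L n)]] < C%:E)%E.
Hypothesis kappa_gt2 : 2 < kappa.
Hypothesis cumulant_decay : forall (n u : nat) (l : 'I_u -> 'I_(L n)),
  (2 <= u <= 4)%N ->
  `|joint_cumulant (P n) (fun (a : 'I_u) w => tnth (Y0 n w) (l a))|
  <= Cp n `^ (u%:R / 2) * (maxn 1 (index_spread l))%:R `^ (- kappa).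
Hypothesis null_hypothesis : forall (n : nat) (l : 'I_(L n)),
  ('E_(P n)[fun w => tnth (Y0 n w) l] = 0)%E.

Let U n q : Omega n -> R :=
  normalized_Ustat (covariance_mx (P n) (Y0 n)) q (h n) (X n).
Arguments U : clear implicits.

Lemma normalized_Ustat_measurable n q : measurable_fun setT (U n q).
Proof.
apply: measurable_funM; first exact: measurable_cst.
apply: measurable_sum => l; apply: measurable_funM; first exact: measurable_cst.
under eq_fun do rewrite -big_filter.
apply: measurable_sum => i; apply: measurable_prod => a _.
exact: measurableT_comp.
Qed.

Section finite_family.
Variables (I : finType) (q : I -> nat).
Hypothesis q_gt0 : forall i, (0 < q i)%N.
Hypothesis q_even : forall i, ~~ odd (q i).
Hypothesis q_inj : injective q.

(** Holds for all but finitely many n; the bound 2 stands for the limit 1 of the inverse ratios and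
    bounds the second moments uniformly. *)
Let large n := [/\ (0 < n)%N, (0 < L n)%N, forall i, (q i <= n)%N &
  forall i, (falling_ratio R (q i) n)^-1 <= 2].

Let near_large : \forall n \near \oo, large n.
Proof.
have h1 : \forall n \near \oo, (0 < n)%N by exists 1.
have h1' : nbhs \oo [set m : nat | (0 < m)%N] by exists 1.
have h2 : \forall n \near \oo, (0 < L n)%N := L_infty h1'.
have h3 : \forall n \near \oo, forall i, (q i <= n)%N.
  by apply: filter_forall => i; exists (q i).
have h4 : \forall n \near \oo, forall i, (falling_ratio R (q i) n)^-1 <= 2.
  apply: filter_forall => i.
  by apply: (cvgr_le _ (falling_ratioV_cvg (q i))); rewrite ltr1n.
by near=> n; split; near: n.
Unshelve. all: by end_near.
Qed.

Lemma charfun_cvg_normal (theta : I -> R) alpha :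
  expect (P n) (fun w => cos (\sum_i theta i * U n (q i) w + alpha)) @[n --> \oo] -->
  expR (- (\sum_i theta i ^+ 2 / 2)) * cos alpha.
Proof.
pose Mx := \max_i q i.
apply: (@cvg_of_dist _ _ (fun n => expR (- (\sum_i theta i ^+ 2 / falling_ratio R (q i) n) / 2)
   * cos alpha) (fun n => charfun_rate q theta Mx (L n)%:R n%:R)).
- apply: filterS near_large => n [n0 L0 qn qr].
  apply: (charfun_bound (X_iid n) (@Y_copies n) (Cp_gt0 n) (trace_lb n)
    (fourth_moment n) kappa_gt2 (@cumulant_decay n) (@null_hypothesis n) n0 L0) => //.
  by move=> i; exact: leq_bigmax.
- apply: cvgM; last exact: cvg_cst.
  apply: continuous_cvg; first exact: continuous_expR.
  rewrite -mulr_suml -mulNr; apply: cvgM; last exact: cvg_cst.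
  apply: cvgN; apply: cvg_big => [|i _]; first exact: add_continuous.
  rewrite -[theta i ^+ 2 in X in _ --> X]mulr1; apply: cvgM; first exact: cvg_cst.
  exact: falling_ratioV_cvg.
- exact: charfun_rate_cvg0.
Qed.

(** One statement for both claims of the theorem: the limit may be any vector with standard normal
    coordinates and the product characteristic function, so each claim can supply its own. *)
Lemma joint_cdf_cvg d' (T' : measurableType d') (P' : probability T' R)
    (G : I -> T' -> R) (t : {ptws I -> R}) :
    (forall i, measurable_fun setT (G i)) ->
    (forall i (A : set R), measurable A -> P' (G i @^-1` A) = normal_prob 0 1 A) ->
    (forall (theta : I -> R) (alpha : R),
      expect P' (fun w => cos (\sum_i theta i * G i w + alpha)) =
      expR (- (\sum_i theta i ^+ 2 / 2)) * cos alpha) ->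
    joint_cdf P' G (fun i => t i + s) @[s --> (0 : R)] --> joint_cdf P' G t ->
  joint_cdf (P n) (fun i => U n (q i)) t @[n --> \oo] --> joint_cdf P' G t.
Proof.
move=> mG law cosG ct.
pose m2 := expect (normal_prob 0 1 : probability (measurableTypeR R) R) (fun x => x ^+ 2).
have mU n i : measurable_fun setT (U n (q i)) by exact: normalized_Ustat_measurable.
rewrite (joint_cdfE P' mG).
rewrite (_ : (fun n => _) = fun n =>
    (expect (P n) (fun w => orthant t (fun i => U n (q i) w)))%:E); last first.
  by apply/funext => n; exact: (joint_cdfE (P n) (mU n)).
apply: cvg_EFin; first by apply: nearW.
(* The common bound is 2 for the statistics, by [large], and [m2] for the limit. *)
apply: (levy_orthant mU mG (K := Num.max 2 m2)).
- apply: filterS near_large => n [n0 L0 qn qr] i; split.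
    apply: L4_sqr; apply: (normalized_Ustat_L4 (X_iid n) (@Y_copies n) (Cp_gt0 n) (trace_lb n)
    (fourth_moment n) kappa_gt2 (@cumulant_decay n) (@null_hypothesis n) n0 L0) => //.
  rewrite /U (normalized_Ustat_sqr (X_iid n) (@Y_copies n) (Cp_gt0 n) (trace_lb n)
    (fourth_moment n) kappa_gt2 (@cumulant_decay n) (@null_hypothesis n) n0 L0)//.
  by rewrite le_max qr.
- move=> i; have [I2 E2] := standard_normal_sqr (mG i) (law i).
  by split=> //; rewrite E2 le_max lexx orbT.
- by move=> theta alpha; rewrite cosG; exact: charfun_cvg_normal.
- rewrite (joint_cdfE P' mG) in ct.
  apply: cvg_trans (fine_cvg ct); apply: near_eq_cvg; apply: nearW => s.
  by rewrite /= (joint_cdfE P' mG).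
Qed.

End finite_family.

End asymptotic_normality.

Theorem theorem3p1 (R : realType)
  (d : nat -> measure_display) (Omega : forall n : nat, measurableType (d n))
  (P : forall n : nat, probability (Omega n) R)
  (p L : nat -> nat)
  (X : forall n : nat, 'I_n -> {RV (P n) >-> (p n).-tuple R})
  (h : forall n : nat, 'I_(L n) -> {mfun (p n).-tuple R >-> R})
  (Y0 : forall n : nat, {RV (P n) >-> (L n).-tuple R})
  (Cp : nat -> R) (C kappa : R)
  (p_infty : p n @[n --> \oo] --> \oo)
  (L_infty : L n @[n --> \oo] --> \oo)
  (X_iid : forall n : nat,
     iid (P n) (fun i : 'I_n => X n i : Omega n -> (p n).-tuple R))
  (Y_copies : forall (n : nat) (i : 'I_n),
     eq_in_distribution (P n)
       (fun w => [tuple h n l (X n i w) | l < L n])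
       (Y0 n : Omega n -> (L n).-tuple R))
  (Cp_gt0 : forall n : nat, 0 < Cp n)
  (trace_lb : forall n : nat,
     Cp n * (L n)%:R <= \tr (covariance_mx (P n) (Y0 n)))
  (fourth_moment : forall n : nat,
     (ereal_sup [set 'E_(P n)[fun w => (tnth (Y0 n w) l ^+ 4)%R]
                | l in [set: 'I_(L n)]] < C%:E)%E)
  (kappa_gt2 : 2 < kappa)
  (cumulant_decay : forall (n u : nat) (l : 'I_u -> 'I_(L n)),
     (2 <= u <= 4)%N ->
     `|joint_cumulant (P n) (fun (a : 'I_u) w => tnth (Y0 n w) (l a))|
     <= Cp n `^ (u%:R / 2) * (maxn 1 (index_spread l))%:R `^ (- kappa))
  (null_hypothesis : forall (n : nat) (l : 'I_(L n)),
     ('E_(P n)[fun w => tnth (Y0 n w) l] = 0)%E) :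
  (forall q : nat, (0 < q)%N -> ~~ odd q ->
     cvg_to_law P
       (fun n => normalized_Ustat (covariance_mx (P n) (Y0 n)) q (h n) (X n))
       (normal_prob 0 1)) /\
  (forall I : {fset nat}, (forall q, q \in I -> (0 < q)%N && ~~ odd q) ->
     cvg_to_independent_normals P
       (fun n (q : I) =>
          normalized_Ustat (covariance_mx (P n) (Y0 n)) (val q) (h n) (X n))).
Proof.
split=> [q q_gt0 q_even t t_cont|I I_even].
  (* A single statistic is a family indexed by ['I_1], and its limit is the identity on the line
     under the normal law. *)
  pose N01 : probability (measurableTypeR R) R := normal_prob 0 1.
  have cdf s : joint_cdf N01 (fun (_ : 'I_1) (x : measurableTypeR R) => x) (fun=> s) =
      normal_prob 0 1 `]-oo, s].
    congr (normal_prob 0 1 _); apply/seteqP; split => x /=; rewrite in_itv/=.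
      by apply; exact: ord0.
    by [].
  have cdfU n : joint_cdf (P n) (fun (_ : 'I_1) =>
      normalized_Ustat (covariance_mx (P n) (Y0 n)) q (h n) (X n)) (fun=> t) =
      P n [set w | normalized_Ustat (covariance_mx (P n) (Y0 n)) q (h n) (X n) w <= t].
    congr (P n _); apply/seteqP; split => w /=; first by apply; exact: ord0.
    by [].
  rewrite -cdf; under eq_fun do rewrite -cdfU.
  apply: (joint_cdf_cvg (q := fun=> q) L_infty X_iid Y_copies Cp_gt0 trace_lb
    fourth_moment kappa_gt2 cumulant_decay null_hypothesis) => //.
  - by move=> i j _; rewrite !ord1.
  - move=> theta alpha; rewrite big_ord1 -normal_charfun.
    by apply: expect_ext => x; rewrite big_ord1.
  - under eq_fun do rewrite cdf; rewrite cdf.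
    have shift : t + s @[s --> (0 : R)] --> t.
      rewrite -[X in _ --> X]addr0; apply: cvgD; [exact: cvg_cst|exact: cvg_id].
    exact: (cvg_comp _ _ shift t_cont).
have [d' [T' [P' [G [G_indep G_law G_cos]]]]] := exists_independent_normals R I.
exists d', T', P', G; split=> // t t_cont.
apply: (joint_cdf_cvg (q := fun i : I => val i) L_infty X_iid Y_copies Cp_gt0 trace_lb
    fourth_moment kappa_gt2 cumulant_decay null_hypothesis) => //.
- by move=> i; case/andP: (I_even _ (valP i)).
- by move=> i; case/andP: (I_even _ (valP i)).
- exact: (cvg_comp _ _ (@cvg_ptws_shift _ _ t) t_cont).
Qed.
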